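(* Let $-\infty<a<c<b<d<\infty$ and let $u_a,u_b,\rho_c,\rho_d$ be real constants. For $\epsilon>0$ let $(u^\epsilon,\rho^\epsilon)$ be the solution (specified in the context via the Hopf--Cole transformation) of $$u^\epsilon_t+\Big(\tfrac{(u^\epsilon)^2}{2}\Big)_x=\tfrac{\epsilon}{2}u^\epsilon_{xx},\qquad \rho^\epsilon_t+(\rho^\epsilon u^\epsilon)_x=\tfrac{\epsilon}{2}\rho^\epsilon_{xx},\qquad (x,t)\in\mathbf{R}\times(0,\infty),$$ $$u^\epsilon|_{t=0}=u_a\,\delta_{x=a}+u_b\,\delta_{x=b},\qquad \rho^\epsilon|_{t=0}=\rho_c\,\delta_{x=c}+\rho_d\,\delta_{x=d}.$$ Then, in each of the six cases below, $\lim_{\epsilon\to0}(u^\epsilon,\rho^\epsilon)=(u,\rho)$, where $u^\epsilon(x,t)\to u(x,t)$ pointwise for every $t>0$ and every $x$ in the open intervals listed in the definition of $u(\cdot,t)$, where $\rho^\epsilon\to\rho$ in the sense of distributions, where $$\rho=\rho_c\,\delta_{x=\gamma_c(t)}+\rho_d\,\delta_{x=\gamma_d(t)},$$ and where $u$, $\gamma_c$, $\gamma_d$ are given as follows. **Case 1: $u_a<0$, $u_b>0$.** For $t\ge0$ put $\gamma_a(t)=a-\sqrt{-2u_at}$, $\gamma_b(t)=b+\sqrt{2u_bt}$, $\gamma_c(t)=c$, and $$\gamma_d(t)=\begin{cases}d,&0\le t\le\frac{(d-b)^2}{2u_b},\\ b+\sqrt{2u_bt},&t\ge\frac{(d-b)^2}{2u_b}.\end{cases}$$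 Then $$u(x,t)=\begin{cases}0,&x\in(-\infty,\gamma_a(t))\cup(a,b)\cup(\gamma_b(t),\infty),\\ \frac{x-a}{t},&x\in(\gamma_a(t),a),\\ \frac{x-b}{t},&x\in(b,\gamma_b(t)).\end{cases}$$ **Case 2: $u_a>0$, $u_b>0$.** Put $$t_1=\frac{(b-a)^2}{2u_a},\qquad t_{a,2}=t_{c,3}=\frac{(d-a)^2}{2(\sqrt{u_a+u_b}-\sqrt{u_b})^2},$$ $$(x^*,t^* )=\left(b+\frac{(b-a)\sqrt{u_b}}{\sqrt{u_a+u_b}-\sqrt{u_b}},\ \frac{(b-a)^2}{2(\sqrt{u_a+u_b}-\sqrt{u_b})^2}\right),$$ and $$\gamma_a(t)=\begin{cases}a+\sqrt{2u_at},&0\le t\le t_1,\\ \frac{a+b}{2}+\frac{u_a}{b-a}t,&t_1\le t\le t_{a,2},\\ a+\sqrt{2(u_a+u_b)t},&t\ge t_{a,2},\end{cases}\qquad \gamma_{b,1}(t)=\begin{cases}b,&0\le t\le t_1,\\ \frac{a+b}{2}+\frac{u_a}{b-a}t,&t_1\le t\le t^*,\\ a+\sqrt{2(u_a+u_b)t},&t\ge t^*,\end{cases}$$ $$\gamma_{b,2}(t)=\begin{cases}b+\sqrt{2u_bt},&0\le t\le t^*,\\ a+\sqrt{2(u_a+u_b)t},&t\ge t^*,\end{cases}\qquad \gamma_c(t)=\begin{cases}c,&0\le t\le\frac{(c-a)^2}{2u_a},\\ a+\sqrt{2u_at},&\frac{(c-a)^2}{2u_a}\le t\le t_1,\\ \frac{a+b}{2}+\frac{u_a}{b-a}t,&t_1\le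 t\le t_{c,3},\\ a+\sqrt{2(u_a+u_b)t},&t\ge t_{c,3}.\end{cases}$$ The curve $\gamma_d$ is defined by: - if $d<x^*$: $\gamma_d(t)=d$ for $0\le t\le\frac{(d-b)^2}{2u_b}$; $\gamma_d(t)=b+\sqrt{2u_bt}$ for $\frac{(d-b)^2}{2u_b}\le t\le t^*$; $\gamma_d(t)=a+\sqrt{2(u_a+u_b)t}$ for $t\ge t^*$; - if $d=x^*$: $\gamma_d(t)=d$ for $0\le t\le t^*$; $\gamma_d(t)=a+\sqrt{2(u_a+u_b)t}$ for $t\ge t^*$; - if $d>x^*$: $\gamma_d(t)=d$ for $0\le t\le t_d$; $\gamma_d(t)=a+\sqrt{2(u_a+u_b)t}$ for $t\ge t_d$, where $t_d=\frac{(d-b)^2}{2u_b}$. Then $$u(x,t)=\begin{cases}0,&x\in(-\infty,a)\cup(\gamma_a(t),\gamma_{b,1}(t))\cup(\gamma_{b,2}(t),\infty),\\ \frac{x-a}{t},&x\in(a,\gamma_a(t)),\\ \frac{x-b}{t},&x\in(\gamma_{b,1}(t),\gamma_{b,2}(t)).\end{cases}$$ **Case 3: $u_a>0$, $u_b<0$, $u_a+u_b>0$.** Put $$(x^*,t^* )=\left(a+\frac{(b-a)\sqrt{u_a}}{\sqrt{u_a}+\sqrt{-u_b}},\ \frac{(b-a)^2}{2(\sqrt{u_a}+\sqrt{-u_b})^2}\right),\qquad t_2=\frac{(b-a)^2}{2(u_a+u_b)},$$ and $$\gamma_a(t)=\begin{cases}a+\sqrt{2u_at},&0\le t\le t^*,\\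 \frac{a+b}{2}+\frac{u_a+u_b}{b-a}t,&t^*\le t\le t_2,\\ a+\sqrt{2(u_a+u_b)t},&t\ge t_2,\end{cases}\qquad \gamma_{b,1}(t)=\begin{cases}b-\sqrt{-2u_bt},&0\le t\le t^*,\\ \frac{a+b}{2}+\frac{u_a+u_b}{b-a}t,&t^*\le t\le t_2,\\ a+\sqrt{2(u_a+u_b)t},&t\ge t_2,\end{cases}$$ $$\gamma_{b,2}(t)=\begin{cases}b,&0\le t\le t_2,\\ a+\sqrt{2(u_a+u_b)t},&t\ge t_2,\end{cases}\qquad \gamma_d(t)=\begin{cases}d,&0\le t\le\frac{(d-a)^2}{2(u_a+u_b)},\\ a+\sqrt{2(u_a+u_b)t},&t\ge\frac{(d-a)^2}{2(u_a+u_b)}.\end{cases}$$ The curve $\gamma_c$ is defined by: - if $c<x^*$: $\gamma_c(t)=c$ for $0\le t\le\frac{(c-a)^2}{2u_a}$; $\gamma_c(t)=a+\sqrt{2u_at}$ for $\frac{(c-a)^2}{2u_a}\le t\le t^*$; $\gamma_c(t)=\frac{a+b}{2}+\frac{u_a+u_b}{b-a}t$ for $t^*\le t\le t_2$; $\gamma_c(t)=a+\sqrt{2(u_a+u_b)t}$ for $t\ge t_2$; - if $c=x^*$: $\gamma_c(t)=c$ for $0\le t\le t^*$; $\gamma_c(t)=\frac{a+b}{2}+\frac{u_a+u_b}{b-a}t$ for $t^*\le t\le t_2$; $\gamma_c(t)=a+\sqrt{2(u_a+u_b)t}$ for $t\ge t_2$; - if $c>x^*$: $\gamma_c(t)=c$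 for $0\le t\le\frac{(b-c)^2}{-2u_b}$; $\gamma_c(t)=b-\sqrt{-2u_bt}$ for $\frac{(b-c)^2}{-2u_b}\le t\le t^*$; $\gamma_c(t)=\frac{a+b}{2}+\frac{u_a+u_b}{b-a}t$ for $t^*\le t\le t_2$; $\gamma_c(t)=a+\sqrt{2(u_a+u_b)t}$ for $t\ge t_2$. Then $$u(x,t)=\begin{cases}0,&x\in(-\infty,a)\cup(\gamma_a(t),\gamma_{b,1}(t))\cup(\gamma_{b,2}(t),\infty),\\ \frac{x-a}{t},&x\in(a,\gamma_a(t)),\\ \frac{x-b}{t},&x\in(\gamma_{b,1}(t),\gamma_{b,2}(t)).\end{cases}$$ **Case 4: $u_a>0$, $u_b<0$, $u_a+u_b<0$.** Put $$(x^*,t^* )=\left(a+\frac{(b-a)\sqrt{u_a}}{\sqrt{u_a}+\sqrt{-u_b}},\ \frac{(b-a)^2}{2(\sqrt{u_a}+\sqrt{-u_b})^2}\right),\qquad t_2=\frac{(b-a)^2}{-2(u_a+u_b)},$$ and $$\gamma_{a,1}(t)=\begin{cases}a,&0\le t\le t_2,\\ b-\sqrt{-2(u_a+u_b)t},&t\ge t_2,\end{cases}\qquad \gamma_{a,2}(t)=\begin{cases}a+\sqrt{2u_at},&0\le t\le t^*,\\ \frac{a+b}{2}+\frac{u_a+u_b}{b-a}t,&t^*\le t\le t_2,\\ b-\sqrt{-2(u_a+u_b)t},&t\ge t_2,\end{cases}$$ $$\gamma_b(t)=\begin{cases}b-\sqrt{-2u_bt},&0\le t\le t^*,\\ \frac{a+b}{2}+\frac{u_a+u_b}{b-a}t,&t^*\le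 t\le t_2,\\ b-\sqrt{-2(u_a+u_b)t},&t\ge t_2,\end{cases}\qquad \gamma_d(t)=d\ \ (t\ge0).$$ The curve $\gamma_c$ is defined by: - if $c<x^*$: $\gamma_c(t)=c$ for $0\le t\le\frac{(c-a)^2}{2u_a}$; $\gamma_c(t)=a+\sqrt{2u_at}$ for $\frac{(c-a)^2}{2u_a}\le t\le t^*$; $\gamma_c(t)=\frac{a+b}{2}+\frac{u_a+u_b}{b-a}t$ for $t^*\le t\le t_2$; $\gamma_c(t)=b-\sqrt{-2(u_a+u_b)t}$ for $t\ge t_2$; - if $c=x^*$: $\gamma_c(t)=c$ for $0\le t\le t^*$; $\gamma_c(t)=\frac{a+b}{2}+\frac{u_a+u_b}{b-a}t$ for $t^*\le t\le t_2$; $\gamma_c(t)=b-\sqrt{-2(u_a+u_b)t}$ for $t\ge t_2$; - if $c>x^*$: $\gamma_c(t)=c$ for $0\le t\le\frac{(b-c)^2}{-2u_b}$; $\gamma_c(t)=b-\sqrt{-2u_bt}$ for $\frac{(b-c)^2}{-2u_b}\le t\le t^*$; $\gamma_c(t)=\frac{a+b}{2}+\frac{u_a+u_b}{b-a}t$ for $t^*\le t\le t_2$; $\gamma_c(t)=b-\sqrt{-2(u_a+u_b)t}$ for $t\ge t_2$. Then $$u(x,t)=\begin{cases}0,&x\in(-\infty,\gamma_{a,1}(t))\cup(\gamma_{a,2}(t),\gamma_b(t))\cup(b,\infty),\\ \frac{x-a}{t},&x\in(\gamma_{a,1}(t),\gamma_{a,2}(t)),\\ \frac{x-b}{t},&x\in(\gamma_b(t),b).\end{cases}$$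 **Case 5: $u_a>0$, $u_b<0$, $u_a+u_b=0$.** Put $t^*=\frac{(b-a)^2}{2(\sqrt{u_a}+\sqrt{-u_b})^2}$ and $$\gamma_a(t)=\begin{cases}a+\sqrt{2u_at},&0\le t\le t^*,\\ \frac{a+b}{2},&t\ge t^*,\end{cases}\qquad \gamma_b(t)=\begin{cases}b-\sqrt{-2u_bt},&0\le t\le t^*,\\ \frac{a+b}{2},&t\ge t^*,\end{cases}\qquad \gamma_d(t)=d\ \ (t\ge0).$$ The curve $\gamma_c$ is defined by: - if $c<\frac{a+b}{2}$: $\gamma_c(t)=c$ for $0\le t\le\frac{(c-a)^2}{2u_a}$; $\gamma_c(t)=a+\sqrt{2u_at}$ for $\frac{(c-a)^2}{2u_a}\le t\le t^*$; $\gamma_c(t)=\frac{a+b}{2}$ for $t\ge t^*$; - if $c=\frac{a+b}{2}$: $\gamma_c(t)=\frac{a+b}{2}$ for all $t\ge0$; - if $c>\frac{a+b}{2}$: $\gamma_c(t)=c$ for $0\le t\le\frac{(b-c)^2}{-2u_b}$; $\gamma_c(t)=b-\sqrt{-2u_bt}$ for $\frac{(b-c)^2}{-2u_b}\le t\le t^*$; $\gamma_c(t)=\frac{a+b}{2}$ for $t\ge t^*$. Then $$u(x,t)=\begin{cases}0,&x\in(-\infty,a)\cup(\gamma_a(t),\gamma_b(t))\cup(b,\infty),\\ \frac{x-a}{t},&x\in(a,\gamma_a(t)),\\ \frac{x-b}{t},&x\in(\gamma_b(t),b).\end{cases}$$ **Case 6: $u_a<0$, $u_b<0$.** Put $t_1=\frac{(b-a)^2}{-2u_b}$,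 $t_2=\frac{(b-a)^2}{2(\sqrt{-(u_a+u_b)}-\sqrt{-u_a})^2}$, and $$\gamma_{a,1}(t)=\begin{cases}a-\sqrt{-2u_at},&0\le t\le t_2,\\ b-\sqrt{-2(u_a+u_b)t},&t\ge t_2,\end{cases}\qquad \gamma_{a,2}(t)=\begin{cases}a,&0\le t\le t_1,\\ \frac{a+b}{2}+\frac{u_b}{b-a}t,&t_1\le t\le t_2,\\ b-\sqrt{-2(u_a+u_b)t},&t\ge t_2,\end{cases}$$ $$\gamma_b(t)=\begin{cases}b-\sqrt{-2u_bt},&0\le t\le t_1,\\ \frac{a+b}{2}+\frac{u_b}{b-a}t,&t_1\le t\le t_2,\\ b-\sqrt{-2(u_a+u_b)t},&t\ge t_2,\end{cases}\qquad \gamma_c(t)=\begin{cases}c,&0\le t\le\frac{(b-c)^2}{-2u_b},\\ b-\sqrt{-2u_bt},&\frac{(b-c)^2}{-2u_b}\le t\le t_1,\\ \frac{a+b}{2}+\frac{u_b}{b-a}t,&t_1\le t\le t_2,\\ b-\sqrt{-2(u_a+u_b)t},&t\ge t_2,\end{cases}$$ and $\gamma_d(t)=d$ for $t\ge0$. Then $$u(x,t)=\begin{cases}0,&x\in(-\infty,\gamma_{a,1}(t))\cup(\gamma_{a,2}(t),\gamma_b(t))\cup(b,\infty),\\ \frac{x-a}{t},&x\in(\gamma_{a,1}(t),\gamma_{a,2}(t)),\\ \frac{x-b}{t},&x\in(\gamma_b(t),b).\end{cases}$$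
   Context: The limit $(u,\rho)$ is called the vanishing viscosity limit for the one-dimensional zero-pressure gas dynamics system $u_t+(u^2/2)_x=0$, $\rho_t+(\rho u)_x=0$ on $\mathbf{R}\times(0,\infty)$ with initial data $u|_{t=0}=u_a\delta_{x=a}+u_b\delta_{x=b}$, $\rho|_{t=0}=\rho_c\delta_{x=c}+\rho_d\delta_{x=d}$. **The solution $(u^\epsilon,\rho^\epsilon)$.** For $\epsilon>0$, let $V^\epsilon,S^\epsilon$ be the solutions on $\mathbf{R}\times(0,\infty)$, given by convolution of the initial data with the heat kernel $(2\pi\epsilon t)^{-1/2}e^{-x^2/(2\epsilon t)}$, of $V^\epsilon_t=\frac{\epsilon}{2}V^\epsilon_{xx}$ and $S^\epsilon_t=\frac{\epsilon}{2}S^\epsilon_{xx}$ with initial data $$V^\epsilon(x,0)=\begin{cases}1,&x<a,\\ e^{-u_a/\epsilon},&a<x<b,\\ e^{-(u_a+u_b)/\epsilon},&x>b,\end{cases}\qquad S^\epsilon(x,0)=\begin{cases}0,&x<c,\\ \rho_c e^{-u_a/\epsilon},&c<x<b,\\ \rho_c e^{-(u_a+u_b)/\epsilon},&b<x<d,\\ (\rho_c+\rho_d)e^{-(u_a+u_b)/\epsilon},&x>d.\end{cases}$$ Then $$u^\epsilon=-\epsilon\,\frac{V^\epsilon_x}{V^\epsilon},\qquad R^\epsilon=\frac{S^\epsilon}{V^\epsilon},\qquad \rho^\epsilon=R^\epsilon_x.$$ **Conventions.** An interval $(p,q)$ with $p\ge q$ is empty. For a piecewise continuous curve $\gamma:[0,\infty)\to\mathbf{R}$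 (its values at finitely many break times being immaterial), $\delta_{x=\gamma(t)}$ denotes the distribution $\langle\delta_{x=\gamma(t)},\phi\rangle=\int_0^\infty\phi(\gamma(t),t)\,dt$ for $\phi\in C_c^\infty(\mathbf{R}\times[0,\infty))$. Convergence $\rho^\epsilon\to\rho$ in the sense of distributions means that for every $\phi\in C_c^\infty(\mathbf{R}\times[0,\infty))$, $$\int_0^\infty\Big(\int_{\mathbf{R}}\rho^\epsilon(x,t)\phi(x,t)\,dx\Big)dt\to\langle\rho,\phi\rangle\quad\text{as }\epsilon\to0.$$
   Formalization: In Case 2, two false formulas are corrected: t_{a,2}=t_{c,3} has (b-a)^2 in place of (d-a)^2 in the numerator (so it equals t^* ), and for d>x^* the time t_d is (d-a)^2/(2(u_a+u_b)) in place of (d-b)^2/(2u_b). *)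

(* Defs.v *)
From HB Require Import structures.
From mathcomp Require Import all_boot all_order all_algebra.
From mathcomp Require Import all_classical all_reals all_analysis.

Set Implicit Arguments.
Unset Strict Implicit.
Unset Printing Implicit Defensive.

Import Order.TTheory GRing.Theory Num.Theory.
Import numFieldNormedType.Exports.

Local Open Scope classical_set_scope.
Local Open Scope ring_scope.

(** * The Hopf--Cole solution *)

Definition heat_kernel (R : realType) (eps x t : R) : R :=
  (Num.sqrt (2 * pi * eps * t))^-1 * expR (- (x ^+ 2 / (2 * eps * t))).

Definition heat_flow (R : realType) (eps : R) (f : R -> R) (x t : R) : R :=
  \int[lebesgue_measure]_(y in [set: R]) (heat_kernel eps (x - y) t * f y).

(* The values of the initial data at the jump points are immaterial. *)
Definition V_init (R : realType) (a b ua ub eps x : R) : R :=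
  if x < a then 1
  else if x < b then expR (- (ua / eps))
  else expR (- ((ua + ub) / eps)).

Definition S_init (R : realType) (b c d ua ub rhoc rhod eps x : R) : R :=
  if x < c then 0
  else if x < b then rhoc * expR (- (ua / eps))
  else if x < d then rhoc * expR (- ((ua + ub) / eps))
  else (rhoc + rhod) * expR (- ((ua + ub) / eps)).

Definition V_visc (R : realType) (a b ua ub eps : R) : R -> R -> R :=
  heat_flow eps (V_init a b ua ub eps).

Definition S_visc (R : realType) (b c d ua ub rhoc rhod eps : R) :
    R -> R -> R :=
  heat_flow eps (S_init b c d ua ub rhoc rhod eps).

Definition u_visc (R : realType) (a b ua ub eps x t : R) : R :=
  - eps * (derive1 (fun y => V_visc a b ua ub eps y t) x
           / V_visc a b ua ub eps x t).

Definition R_visc (R : realType) (a b c d ua ub rhoc rhod eps x t : R) : R :=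
  S_visc b c d ua ub rhoc rhod eps x t / V_visc a b ua ub eps x t.

Definition rho_visc (R : realType) (a b c d ua ub rhoc rhod eps x t : R) : R :=
  derive1 (fun y => R_visc a b c d ua ub rhoc rhod eps y t) x.

(** * Test functions and convergence *)

(* Iterated partial derivative; [true] stands for d/dx, [false] for d/dt. *)
Fixpoint partial (R : realType) (w : seq bool) (phi : R -> R -> R) :
    R -> R -> R :=
  match w with
  | [::] => phi
  | true :: w' => fun x t => derive1 (fun y => partial w' phi y t) x
  | false :: w' => fun x t => derive1 (partial w' phi x) t
  end.

Definition smooth (R : realType) (phi : R -> R -> R) : Prop :=
  forall w : seq bool,
    continuous (fun p : R * R => partial w phi p.1 p.2) /\
    (forall x t : R, derivable (fun y => partial w phi y t) x 1 /\
                     derivable (partial w phi x) t 1).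

(* The space C_c^oo(R x [0, oo)): smooth functions on the plane whose
   restriction to the closed half-plane t >= 0 is compactly supported (the
   support may meet the line t = 0).  Only that restriction is ever used. *)
Definition test_function (R : realType) (phi : R -> R -> R) : Prop :=
  smooth phi /\
  (exists M : R, forall x t : R, 0 <= t -> M < `|x| \/ M < t -> phi x t = 0).

(* The action on [phi] of the distribution delta_{x = gamma(t)}. *)
Definition delta_curve (R : realType) (gamma : R -> R) (phi : R -> R -> R) : R :=
  \int[lebesgue_measure]_(t in `[0, +oo[) phi (gamma t) t.

Definition distribution_cvg (R : realType)
    (rho_ : R -> R -> R -> R) (rho : (R -> R -> R) -> R) : Prop :=
  forall phi : R -> R -> R, test_function phi ->
    \int[lebesgue_measure]_(t in `[0, +oo[)
       (\int[lebesgue_measure]_(x in [set: R]) (rho_ eps x t * phi x t))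
      @[eps --> 0^'+] --> rho phi.

(* In every regime the limit velocity vanishes on
     (-oo, g1 t), (g2 t, g3 t), (g4 t, +oo),
   equals (x - a) / t on (g1 t, g2 t) and (x - b) / t on (g3 t, g4 t). *)
Definition velocity_cvg (R : realType) (a b ua ub : R)
    (g1 g2 g3 g4 : R -> R) : Prop :=
  forall x t : R, 0 < t ->
    [/\ [|| x \in `]-oo, g1 t[, x \in `]g2 t, g3 t[ | x \in `]g4 t, +oo[] ->
          u_visc a b ua ub eps x t @[eps --> 0^'+] --> (0 : R),
        x \in `]g1 t, g2 t[ ->
          u_visc a b ua ub eps x t @[eps --> 0^'+] --> (x - a) / t
      & x \in `]g3 t, g4 t[ ->
          u_visc a b ua ub eps x t @[eps --> 0^'+] --> (x - b) / t].

Definition vanishing_viscosity_limit (R : realType)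
    (a b c d ua ub rhoc rhod : R) (g1 g2 g3 g4 gamma_c gamma_d : R -> R) :
    Prop :=
  velocity_cvg a b ua ub g1 g2 g3 g4 /\
  distribution_cvg (rho_visc a b c d ua ub rhoc rhod)
    (fun phi => rhoc * delta_curve gamma_c phi + rhod * delta_curve gamma_d phi).

(** * Building blocks of the curves *)

Definition until (R : realType) (t0 : R) (f g : R -> R) (t : R) : R :=
  if t <= t0 then f t else g t.

Definition still (R : realType) (p t : R) : R := p.

(* p + sqrt(2 w t), used for w > 0 *)
Definition forward (R : realType) (p w t : R) : R := p + Num.sqrt (2 * w * t).

(* p - sqrt(-2 w t), used for w < 0 *)
Definition backward (R : realType) (p w t : R) : R :=
  p - Num.sqrt (- 2 * w * t).

Definition chord (R : realType) (a b w t : R) : R :=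
  (a + b) / 2 + w / (b - a) * t.

(** * Case ua < 0 < ub *)
Module Case1.
Definition gamma_a (R : realType) (a ua : R) : R -> R := backward a ua.
Definition gamma_b (R : realType) (b ub : R) : R -> R := forward b ub.
Definition gamma_c (R : realType) (c : R) : R -> R := still c.
Definition gamma_d (R : realType) (b d ub : R) : R -> R :=
  until ((d - b) ^+ 2 / (2 * ub)) (still d) (forward b ub).
End Case1.

(** * Case 0 < ua, 0 < ub *)
Module Case2.
Definition t1 (R : realType) (a b ua : R) : R := (b - a) ^+ 2 / (2 * ua).
Definition xstar (R : realType) (a b ua ub : R) : R :=
  b + (b - a) * Num.sqrt ub / (Num.sqrt (ua + ub) - Num.sqrt ub).
Definition tstar (R : realType) (a b ua ub : R) : R :=
  (b - a) ^+ 2 / (2 * (Num.sqrt (ua + ub) - Num.sqrt ub) ^+ 2).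
(* The chord meets the parabola [forward a (ua + ub)] exactly at
     (b - a)^2 / (2 (sqrt (ua + ub) - sqrt ub)^2).
   The source has the misprint d - a for b - a here; with it, [gamma_a] would
   overtake [gamma_b1] and two of the intervals on which u is prescribed would
   overlap. *)
Definition ta2 (R : realType) (a b ua ub : R) : R :=
  (b - a) ^+ 2 / (2 * (Num.sqrt (ua + ub) - Num.sqrt ub) ^+ 2).
Definition tc3 (R : realType) (a b ua ub : R) : R := ta2 a b ua ub.
(* For d > xstar the particle at d is reached by [forward a (ua + ub)], whence
   this arrival time.  The source has the misprint (d - b)^2 / (2 ub), the time
   at which the curve [forward b ub], which has then already been absorbed,
   would have reached d. *)
Definition td (R : realType) (a d ua ub : R) : R :=
  (d - a) ^+ 2 / (2 * (ua + ub)).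
Definition gamma_a (R : realType) (a b ua ub : R) : R -> R :=
  until (t1 a b ua) (forward a ua)
    (until (ta2 a b ua ub) (chord a b ua) (forward a (ua + ub))).
Definition gamma_b1 (R : realType) (a b ua ub : R) : R -> R :=
  until (t1 a b ua) (still b)
    (until (tstar a b ua ub) (chord a b ua) (forward a (ua + ub))).
Definition gamma_b2 (R : realType) (a b ua ub : R) : R -> R :=
  until (tstar a b ua ub) (forward b ub) (forward a (ua + ub)).
Definition gamma_c (R : realType) (a b c ua ub : R) : R -> R :=
  until ((c - a) ^+ 2 / (2 * ua)) (still c)
    (until (t1 a b ua) (forward a ua)
      (until (tc3 a b ua ub) (chord a b ua) (forward a (ua + ub)))).
Definition gamma_d (R : realType) (a b d ua ub : R) : R -> R :=
  if d < xstar a b ua ub then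
    until ((d - b) ^+ 2 / (2 * ub)) (still d)
      (until (tstar a b ua ub) (forward b ub) (forward a (ua + ub)))
  else if d == xstar a b ua ub then
    until (tstar a b ua ub) (still d) (forward a (ua + ub))
  else
    until (td a d ua ub) (still d) (forward a (ua + ub)).
End Case2.

(** * Case ub < 0 < ua, 0 < ua + ub *)
Module Case3.
Definition xstar (R : realType) (a b ua ub : R) : R :=
  a + (b - a) * Num.sqrt ua / (Num.sqrt ua + Num.sqrt (- ub)).
Definition tstar (R : realType) (a b ua ub : R) : R :=
  (b - a) ^+ 2 / (2 * (Num.sqrt ua + Num.sqrt (- ub)) ^+ 2).
Definition t2 (R : realType) (a b ua ub : R) : R :=
  (b - a) ^+ 2 / (2 * (ua + ub)).
Definition gamma_a (R : realType) (a b ua ub : R) : R -> R :=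
  until (tstar a b ua ub) (forward a ua)
    (until (t2 a b ua ub) (chord a b (ua + ub)) (forward a (ua + ub))).
Definition gamma_b1 (R : realType) (a b ua ub : R) : R -> R :=
  until (tstar a b ua ub) (backward b ub)
    (until (t2 a b ua ub) (chord a b (ua + ub)) (forward a (ua + ub))).
Definition gamma_b2 (R : realType) (a b ua ub : R) : R -> R :=
  until (t2 a b ua ub) (still b) (forward a (ua + ub)).
Definition gamma_c (R : realType) (a b c ua ub : R) : R -> R :=
  if c < xstar a b ua ub then
    until ((c - a) ^+ 2 / (2 * ua)) (still c)
      (until (tstar a b ua ub) (forward a ua)
        (until (t2 a b ua ub) (chord a b (ua + ub)) (forward a (ua + ub))))
  else if c == xstar a b ua ub then
    until (tstar a b ua ub) (still c)
      (until (t2 a b ua ub) (chord a b (ua + ub)) (forward a (ua + ub)))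
  else
    until ((b - c) ^+ 2 / (- 2 * ub)) (still c)
      (until (tstar a b ua ub) (backward b ub)
        (until (t2 a b ua ub) (chord a b (ua + ub)) (forward a (ua + ub)))).
Definition gamma_d (R : realType) (a d ua ub : R) : R -> R :=
  until ((d - a) ^+ 2 / (2 * (ua + ub))) (still d) (forward a (ua + ub)).
End Case3.

(** * Case ub < 0 < ua, ua + ub < 0 *)
Module Case4.
Definition xstar (R : realType) (a b ua ub : R) : R :=
  a + (b - a) * Num.sqrt ua / (Num.sqrt ua + Num.sqrt (- ub)).
Definition tstar (R : realType) (a b ua ub : R) : R :=
  (b - a) ^+ 2 / (2 * (Num.sqrt ua + Num.sqrt (- ub)) ^+ 2).
Definition t2 (R : realType) (a b ua ub : R) : R :=
  (b - a) ^+ 2 / (- 2 * (ua + ub)).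
Definition gamma_a1 (R : realType) (a b ua ub : R) : R -> R :=
  until (t2 a b ua ub) (still a) (backward b (ua + ub)).
Definition gamma_a2 (R : realType) (a b ua ub : R) : R -> R :=
  until (tstar a b ua ub) (forward a ua)
    (until (t2 a b ua ub) (chord a b (ua + ub)) (backward b (ua + ub))).
Definition gamma_b (R : realType) (a b ua ub : R) : R -> R :=
  until (tstar a b ua ub) (backward b ub)
    (until (t2 a b ua ub) (chord a b (ua + ub)) (backward b (ua + ub))).
Definition gamma_c (R : realType) (a b c ua ub : R) : R -> R :=
  if c < xstar a b ua ub then
    until ((c - a) ^+ 2 / (2 * ua)) (still c)
      (until (tstar a b ua ub) (forward a ua)
        (until (t2 a b ua ub) (chord a b (ua + ub)) (backward b (ua + ub))))
  else if c == xstar a b ua ub then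
    until (tstar a b ua ub) (still c)
      (until (t2 a b ua ub) (chord a b (ua + ub)) (backward b (ua + ub)))
  else
    until ((b - c) ^+ 2 / (- 2 * ub)) (still c)
      (until (tstar a b ua ub) (backward b ub)
        (until (t2 a b ua ub) (chord a b (ua + ub)) (backward b (ua + ub)))).
Definition gamma_d (R : realType) (d : R) : R -> R := still d.
End Case4.

(** * Case ub < 0 < ua, ua + ub = 0 *)
Module Case5.
Definition tstar (R : realType) (a b ua ub : R) : R :=
  (b - a) ^+ 2 / (2 * (Num.sqrt ua + Num.sqrt (- ub)) ^+ 2).
Definition gamma_a (R : realType) (a b ua ub : R) : R -> R :=
  until (tstar a b ua ub) (forward a ua) (still ((a + b) / 2)).
Definition gamma_b (R : realType) (a b ua ub : R) : R -> R :=
  until (tstar a b ua ub) (backward b ub) (still ((a + b) / 2)).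
Definition gamma_c (R : realType) (a b c ua ub : R) : R -> R :=
  if c < (a + b) / 2 then
    until ((c - a) ^+ 2 / (2 * ua)) (still c)
      (until (tstar a b ua ub) (forward a ua) (still ((a + b) / 2)))
  else if c == (a + b) / 2 then
    still ((a + b) / 2)
  else
    until ((b - c) ^+ 2 / (- 2 * ub)) (still c)
      (until (tstar a b ua ub) (backward b ub) (still ((a + b) / 2))).
Definition gamma_d (R : realType) (d : R) : R -> R := still d.
End Case5.

(** * Case ua < 0, ub < 0 *)
Module Case6.
Definition t1 (R : realType) (a b ub : R) : R := (b - a) ^+ 2 / (- 2 * ub).
Definition t2 (R : realType) (a b ua ub : R) : R :=
  (b - a) ^+ 2 / (2 * (Num.sqrt (- (ua + ub)) - Num.sqrt (- ua)) ^+ 2).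
Definition gamma_a1 (R : realType) (a b ua ub : R) : R -> R :=
  until (t2 a b ua ub) (backward a ua) (backward b (ua + ub)).
Definition gamma_a2 (R : realType) (a b ua ub : R) : R -> R :=
  until (t1 a b ub) (still a)
    (until (t2 a b ua ub) (chord a b ub) (backward b (ua + ub))).
Definition gamma_b (R : realType) (a b ua ub : R) : R -> R :=
  until (t1 a b ub) (backward b ub)
    (until (t2 a b ua ub) (chord a b ub) (backward b (ua + ub))).
Definition gamma_c (R : realType) (a b c ua ub : R) : R -> R :=
  until ((b - c) ^+ 2 / (- 2 * ub)) (still c)
    (until (t1 a b ub) (backward b ub)
      (until (t2 a b ua ub) (chord a b ub) (backward b (ua + ub)))).
Definition gamma_d (R : realType) (d : R) : R -> R := still d.
End Case6.

(* Main.v *)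
Require Import Defs.
From HB Require Import structures.
From mathcomp Require Import all_boot all_order all_algebra.
From mathcomp Require Import all_classical all_reals all_analysis.
From mathcomp Require Import measurable_realfun ring lra.
Import Order.TTheory GRing.Theory Num.Theory.
Import numFieldNormedType.Exports.
Local Open Scope classical_set_scope.
Local Open Scope ring_scope.

(** Write w for the step function with values 0, ua, ua + ub on the three
pieces cut by a and b; it is a primitive of the initial velocity.  The
Hopf--Cole solution gives
  V(x, t) = (2 pi eps t)^(-1/2) * integral of exp (- cost (y) / eps) dy,
  cost (y) = w (y) + (x - y)^2 / (2 t),
so everything is governed by the probability measure with density
proportional to exp (- cost / eps).  Since S has the initial data of V
multiplied by rhoc * 1_(y >= c) + rhod * 1_(y >= d), the quotient R = S / V is
rhoc * P (y >= c) + rhod * P (y >= d), while u is the mean of (x - y) / t.  As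
eps tends to 0 this measure concentrates on the minimisers of the cost.  Hence
u tends to (x - y) / t wherever the cost has a unique minimiser y, and
P (y >= e) tends to 0 or 1 according to the side of e on which the minimisers
lie ([u_visc_cvg], [tail_prob_cvg0], [tail_prob_cvg1]).

The estimates at fixed eps are elementary because all masses are differences
of the normal distribution function Phi.  Masses are bounded above by the
smallest cost ([tail_le], [head_le]) and V is bounded below by any given cost
([total_mass_ge_near]).  For the velocity one also needs that a mass carried by
y >= p has x-derivative at least (p - x) / (eps t) times itself
([tail_slope_ge]); this follows from the convexity of z |-> gauss z + z Phi z,
whose derivative is Phi.

The position of the minimisers is monotone in x, because the costs at two
points x differ by an affine function of y.  It therefore suffices to know the
minimisers on the four curves g1 <= g2 <= g3 <= g4 that bound the intervals on
which u is prescribed: this information is the structure [fan].  It implies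
that the minimiser is x, a, x, b, x respectively on the five intervals, and
that the point where P (y >= c) jumps is the projection of c onto [g2, g3],
while P (y >= d) jumps at max d g4 ([fan_split_mid], [fan_split_right]).  In
each of the six cases the curves form a fan at every time, and gamma_c and
gamma_d are these two expressions; after multiplication by sqrt (2 t) all
conditions on t become linear in the square roots of the absolute values of
ua, ub and ua + ub.

For the density, integration by parts in x moves the derivative of R onto the
test function.  R is bounded, so dominated convergence, first in x and then in
t, turns the jumps of the limit of R into the two Dirac measures
([Rintegral_dtail_cvg], [limit_of_fan]). *)

(** * The standard normal distribution function *)

Definition gauss {R : realType} (z : R) : R :=
  (Num.sqrt (2 * pi))^-1 * expR (- (z ^+ 2 / 2)).

Definition Phi {R : realType} (z : R) : R :=
  \int[lebesgue_measure]_(y in `]-oo, z]) gauss y.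

Lemma gauss_normal_pdf {R : realType} : @gauss R = normal_pdf 0 1.
Proof.
apply/funext => z; rewrite normal_pdfE ?oner_neq0// /normal_peak /normal_fun.
rewrite /gauss subr0 expr1n mul1r [2 * _]mulrC mulr_natr; congr (_ * expR _).
by rewrite mulNr.
Qed.

Lemma gauss_gt0 {R : realType} (z : R) : 0 < gauss z.
Proof.
by rewrite mulr_gt0 ?expR_gt0// invr_gt0 sqrtr_gt0 mulr_gt0// pi_gt0.
Qed.

Lemma gauss_le_expR {R : realType} (z : R) : gauss z <= expR (- (z ^+ 2 / 2)).
Proof.
rewrite ler_piMl ?expR_ge0// invf_le1 ?sqrtr_gt0 ?mulr_gt0 ?pi_gt0//.
rewrite -[leLHS]sqrtr1 ler_sqrt ?mulr_ge0 ?pi_ge0//.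
have := @pi_ge2 R; lra.
Qed.

Lemma gaussN {R : realType} (z : R) : gauss (- z) = gauss z.
Proof. by rewrite /gauss sqrrN. Qed.

Lemma is_derive_gauss {R : realType} (z : R) :
  is_derive z 1 gauss (- z * gauss z).
Proof.
rewrite /gauss; apply: is_derive_eq.
rewrite /GRing.scale /=; field.
by rewrite gt_eqF// sqrtr_gt0 mulr_gt0// pi_gt0.
Qed.

Lemma continuous_gauss {R : realType} : continuous (@gauss R).
Proof.
by rewrite gauss_normal_pdf; apply: continuous_normal_pdf; rewrite oner_neq0.
Qed.

Lemma measurable_gauss {R : realType} : measurable_fun [set: R] gauss.
Proof. by apply: continuous_measurable_fun; exact: continuous_gauss. Qed.

Lemma integrable_gauss {R : realType} (A : set R) : measurable A ->
  lebesgue_measure.-integrable A (EFin \o gauss).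
Proof.
move=> mA; apply: (@integrableS _ _ _ _ setT) => //.
by rewrite gauss_normal_pdf; exact: integrable_normal_pdf.
Qed.

Lemma is_derive_Phi {R : realType} (z : R) : is_derive z 1 Phi (gauss z).
Proof.
have [||||] := @continuous_FTC1 R gauss -oo%O z (z + 1).
- by rewrite ltrDl.
- exact: integrable_gauss.
- by rewrite ltNyr.
- exact: continuous_gauss.
move=> d e; apply: DeriveDef; first exact: d.
by rewrite -derive1E; exact: e.
Qed.

Lemma cvg_gauss {R : realType} : gauss z @[z --> +oo] --> (0 : R).
Proof.
apply/cvgrPdist_le => e e0; near=> z.
rewrite sub0r normrN (ger0_norm (ltW (gauss_gt0 _))).
have z0 : 0 < z by near: z; exact: nbhs_pinfty_gt.
apply: (le_trans (gauss_le_expR z)).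
rewrite expRN invf_ple ?posrE ?expR_gt0//.
apply: le_trans (expR_ge1Dx _).
have ze : 2 * e^-1 + 1 <= z by near: z; apply: nbhs_pinfty_ge; exact: num_real.
have e1 : 0 < e^-1 by rewrite invr_gt0.
nra.
Unshelve. all: by end_near. Qed.

(** The function y * gauss y dominates gauss y for y >= 1 and has the primitive
- gauss y. *)
Lemma integral_gauss_oy_le {R : realType} (z : R) : 1 <= z ->
  \int[lebesgue_measure]_(y in `[z, +oo[) gauss y <= gauss z.
Proof.
move=> z1.
have E : (\int[lebesgue_measure]_(y in `[z, +oo[) (y * gauss y)%:E)%E = (gauss z)%:E.
  rewrite (@ge0_continuous_FTC2y _ _ (fun y => - gauss y) z 0).
  - by rewrite EFinN oppeK add0e.
  - by move=> x zx; rewrite mulr_ge0 ?ltW ?gauss_gt0//; lra.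
  - apply: continuous_subspaceT => x; apply: cvgM; first exact: cvg_id.
    exact: continuous_gauss.
  - by rewrite -oppr0; apply: cvgN; exact: cvg_gauss.
  - by move=> x _; apply: derivableN; have [] := is_derive_gauss x.
  - apply: cvgN; apply: cvg_at_right_filter; exact: continuous_gauss.
  - move=> x _; rewrite derive1E; have := is_derive_gauss x => h.
    by rewrite derive_val mulNr opprK.
rewrite -lee_fin -E /Rintegral fineK; last first.
  apply: integrable_fin_num => //; exact: integrable_gauss.
apply: ge0_le_integral => //=.
- by move=> x _; rewrite lee_fin ltW ?gauss_gt0.
- by apply/measurable_EFinP; apply: measurable_funTS; exact: measurable_gauss.
- apply/measurable_EFinP; apply: measurable_funTS.
  by apply: measurable_funM => //; exact: measurable_gauss.
- move=> x; rewrite in_itv/= andbT => zx; rewrite lee_fin ler_peMl ?(ltW (gauss_gt0 _))//; lra.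
Qed.

Lemma PhiN {R : realType} (z : R) : Phi (- z) = 1 - Phi z.
Proof.
have -> : Phi (- z) = \int[lebesgue_measure]_(y in `[z, +oo[) gauss y.
  rewrite /Phi /Rintegral ge0_integration_by_substitutionNy.
  - by congr fine; apply: eq_integral => x _ /=; rewrite gaussN.
  - by apply: continuous_subspaceT; exact: continuous_gauss.
  - by move=> x _; rewrite ltW ?gauss_gt0.
have <- : \int[lebesgue_measure]_(y in [set: R]) gauss y = 1.
  by rewrite /Rintegral gauss_normal_pdf integral_normal_pdf.
rewrite /Phi; have := @Rintegral_itvB R gauss -oo%O +oo%O z.
rewrite set_itvNyy Rintegral_itv_obnd_cbnd; last exact: integrable_gauss.
by move=> -> //; exact: integrable_gauss.
Qed.

Lemma Phi_ge0 {R : realType} (z : R) : 0 <= Phi z.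
Proof. by apply: Rintegral_ge0 => y _; rewrite ltW ?gauss_gt0. Qed.

Lemma Phi_le1 {R : realType} (z : R) : Phi z <= 1.
Proof. by rewrite -subr_ge0 -PhiN Phi_ge0. Qed.

Lemma PhiN_le_gauss {R : realType} (z : R) : 1 <= z -> Phi (- z) <= gauss z.
Proof.
move=> z1; apply: le_trans (integral_gauss_oy_le _ z1).
rewrite /Phi /Rintegral ge0_integration_by_substitutionNy.
- by rewrite le_eqVlt; apply/orP; left; apply/eqP; congr fine;
    apply: eq_integral => x _ /=; rewrite gaussN.
- by apply: continuous_subspaceT; exact: continuous_gauss.
- by move=> x _; rewrite ltW ?gauss_gt0.
Qed.

Lemma continuous_Phi {R : realType} : continuous (@Phi R).
Proof.
move=> z; apply: differentiable_continuous; apply/derivable1_diffP.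
by have [] := is_derive_Phi z.
Qed.

Lemma Phi_MVT {R : realType} (p q : R) : p < q ->
  exists2 c, c \in `]p, q[ & Phi q - Phi p = gauss c * (q - p).
Proof.
move=> pq; apply: MVT => // [x _|]; first exact: is_derive_Phi.
by apply: continuous_subspaceT; exact: continuous_Phi.
Qed.

Lemma le_Phi {R : realType} (p q : R) : p <= q -> Phi p <= Phi q.
Proof.
rewrite le_eqVlt => /predU1P[->//|pq]; rewrite -subr_ge0.
have [c _ ->] := Phi_MVT _ _ pq.
by rewrite mulr_ge0 ?subr_ge0 ?ltW ?gauss_gt0.
Qed.

(** The function z |-> gauss z + z * Phi z is a primitive of the nondecreasing
function Phi, hence convex.  [gaussB_ge] and [gaussB_le] compare it with its
tangents. *)
Lemma gauss_Phi_MVT {R : realType} (p q : R) : p < q ->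
  exists2 c, c \in `]p, q[ &
    (gauss q + q * Phi q) - (gauss p + p * Phi p) = Phi c * (q - p).
Proof.
move=> pq.
have D (x : R) : is_derive x 1 (fun z => gauss z + z * Phi z) (Phi x).
  have := is_derive_Phi x => hP; have := is_derive_gauss x => hg.
  apply: is_derive_eq; rewrite /GRing.scale/=; ring.
have [|c cpq E] := MVT pq (fun x _ => D x).
  apply: continuous_subspaceT => x; apply: differentiable_continuous.
  by apply/derivable1_diffP; have [] := D x.
by exists c.
Qed.

Lemma gaussB_ge {R : realType} (p q : R) : p <= q ->
  - q * (Phi q - Phi p) <= gauss q - gauss p.
Proof.
rewrite le_eqVlt => /predU1P[->|pq]; first by rewrite !subrr mulr0.
have [c] := gauss_Phi_MVT _ _ pq; rewrite in_itv/= => /andP[pc cq] E.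
have := le_Phi _ _ (ltW pc); nra.
Qed.

Lemma gaussB_le {R : realType} (p q : R) : p <= q ->
  gauss q - gauss p <= - p * (Phi q - Phi p).
Proof.
rewrite le_eqVlt => /predU1P[->|pq]; first by rewrite !subrr mulr0.
have [c] := gauss_Phi_MVT _ _ pq; rewrite in_itv/= => /andP[pc cq] E.
have := le_Phi _ _ (ltW cq); nra.
Qed.

(** The inequality [gaussB_ge] on ]-oo, q], obtained by letting the left end
tend to -oo. *)
Lemma gauss_ge {R : realType} (q : R) : - q * Phi q <= gauss q.
Proof.
have [q0|q0] := leP 0 q.
  have := gauss_gt0 q; have := Phi_ge0 q; nra.
apply/ler_addgt0Pr => e e0.
have e1 : 0 < (- q)^-1 * e by rewrite mulr_gt0 ?invr_gt0 ?oppr_gt0.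
have [z [zq z1 ze]] : exists z : R, [/\ - z <= q, 1 <= z & - q * gauss z <= e].
  near (+oo : set_system R) => z; exists z; split.
  - rewrite lerNl; near: z; apply: nbhs_pinfty_ge; exact: num_real.
  - near: z; apply: nbhs_pinfty_ge; exact: num_real.
  - rewrite -ler_pdivlMl ?oppr_gt0//; near: z.
    have := @cvg_gauss R => /cvgrPdist_le /(_ _ e1).
    by apply: filterS => z; rewrite sub0r normrN ger0_norm// ltW ?gauss_gt0//.
have := gaussB_ge _ _ zq; have := PhiN_le_gauss _ z1.
have := gauss_gt0 (- z); nra.
Unshelve. all: by end_near. Qed.

(** The inequality [gaussB_le] on [p, +oo[, by symmetry. *)
Lemma gauss_le {R : realType} (p : R) : - gauss p <= - p * (1 - Phi p).
Proof.
have := gauss_ge (- p); rewrite gaussN PhiN; lra.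
Qed.

(** The factor 2 covers the range 0 <= z < 1, where the tail is not below the
density but expR (- z^2 / 2) >= 1 / 2. *)
Lemma PhiN_le_expR {R : realType} (z : R) : 0 <= z ->
  Phi (- z) <= 2 * expR (- (z ^+ 2 / 2)).
Proof.
move=> z0; have [z1|z1] := leP 1 z.
  apply: (le_trans (PhiN_le_gauss _ z1)); apply: (le_trans (gauss_le_expR z)).
  have := expR_gt0 (- (z ^+ 2 / 2)); lra.
apply: (le_trans (Phi_le1 _)).
have := expR_ge1Dx (- (z ^+ 2 / 2)); nra.
Qed.

(** The three cases are an interval to the right of 0, to the left of 0, and
around 0; in the last one I <= 0 and the bound 1 is enough. *)
Lemma PhiB_le_expR {R : realType} (p q I : R) : p <= q ->
  (forall z, p <= z -> z <= q -> I <= z ^+ 2 / 2) ->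
  Phi q - Phi p <= 2 * expR (- I).
Proof.
move=> pq H.
have [p0|p0] := leP 0 p.
  have H1 := PhiN_le_expR _ p0.
  have H2 : expR (- (p ^+ 2 / 2)) <= expR (- I) by rewrite ler_expR lerN2 H.
  have := PhiN p; have := Phi_le1 q; lra.
have [q0|q0] := leP q 0.
  have H1 : Phi (- - q) <= 2 * expR (- ((- q) ^+ 2 / 2)).
    by apply: PhiN_le_expR; rewrite oppr_ge0.
  rewrite opprK sqrrN in H1.
  have H2 : expR (- (q ^+ 2 / 2)) <= expR (- I) by rewrite ler_expR lerN2 H.
  have := Phi_ge0 p; lra.
have I0 := H 0 (ltW p0) (ltW q0).
have := expR_ge1Dx (- I); have := Phi_ge0 p; have := Phi_le1 q; lra.
Qed.

Lemma Phi_le_expR {R : realType} (q I : R) :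
  (forall z, z <= q -> I <= z ^+ 2 / 2) -> Phi q <= 2 * expR (- I).
Proof.
move=> H; have [q0|q0] := leP q 0.
  have H1 : Phi (- - q) <= 2 * expR (- ((- q) ^+ 2 / 2)).
    by apply: PhiN_le_expR; rewrite oppr_ge0.
  rewrite opprK sqrrN in H1.
  have H2 : expR (- (q ^+ 2 / 2)) <= expR (- I) by rewrite ler_expR lerN2 H.
  lra.
have I0 := H 0 (ltW q0).
have := expR_ge1Dx (- I); have := Phi_le1 q; lra.
Qed.

Lemma onem_Phi_le_expR {R : realType} (p I : R) :
  (forall z, p <= z -> I <= z ^+ 2 / 2) -> 1 - Phi p <= 2 * expR (- I).
Proof.
move=> H; rewrite -PhiN; apply: Phi_le_expR => z zp.
by rewrite -sqrrN; apply: H; lra.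
Qed.

Lemma gauss_le_expRW {R : realType} (z I : R) :
  I <= z ^+ 2 / 2 -> gauss z <= expR (- I).
Proof.
by move=> H; apply: (le_trans (gauss_le_expR z)); rewrite ler_expR lerN2.
Qed.

Lemma PhiB_ge {R : realType} (p q M : R) : p <= q -> `|p| <= M -> `|q| <= M ->
  (q - p) * gauss M <= Phi q - Phi p.
Proof.
rewrite le_eqVlt => /predU1P[-> _ _|pq pM qM]; first by rewrite !subrr mul0r.
have [c + ->] := Phi_MVT _ _ pq; rewrite in_itv/= => /andP[pc cq].
rewrite mulrC ler_wpM2r ?subr_ge0 ?(ltW pq)// /gauss.
rewrite ler_wpM2l ?invr_ge0 ?sqrtr_ge0// ler_expR lerN2 ler_wpM2r//.
move: pM qM; rewrite !ler_norml => /andP[? ?] /andP[? ?]; nra.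
Qed.

(** * Heat flow of step data *)
Lemma heat_kernelE {R : realType} (eps x t : R) : 0 < eps -> 0 < t ->
  heat_kernel eps x t = gauss (x / Num.sqrt (eps * t)) / Num.sqrt (eps * t).
Proof.
move=> e0 t0; rewrite /heat_kernel /gauss.
have et0 : 0 < eps * t by rewrite mulr_gt0.
have -> : 2 * pi * eps * t = (2 * pi) * (eps * t) by ring.
rewrite sqrtrM ?mulr_ge0 ?pi_ge0// invfM.
rewrite expr_div_n sqr_sqrtr ?(ltW et0)//.
have -> : x ^+ 2 / (eps * t) / 2 = x ^+ 2 / (2 * eps * t).
  by field; rewrite !gt_eqF.
ring.
Qed.

Lemma is_derive_Phi_affine {R : realType} (s p x : R) :
  is_derive x 1 (fun y => Phi ((y - p) / s)) (gauss ((x - p) / s) / s).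
Proof.
have h := is_derive_Phi ((x - p) / s).
have h2 : is_derive x 1 (fun y => (y - p) / s) (s^-1).
  by apply: is_derive_eq; rewrite /GRing.scale/=; ring.
exact: (is_derive1_comp (f := Phi) (g := fun y => (y - p) / s) h h2).
Qed.

Lemma is_derive_Phi_reflect {R : realType} (s x y : R) :
  is_derive y 1 (fun y => Phi ((x - y) / s)) (- (gauss ((x - y) / s) / s)).
Proof.
have h := is_derive_Phi ((x - y) / s).
have h2 : is_derive y 1 (fun y => (x - y) / s) (- s^-1).
  by apply: is_derive_eq; rewrite /GRing.scale/=; ring.
have := is_derive1_comp (f := Phi) (g := fun y => (x - y) / s) h h2.
by rewrite mulrN.
Qed.

Definition step {R : realType} (p y : R) : R := if y < p then 0 else 1.

Lemma measurable_step {R : realType} (p : R) : measurable_fun [set: R] (step p).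
Proof.
have -> : step p = \1_(`[p, +oo[).
  apply/funext => y; rewrite /step indicE mem_setE in_itv/= andbT ltNge.
  by case: (p <= y).
exact: measurable_indic.
Qed.

Lemma Phi_cvgNy {R : realType} : Phi z @[z --> -oo] --> (0 : R).
Proof.
apply/cvgrPdist_le => e e0; near=> z.
rewrite sub0r normrN ger0_norm ?Phi_ge0//.
have z1 : 1 <= - z by rewrite lerNr; near: z; apply: nbhs_ninfty_le; exact: num_real.
rewrite -(opprK z); apply: (le_trans (PhiN_le_gauss _ z1)).
near: z.
have /cvgrPdist_le /(_ _ e0) [M [Mr HM]] := @cvg_gauss R.
exists (- M); split; first by rewrite num_real.
move=> z zM; have := HM (- z); rewrite ltrNr => /(_ zM).
by rewrite sub0r normrN ger0_norm ?(ltW (gauss_gt0 _))//.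
Unshelve. all: by end_near. Qed.

Section heat_flow_step.
Context {R : realType} (eps t x : R).
Hypotheses (e0 : 0 < eps) (t0 : 0 < t).
Let s := Num.sqrt (eps * t).
Let s0 : 0 < s. Proof. by rewrite sqrtr_gt0 mulr_gt0. Qed.

Lemma heat_kernel_normal :
  (fun y => heat_kernel eps (x - y) t) = normal_pdf x s.
Proof.
apply/funext => y; rewrite normal_pdfE ?gt_eqF//.
rewrite heat_kernelE// -/s /gauss /normal_peak /normal_fun.
have -> : s ^+ 2 * pi *+ 2 = (2 * pi) * s ^+ 2 by rewrite -mulr_natr; ring.
rewrite [Num.sqrt (_ * s ^+ 2)]sqrtrM ?mulr_ge0 ?pi_ge0// sqrtr_sqr (gtr0_norm s0) invfM.
have -> : - ((((x - y) / s) ^+ 2) / 2) = - (y - x) ^+ 2 / (s ^+ 2 *+ 2).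
  by rewrite -mulr_natr; field; rewrite gt_eqF.
ring.
Qed.

Lemma integrable_heat_kernel :
  lebesgue_measure.-integrable [set: R]
    (EFin \o (fun y => heat_kernel eps (x - y) t)).
Proof. by rewrite heat_kernel_normal; exact: integrable_normal_pdf. Qed.

Lemma Rintegral_heat_kernel :
  \int[lebesgue_measure]_(y in [set: R]) heat_kernel eps (x - y) t = 1.
Proof.
by rewrite heat_kernel_normal /Rintegral integral_normal_pdf.
Qed.

Lemma integrable_heat_kernel_step p :
  lebesgue_measure.-integrable [set: R]
    (EFin \o (fun y => heat_kernel eps (x - y) t * step p y)).
Proof.
apply: (le_integrable _ _ _ integrable_heat_kernel) => //.
  apply/measurable_EFinP; apply: measurable_funM; last exact: measurable_step.
  by rewrite heat_kernel_normal; exact: measurable_normal_pdf.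
move=> y _ /=; rewrite lee_fin normrM ler_piMr//.
by rewrite /step; case: ifP; rewrite ?normr0 ?normr1.
Qed.

(** The function y |-> - Phi ((x - y) / s) is a primitive of the heat kernel, so
the half-line is integrated by the fundamental theorem of calculus. *)
Lemma Rintegral_heat_kernel_step p :
  \int[lebesgue_measure]_(y in [set: R]) (heat_kernel eps (x - y) t * step p y)
  = Phi ((x - p) / s).
Proof.
transitivity (\int[lebesgue_measure]_(y in `[p, +oo[) heat_kernel eps (x - y) t).
  rewrite [RHS]Rintegral_mkcond; apply: eq_Rintegral => y _.
  rewrite patchE mem_setE in_itv/= andbT /step ltNge.
  by case: (p <= y); rewrite ?mulr1 ?mulr0.
rewrite (@Rintegral_ge0_continuous_FTC2y _ _ (fun y => - Phi ((x - y) / s)) p 0).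
- by rewrite sub0r opprK.
- by move=> y _; rewrite heat_kernelE// divr_ge0 ?ltW ?gauss_gt0.
- rewrite heat_kernel_normal; apply: continuous_subspaceT.
  by apply: continuous_normal_pdf; rewrite gt_eqF.
- rewrite -oppr0; apply: cvgN.
  apply: (cvg_comp (fun y => (x - y) / s) Phi _ Phi_cvgNy).
  apply/cvgrNyPle => M; near=> y.
  rewrite ler_pdivrMr// lerBlDr -lerBlDl.
  by near: y; apply: nbhs_pinfty_ge; exact: num_real.
- move=> y _; apply: derivableN; apply: ex_derive.
  exact: is_derive_Phi_reflect.
- apply: cvgN; apply: cvg_at_right_filter.
  suff : {for p, continuous (fun y => Phi ((x - y) / s))} by [].
  apply: differentiable_continuous; apply/derivable1_diffP; apply: ex_derive.
  exact: is_derive_Phi_reflect.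
- move=> y _; rewrite derive1E; have h := is_derive_Phi_reflect s x y.
  by rewrite derive_val heat_kernelE// opprK.
Unshelve. all: by end_near. Qed.

End heat_flow_step.

Section lincomb.
Context (d : measure_display) (T : measurableType d) {R : realType}.
Context (mu : {measure set T -> \bar R}) (D : set T).
Hypothesis mD : measurable D.
Implicit Types (f g : T -> R) (k l : R).

Lemma integrable_scale f k : mu.-integrable D (EFin \o f) ->
  mu.-integrable D (EFin \o (fun y => k * f y)).
Proof.
move=> intf; have := integrableZl mD k intf.
by apply: eq_integrable => // y _ /=; rewrite EFinM.
Qed.

Lemma Rintegral_lincomb f g k l :
  mu.-integrable D (EFin \o f) -> mu.-integrable D (EFin \o g) ->
  \int[mu]_(x in D) (k * f x + l * g x) =
  k * \int[mu]_(x in D) f x + l * \int[mu]_(x in D) g x.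
Proof.
move=> intf intg; rewrite RintegralD//; [|exact: integrable_scale|exact: integrable_scale].
by rewrite !RintegralZl.
Qed.
End lincomb.

(** An initial datum with value k at -oo and finitely many jumps is given by the
list of its jumps (height, position). *)
Lemma heat_flow_steps {R : realType} (eps t x k : R) (r : seq (R * R)) :
  0 < eps -> 0 < t ->
  lebesgue_measure.-integrable [set: R] (EFin \o (fun y =>
    heat_kernel eps (x - y) t * (k + \sum_(i <- r) i.1 * step i.2 y))) /\
  heat_flow eps (fun y => k + \sum_(i <- r) i.1 * step i.2 y) x t =
    k + \sum_(i <- r) i.1 * Phi ((x - i.2) / Num.sqrt (eps * t)).
Proof.
move=> e0 t0; elim: r => [|i r [int1 E1]].
  have Ek : (fun y => heat_kernel eps (x - y) t *
      (k + \sum_(i <- [::]) i.1 * step i.2 y)) =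
      (fun y => k * heat_kernel eps (x - y) t).
    by apply/funext => y; rewrite big_nil addr0 mulrC.
  have int0 := @integrable_heat_kernel R eps t x e0 t0.
  split; first by rewrite Ek; exact: integrable_scale.
  by rewrite /heat_flow Ek RintegralZl// Rintegral_heat_kernel// big_nil addr0 mulr1.
have Ei : (fun y => heat_kernel eps (x - y) t *
      (k + \sum_(j <- i :: r) j.1 * step j.2 y)) =
    (fun y => i.1 * (heat_kernel eps (x - y) t * step i.2 y) +
       heat_kernel eps (x - y) t * (k + \sum_(j <- r) j.1 * step j.2 y)).
  by apply/funext => y; rewrite big_cons; ring.
have int2 := @integrable_heat_kernel_step R eps t x e0 t0 i.2.
have int3 : lebesgue_measure.-integrable [set: R] (EFin \o
    (fun y => i.1 * (heat_kernel eps (x - y) t * step i.2 y))).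
  exact: integrable_scale.
split.
  rewrite Ei; have := integrableD measurableT int3 int1.
  by apply: eq_integrable => // y _ /=; rewrite EFinD.
rewrite /heat_flow Ei RintegralD// RintegralZl//.
rewrite Rintegral_heat_kernel_step//.
by have := E1; rewrite /heat_flow => ->; rewrite big_cons; ring.
Qed.

(** * The weighted Gaussian masses *)

(** The mass that the heat kernel centred at x gives to [p, +oo[.  Its
x-derivative is gauss_at eps t x p / sqrt (eps t). *)
Definition Phi_at {R : realType} (eps t x p : R) : R :=
  Phi ((x - p) / Num.sqrt (eps * t)).

Definition gauss_at {R : realType} (eps t x p : R) : R :=
  gauss ((x - p) / Num.sqrt (eps * t)).

(** Let F p stand for the mass of [p, +oo[, and k for its limit at -oo.  With
the weights 1, E1, E2 on the three pieces cut by a and b, [tail_sum],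
[head_sum] and [total_sum] are the weighted masses of [p, +oo[, of ]-oo, p] and
of the line.  They are used with F = Phi_at and k = 1, and with F = gauss_at
and k = 0 for the x-derivatives. *)
Definition tail_sum {R : realType} (a b E1 E2 p : R) (F : R -> R) : R :=
  (F p - F (Num.max a p)) + E1 * (F (Num.max a p) - F (Num.max b p))
  + E2 * F (Num.max b p).

Definition head_sum {R : realType} (a b E1 E2 p k : R) (F : R -> R) : R :=
  (k - F (Num.min a p)) + E1 * (F (Num.min a p) - F (Num.min b p))
  + E2 * (F (Num.min b p) - F p).

Definition total_sum {R : realType} (a b E1 E2 k : R) (F : R -> R) : R :=
  k + (E1 - 1) * F a + (E2 - E1) * F b.

Lemma head_tail_sum {R : realType} (a b E1 E2 p k : R) (F : R -> R) :
  head_sum a b E1 E2 p k F + tail_sum a b E1 E2 p F = total_sum a b E1 E2 k F.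
Proof.
rewrite /head_sum /tail_sum /total_sum.
by case: (leP a p) => _; case: (leP b p) => _; ring.
Qed.

Lemma V_viscE {R : realType} (a b ua ub eps x t : R) :
  a < b -> 0 < eps -> 0 < t ->
  V_visc a b ua ub eps x t =
  total_sum a b (expR (- (ua / eps))) (expR (- ((ua + ub) / eps))) 1
    (Phi_at eps t x).
Proof.
move=> ab e0 t0; rewrite /V_visc.
set E1 := expR (- (ua / eps)); set E2 := expR (- ((ua + ub) / eps)).
have -> : V_init a b ua ub eps = (fun y => 1 +
    \sum_(i <- [:: (E1 - 1, a); (E2 - E1, b)]) i.1 * step i.2 y).
  apply/funext => y; rewrite /V_init -/E1 -/E2 !big_cons big_nil /step /=.
  by case: (ltP y a) => ya; case: (ltP y b) => yb; rewrite ?mulr0 ?mulr1; lra.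
have [_ ->] := heat_flow_steps eps t x 1 [:: (E1 - 1, a); (E2 - E1, b)] e0 t0.
by rewrite !big_cons big_nil /= /total_sum /Phi_at; ring.
Qed.

Lemma S_viscE {R : realType} (a b c d ua ub rhoc rhod eps x t : R) :
  a < c -> c < b -> b < d -> 0 < eps -> 0 < t ->
  let E1 := expR (- (ua / eps)) in let E2 := expR (- ((ua + ub) / eps)) in
  S_visc b c d ua ub rhoc rhod eps x t =
  rhoc * tail_sum a b E1 E2 c (Phi_at eps t x) +
  rhod * tail_sum a b E1 E2 d (Phi_at eps t x).
Proof.
move=> ac cb bd e0 t0 E1 E2; rewrite /S_visc.
set r := [:: (rhoc * E1, c); (rhoc * (E2 - E1), b); (rhod * E2, d)].
have -> : S_init b c d ua ub rhoc rhod eps = (fun y => 0 +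
    \sum_(i <- r) i.1 * step i.2 y).
  apply/funext => y; rewrite /S_init -/E1 -/E2 !big_cons big_nil /step /=.
  by case: (ltP y c) => yc; case: (ltP y b) => yb; case: (ltP y d) => yd;
    rewrite ?mulr0 ?mulr1; lra.
have [_ ->] := heat_flow_steps eps t x 0 r e0 t0.
rewrite !big_cons big_nil /= /tail_sum -/(Phi_at eps t x).
rewrite (max_r (ltW ac)) (max_l (ltW cb)) (max_r (ltW bd)).
rewrite (max_r (ltW (lt_trans ac (lt_trans cb bd)))) /Phi_at; ring.
Qed.

Section gibbs.
Context {R : realType} (a b ua ub eps t x : R).
Hypotheses (ab : a < b) (e0 : 0 < eps) (t0 : 0 < t).
Let s := Num.sqrt (eps * t).
Let s0 : 0 < s. Proof. by rewrite sqrtr_gt0 mulr_gt0. Qed.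
Let ss : s ^+ 2 = eps * t. Proof. by rewrite sqr_sqrtr// ltW// mulr_gt0. Qed.
Let E1 := expR (- (ua / eps)).
Let E2 := expR (- ((ua + ub) / eps)).
Let N := Phi_at eps t x.
Let n := gauss_at eps t x.

Let zle p q : p <= q -> (x - q) / s <= (x - p) / s.
Proof. by move=> pq; rewrite ler_pM2r ?invr_gt0// lerD2l lerN2. Qed.

Let NB p q : p <= q -> 0 <= N p - N q.
Proof. by move=> pq; rewrite subr_ge0; exact/le_Phi/zle. Qed.

Let nB_ge p q r : r <= p -> p <= q -> (r - x) / s * (N p - N q) <= n p - n q.
Proof.
move=> rp pq; apply: le_trans (gaussB_ge _ _ (zle _ _ pq)).
rewrite -mulNr opprB ler_wpM2r ?NB//.
by rewrite ler_pM2r ?invr_gt0// lerD2r.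
Qed.

Let nB_le p q r : p <= q -> q <= r -> n p - n q <= (r - x) / s * (N p - N q).
Proof.
move=> pq qr; apply: (le_trans (gaussB_le _ _ (zle _ _ pq))).
rewrite -mulNr opprB ler_wpM2r ?NB//.
by rewrite ler_pM2r ?invr_gt0// lerD2r.
Qed.

Let maxab p : Num.max a p <= Num.max b p.
Proof. by rewrite ge_max !le_max (ltW ab) lexx orbT. Qed.
Let minab p : Num.min a p <= Num.min b p.
Proof. by rewrite le_min !ge_min (ltW ab) lexx orbT. Qed.
Let pmax (q p : R) : p <= Num.max q p. Proof. by rewrite le_max lexx orbT. Qed.
Let minp (q p : R) : Num.min q p <= p. Proof. by rewrite ge_min lexx orbT. Qed.

Lemma tail_ge0 p : 0 <= tail_sum a b E1 E2 p N.
Proof.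
apply: addr_ge0; first apply: addr_ge0.
- exact: NB.
- by rewrite mulr_ge0 ?expR_ge0 ?NB.
- by rewrite mulr_ge0 ?expR_ge0//; exact: Phi_ge0.
Qed.

Lemma head_ge0 p : 0 <= head_sum a b E1 E2 p 1 N.
Proof.
apply: addr_ge0; first apply: addr_ge0.
- by rewrite subr_ge0; exact: Phi_le1.
- by rewrite mulr_ge0 ?expR_ge0 ?NB.
- by rewrite mulr_ge0 ?expR_ge0 ?NB.
Qed.

(** Differentiating the heat kernel in x multiplies it by (y - x) / s^2, and
y >= p on the mass considered.  On each piece this is [gaussB_ge] or
[gauss_ge]; the common factor 1 / s of the derivatives is omitted. *)
Lemma tail_slope_ge p :
  (p - x) / s * tail_sum a b E1 E2 p N <= tail_sum a b E1 E2 p n.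
Proof.
rewrite /tail_sum 2!mulrDr; apply: lerD; first apply: lerD.
- exact: nB_ge.
- by rewrite mulrCA ler_wpM2l ?expR_ge0// nB_ge.
- rewrite mulrCA ler_wpM2l ?expR_ge0//.
  apply: le_trans (gauss_ge _); rewrite -mulNr opprB ler_wpM2r ?Phi_ge0//.
  by rewrite ler_pM2r ?invr_gt0// lerD2r.
Qed.

(** Same reason as for [tail_slope_ge], with y <= p. *)
Lemma head_slope_le p :
  head_sum a b E1 E2 p 0 n <= (p - x) / s * head_sum a b E1 E2 p 1 N.
Proof.
rewrite /head_sum [leRHS]mulrDr [X in _ <= X + _]mulrDr; apply: lerD; first apply: lerD.
- rewrite sub0r; apply: (le_trans (gauss_le _)).
  rewrite -mulNr opprB ler_wpM2r ?subr_ge0 ?Phi_le1//.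
  by rewrite ler_pM2r ?invr_gt0// lerD2r.
- rewrite [leRHS]mulrCA ler_wpM2l ?expR_ge0// nB_le//.
- by rewrite [leRHS]mulrCA ler_wpM2l ?expR_ge0// nB_le.
Qed.

(** Both one-sided values of the step function are admitted at the jumps a and b:
minima over the closed pieces are then attained, and strict inequalities
between costs survive a small displacement of y inside its piece. *)
Definition level (y w : R) : Prop :=
  [\/ y <= a /\ w = 0, a <= y <= b /\ w = ua | b <= y /\ w = ua + ub].

Definition cost (y w : R) : R := w + (x - y) ^+ 2 / (2 * t).

(* A bound on the cost turns into a bound on the exponent of the kernel in the
   variable z = (x - p) / s. *)
Let costE p w I : I <= cost p w -> I / eps <= w / eps + ((x - p) / s) ^+ 2 / 2.
Proof.
move=> H; rewrite expr_div_n ss.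
have -> : w / eps + (x - p) ^+ 2 / (eps * t) / 2 = cost p w / eps.
  by rewrite /cost; field; rewrite !gt_eqF.
by rewrite ler_pM2r ?invr_gt0.
Qed.

Let ztox z : (x - (x - s * z)) / s = z.
Proof. by field; rewrite gt_eqF. Qed.

(* The bound on the cost is required for p < q only: when the piece is cut away
   its mass vanishes, although its end point may carry another level. *)
Let pieceM p q w I : p <= q -> (p < q -> forall y, p <= y <= q -> I <= cost y w) ->
  expR (- (w / eps)) * (N p - N q) <= 2 * expR (- (I / eps)).
Proof.
rewrite le_eqVlt => /predU1P[->|pq] H.
  by rewrite subrr mulr0 mulr_ge0// expR_ge0.
have -> : - (I / eps) = - (w / eps) + - (I / eps - w / eps) by ring.
rewrite expRD mulrCA ler_pM2l ?expR_gt0//.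
apply: PhiB_le_expR; first exact/zle/ltW.
move=> z; rewrite ler_pdivrMr// ler_pdivlMr// => z1 z2.
rewrite lerBlDl -(ztox z); apply: costE.
by apply: H => //; rewrite -/s in z1 z2; apply/andP; split; lra.
Qed.

Let piece_inftyM p w I : (forall y, p <= y -> I <= cost y w) ->
  expR (- (w / eps)) * N p <= 2 * expR (- (I / eps)).
Proof.
move=> H.
have -> : - (I / eps) = - (w / eps) + - (I / eps - w / eps) by ring.
rewrite expRD mulrCA ler_pM2l ?expR_gt0//.
apply: (Phi_le_expR _ (I / eps - w / eps)) => z z1; rewrite ler_pdivlMr// in z1.
rewrite lerBlDl -(ztox z); apply: costE.
by apply: H => //; rewrite -/s in z1; lra.
Qed.

Let piece_NinftyM p w I : (forall y, y <= p -> I <= cost y w) ->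
  expR (- (w / eps)) * (1 - N p) <= 2 * expR (- (I / eps)).
Proof.
move=> H.
have -> : - (I / eps) = - (w / eps) + - (I / eps - w / eps) by ring.
rewrite expRD mulrCA ler_pM2l ?expR_gt0//.
apply: (onem_Phi_le_expR _ (I / eps - w / eps)) => z z1; rewrite ler_pdivrMr// in z1.
rewrite lerBlDl -(ztox z); apply: costE.
by apply: H => //; rewrite -/s in z1; lra.
Qed.

Let slope1 p w I : I <= cost p w ->
  0 <= expR (- (w / eps)) * n p <= expR (- (I / eps)).
Proof.
move=> H; rewrite mulr_ge0 ?expR_ge0 ?(ltW (gauss_gt0 _))//=.
have -> : - (I / eps) = - (w / eps) + - (I / eps - w / eps) by ring.
rewrite expRD ler_pM2l ?expR_gt0//.
by apply: gauss_le_expRW; rewrite lerBlDl; exact: costE.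
Qed.

Let slopeM p q w I : p <= q -> (p < q -> forall y, p <= y <= q -> I <= cost y w) ->
  `| expR (- (w / eps)) * (n p - n q) | <= expR (- (I / eps)).
Proof.
rewrite le_eqVlt => /predU1P[->|pq] H.
  by rewrite subrr mulr0 normr0 expR_ge0.
have /andP[p1 p2] : 0 <= expR (- (w / eps)) * n p <= expR (- (I / eps)).
  by apply: slope1; apply: H; rewrite // lexx ltW.
have /andP[q1 q2] : 0 <= expR (- (w / eps)) * n q <= expR (- (I / eps)).
  by apply: slope1; apply: H; rewrite // lexx ltW.
rewrite ler_norml mulrBr; apply/andP; split; lra.
Qed.

(** Laplace upper bound: each of the three pieces contributes at most
2 expR (- I / eps), and its slope at most expR (- I / eps). *)
Lemma tail_le p I : (forall y w, level y w -> p <= y -> I <= cost y w) ->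
  tail_sum a b E1 E2 p N <= 6 * expR (- (I / eps)) /\
  `| tail_sum a b E1 E2 p n | <= 3 * expR (- (I / eps)).
Proof.
move=> H; have h1 : p < Num.max a p -> forall y, p <= y <= Num.max a p -> I <= cost y 0.
  rewrite lt_max ltxx orbF => pa y /andP[py].
  by rewrite (max_l (ltW pa)) => ya; apply: H => //; exact: Or31.
have h2 : Num.max a p < Num.max b p ->
    forall y, Num.max a p <= y <= Num.max b p -> I <= cost y ua.
  rewrite gt_max !lt_max ltxx orbF => /andP[_ pb] y.
  rewrite (max_l (ltW pb)) ge_max => /andP[/andP[ay py] yb].
  by apply: H => //; apply: Or32; rewrite ay yb.
have h3 : forall y, Num.max b p <= y -> I <= cost y (ua + ub).
  by move=> y; rewrite ge_max => /andP[byy py]; apply: H => //; exact: Or33.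
split.
  have := pieceM _ _ _ _ (pmax _ _) h1; have := pieceM _ _ _ _ (maxab _) h2.
  have := piece_inftyM _ _ _ h3.
  rewrite /tail_sum -/E1 -/E2 mul0r oppr0 expR0; lra.
have := slopeM _ _ _ _ (pmax _ _) h1; have := slopeM _ _ _ _ (maxab _) h2.
have := slope1 _ _ _ (h3 _ (lexx _)).
rewrite /tail_sum -/E1 -/E2 mul0r oppr0 expR0 mul1r.
rewrite !ler_norml => /andP[? ?] /andP[? ?] /andP[? ?].
apply/andP; split; lra.
Qed.

Lemma head_le p I : (forall y w, level y w -> y <= p -> I <= cost y w) ->
  head_sum a b E1 E2 p 1 N <= 6 * expR (- (I / eps)) /\
  `| head_sum a b E1 E2 p 0 n | <= 3 * expR (- (I / eps)).
Proof.
move=> H; have h1 : Num.min b p < p ->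
    forall y, Num.min b p <= y <= p -> I <= cost y (ua + ub).
  rewrite gt_min ltxx orbF => bp y /andP[].
  rewrite (min_l (ltW bp)) => byy yp.
  by apply: H => //; exact: Or33.
have h2 : Num.min a p < Num.min b p ->
    forall y, Num.min a p <= y <= Num.min b p -> I <= cost y ua.
  rewrite lt_min !gt_min ltxx orbF => /andP[_ ap] y.
  rewrite (min_l (ltW ap)) le_min => /andP[ay /andP[yb yp]].
  by apply: H => //; apply: Or32; rewrite ay yb.
have h3 : forall y, y <= Num.min a p -> I <= cost y 0.
  by move=> y; rewrite le_min => /andP[ya yp]; apply: H => //; exact: Or31.
split.
  have := pieceM _ _ _ _ (minp _ _) h1; have := pieceM _ _ _ _ (minab _) h2.
  have := piece_NinftyM _ _ _ h3.
  rewrite /head_sum -/E1 -/E2 mul0r oppr0 expR0; lra.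
have := slopeM _ _ _ _ (minp _ _) h1; have := slopeM _ _ _ _ (minab _) h2.
have := slope1 _ _ _ (h3 _ (lexx _)).
rewrite /head_sum -/E1 -/E2 mul0r oppr0 expR0 mul1r.
rewrite !ler_norml => /andP[? ?] /andP[? ?] /andP[? ?].
apply/andP; split; lra.
Qed.

Lemma total_ge p q w : p <= q ->
  [\/ q <= a /\ w = 0, [/\ a <= p, q <= b & w = ua] | b <= p /\ w = ua + ub] ->
  expR (- (w / eps)) * (N p - N q) <= total_sum a b E1 E2 1 N.
Proof.
move=> pq H; have -> : total_sum a b E1 E2 1 N =
    (1 - N a) + E1 * (N a - N b) + E2 * N b by rewrite /total_sum; ring.
have h1 : 0 <= 1 - N a by rewrite subr_ge0; exact: Phi_le1.
have h2 : 0 <= E1 * (N a - N b) by rewrite mulr_ge0 ?expR_ge0 ?NB ?ltW.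
have h3 : 0 <= E2 * N b by rewrite mulr_ge0 ?expR_ge0//; exact: Phi_ge0.
case: H => [[qa ->]|[ap qb ->]|[bp ->]].
- rewrite mul0r oppr0 expR0; have := NB _ _ qa; have : N p <= 1 := Phi_le1 _.
  lra.
- rewrite -/E1; have : E1 * (N p - N q) <= E1 * (N a - N b).
    by rewrite ler_wpM2l ?expR_ge0//; have := NB _ _ ap; have := NB _ _ qb; lra.
  lra.
- rewrite -/E2; have : E2 * (N p - N q) <= E2 * N b.
    rewrite ler_wpM2l ?expR_ge0//; have := NB _ _ bp.
    by have : 0 <= N q := Phi_ge0 _; lra.
  lra.
Qed.

(** At least one of [y - d, y] and [y, y + d] lies in the piece of y; for the
middle piece this needs d <= (b - a) / 2.  The kernel is minimal on it at
distance `|x - y| + d at most. *)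
Lemma total_ge_gauss y w d : 0 <= d -> d <= (b - a) / 2 -> level y w ->
  expR (- (w / eps)) * (d / s * gauss ((`|x - y| + d) / s)) <=
  total_sum a b E1 E2 1 N.
Proof.
move=> d0 dab L.
have [p [q [yp pE qy H]]] : exists p q, [/\ y - d <= p, p + d = q, q <= y + d &
    [\/ q <= a /\ w = 0, [/\ a <= p, q <= b & w = ua] | b <= p /\ w = ua + ub]].
  case: L => [[ya ->]|[/andP[ay yb] ->]|[yb ->]].
  - exists (y - d), y; split; [lra|lra|lra|exact: Or31].
  - have [h|h] := leP y ((a + b) / 2).
      by exists y, (y + d); split; [lra|lra|lra|apply: Or32; split => //; lra].
    by exists (y - d), y; split; [lra|lra|lra|apply: Or32; split => //; lra].
  - exists y, (y + d); split; [lra|lra|lra|exact: Or33].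
have pq : p <= q by lra.
apply: le_trans (total_ge _ _ _ pq H); rewrite ler_wpM2l ?expR_ge0//.
have -> : d / s = (x - p) / s - (x - q) / s by rewrite -pE; ring.
have /andP[n1 n2] : (- `|x - y| <= x - y <= `|x - y|) by rewrite -ler_norml.
apply: PhiB_ge; first exact: zle.
  rewrite normrM (ger0_norm (_ : 0 <= s^-1)) ?invr_ge0 ?(ltW s0)//.
  by rewrite ler_pM2r ?invr_gt0// ler_norml; apply/andP; split; lra.
rewrite normrM (ger0_norm (_ : 0 <= s^-1)) ?invr_ge0 ?(ltW s0)//.
by rewrite ler_pM2r ?invr_gt0// ler_norml; apply/andP; split; lra.
Qed.

(** The hypothesis on d makes the interval of length d long enough to absorb the
normalisation (2 pi eps t)^(-1/2) of the kernel. *)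
Lemma total_ge_expR y w d J : 0 <= d -> d <= (b - a) / 2 -> level y w ->
  w + (`|x - y| + d) ^+ 2 / (2 * t) <= J -> 2 * pi * (eps * t) <= d ^+ 2 ->
  expR (- (J / eps)) <= total_sum a b E1 E2 1 N.
Proof.
move=> d0 dab L HJ Hd; apply: le_trans (total_ge_gauss _ _ _ d0 dab L).
have H1 : 1 <= d / s * (Num.sqrt (2 * pi))^-1.
  rewrite -mulrA -invfM -sqrtrM ?(ltW (mulr_gt0 _ _))//.
  rewrite ler_pdivlMr ?sqrtr_gt0 ?mulr_gt0 ?pi_gt0// mul1r.
  rewrite -[leRHS](ger0_norm d0) -sqrtr_sqr ler_sqrt ?sqr_ge0//; lra.
rewrite /gauss expr_div_n ss.
set g := expR (- (_ / 2)).
have -> : expR (- (w / eps)) * (d / s * ((Num.sqrt (2 * pi))^-1 * g)) =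
  (d / s * (Num.sqrt (2 * pi))^-1) * (expR (- (w / eps)) * g) by ring.
apply: (@le_trans _ _ (expR (- (w / eps)) * g)); last first.
  by rewrite ler_peMl// mulr_ge0 ?expR_ge0.
rewrite /g -expRD ler_expR -opprD lerN2.
rewrite ler_pdivlMr//; apply: le_trans HJ.
rewrite le_eqVlt; apply/orP; left; apply/eqP.
by field; rewrite !gt_eqF.
Qed.

End gibbs.

(** * Laplace asymptotics of the Gibbs masses *)

(** The masses of the preceding part with the weights of V. *)
Definition tail_mass {R : realType} (a b ua ub p eps : R) (F : R -> R) : R :=
  tail_sum a b (expR (- (ua / eps))) (expR (- ((ua + ub) / eps))) p F.
Definition head_mass {R : realType} (a b ua ub p k eps : R) (F : R -> R) : R :=
  head_sum a b (expR (- (ua / eps))) (expR (- ((ua + ub) / eps))) p k F.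
Definition total_mass {R : realType} (a b ua ub k eps : R) (F : R -> R) : R :=
  total_sum a b (expR (- (ua / eps))) (expR (- ((ua + ub) / eps))) k F.

(** The cost on P exceeds, by a positive margin, the cost of some point.  The
Gibbs measure of P then tends to 0. *)
Definition outweighed {R : realType} (a b ua ub t x : R) (P : R -> Prop) :=
  exists y w I, [/\ level a b ua ub y w, cost t x y w < I &
    forall y' w', P y' -> level a b ua ub y' w' -> I <= cost t x y' w'].

(** From expR (- (I - J) / eps) <= eps / (I - J): a rate linear in eps suffices
for all that follows. *)
Lemma expR_ratio_le {R : realType} (k I J eps T V : R) :
  0 < eps -> J < I -> 0 <= k -> T <= k * expR (- (I / eps)) ->
  expR (- (J / eps)) <= V -> T / V <= k * (eps / (I - J)).
Proof.
move=> e0 JI k0 TI VJ.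
have V0 : 0 < V := lt_le_trans (expR_gt0 _) VJ.
have IJ : 0 < I - J by lra.
rewrite ler_pdivrMr//; apply: (le_trans TI); rewrite -mulrA ler_wpM2l//.
apply: (@le_trans _ _ (eps / (I - J) * expR (- (J / eps)))); last first.
  by rewrite ler_wpM2l// divr_ge0// ltW.
have -> : - (J / eps) = - (I / eps) + (I - J) / eps by ring.
rewrite expRD mulrCA ler_peMr ?expR_ge0//.
rewrite -ler_pdivrMl ?divr_gt0// mulr1 invf_div.
apply: le_trans (expR_ge1Dx _); lra.
Qed.

(** Laplace lower bound.  The length d of the interval used near y is chosen so
that (`|x - y| + d)^2 exceeds (x - y)^2 by at most the margin available in J;
this uses d <= 1 to linearise d^2. *)
Lemma total_mass_ge_near {R : realType} (a b ua ub t x y w J : R) :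
  a < b -> 0 < t -> level a b ua ub y w -> cost t x y w < J ->
  \forall eps \near 0^'+,
    expR (- (J / eps)) <= total_mass a b ua ub 1 eps (Phi_at eps t x).
Proof.
move=> ab t0 L cJ; set r := `|x - y|.
have r0 : 0 <= r := normr_ge0 _.
have c0 : 0 < J - cost t x y w by lra.
have k0 : 0 < 2 * t / (2 * r + 1) by rewrite divr_gt0//; lra.
pose d := Num.min 1 (Num.min ((b - a) / 2) ((J - cost t x y w) * (2 * t / (2 * r + 1)))).
have d0 : 0 < d by rewrite !lt_min ltr01 /= (mulr_gt0 c0 k0) andbT; lra.
have d1 : d <= 1 by rewrite ge_min lexx.
have d2 : d <= (b - a) / 2 by rewrite !ge_min lexx orbT.
have d3 : d <= (J - cost t x y w) * (2 * t / (2 * r + 1)).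
  by rewrite !ge_min lexx !orbT.
clearbody d; near=> eps.
have e0 : 0 < eps by near: eps; exact: nbhs_right_gt.
apply: (total_ge_expR _ _ _ _ _ _ _ ab e0 t0 _ _ _ _ (ltW d0) d2 L).
  have H : (r + d) ^+ 2 <= r ^+ 2 + (J - cost t x y w) * (2 * t).
    have : d * (2 * r + 1) <= (J - cost t x y w) * (2 * t).
      by rewrite mulrA ler_pdivlMr// in d3; lra.
    move=> h; have h2 : d * d <= d by rewrite ler_piMl ?(ltW d0).
    lra.
  have Hr : r ^+ 2 = (x - y) ^+ 2 by rewrite /r real_normK ?num_real.
  rewrite -/r -lerBrDl ler_pdivrMr ?mulr_gt0//.
  have -> : (J - w) * (2 * t) = (x - y) ^+ 2 + (J - cost t x y w) * (2 * t).
    by rewrite /cost; field; rewrite gt_eqF.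
  by rewrite -Hr.
have -> : 2 * pi * (eps * t) = eps * (2 * pi * t) by ring.
rewrite -ler_pdivlMr ?mulr_gt0 ?pi_gt0//.
near: eps; apply: nbhs_right_le.
by rewrite divr_gt0 ?exprn_gt0 ?mulr_gt0 ?pi_gt0.
Unshelve. all: by end_near. Qed.

Lemma near_small {R : realType} (k e : R) : 0 <= k -> 0 < e ->
  \forall eps \near (0 : R)^'+, k * eps <= e.
Proof.
move=> k0 e0; near=> eps.
have h : eps <= e / (k + 1) by near: eps; apply: nbhs_right_le; rewrite divr_gt0//; lra.
have : 0 < eps by near: eps; exact: nbhs_right_gt.
rewrite ler_pdivlMr in h; last lra.
nra.
Unshelve. all: by end_near. Qed.

(** Common to heads and tails: T is the mass of P and T' its slope.  The second
quantity is the contribution of P to the velocity; its prefactor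
eps / sqrt (eps t) is at most 1 as soon as eps <= t. *)
Lemma outweighed_near {R : realType} (a b ua ub t x : R) (P : R -> Prop)
    (T T' : R -> R) :
  a < b -> 0 < t -> outweighed a b ua ub t x P ->
  (forall eps I, 0 < eps ->
    (forall y w, level a b ua ub y w -> P y -> I <= cost t x y w) ->
    T eps <= 6 * expR (- (I / eps)) /\ `|T' eps| <= 3 * expR (- (I / eps))) ->
  forall e, 0 < e -> \forall eps \near 0^'+,
    T eps / total_mass a b ua ub 1 eps (Phi_at eps t x) <= e /\
    eps / Num.sqrt (eps * t) *
      (`|T' eps| / total_mass a b ua ub 1 eps (Phi_at eps t x)) <= e.
Proof.
move=> ab t0 [y [w [I [L cI H]]]] HT e e_gt0.
pose J := (cost t x y w + I) / 2.
have cJ : cost t x y w < J by rewrite /J; lra.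
have JI : J < I by rewrite /J; lra.
have H' y' w' : level a b ua ub y' w' -> P y' -> I <= cost t x y' w'.
  by move=> ? ?; exact: H.
near=> eps.
have e0 : 0 < eps by near: eps; exact: nbhs_right_gt.
have [T1 T2] := HT _ _ e0 H'.
have VJ : expR (- (J / eps)) <= total_mass a b ua ub 1 eps (Phi_at eps t x).
  by near: eps; exact: total_mass_ge_near L cJ.
have k0 (k : R) : 0 <= k -> k * (eps / (I - J)) = (k / (I - J)) * eps by move=> _; ring.
split.
  apply: (le_trans (expR_ratio_le _ _ _ _ _ _ e0 JI _ T1 VJ)); first lra.
  rewrite k0//; near: eps; apply: near_small => //.
  by rewrite divr_ge0//; lra.
have s1 : eps / Num.sqrt (eps * t) <= 1.
  rewrite ler_pdivrMr ?sqrtr_gt0 ?mulr_gt0// mul1r.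
  rewrite -[leLHS](ger0_norm (ltW e0)) -sqrtr_sqr ler_sqrt ?mulr_ge0 ?(ltW e0) ?(ltW t0)//.
  rewrite expr2 ler_pM2l//; near: eps; exact: nbhs_right_le.
apply: (@le_trans _ _ (`|T' eps| / total_mass a b ua ub 1 eps (Phi_at eps t x))).
  rewrite ler_piMl// divr_ge0//; exact: le_trans (expR_ge0 _) VJ.
apply: (le_trans (expR_ratio_le _ _ _ _ _ _ e0 JI _ T2 VJ)); first lra.
rewrite k0//; near: eps; apply: near_small => //.
by rewrite divr_ge0//; lra.
Unshelve. all: by end_near. Qed.

Lemma tail_near {R : realType} (a b ua ub t x p e : R) :
  a < b -> 0 < t -> outweighed a b ua ub t x (fun y => p <= y) -> 0 < e ->
  \forall eps \near 0^'+,
    tail_mass a b ua ub p eps (Phi_at eps t x) /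
      total_mass a b ua ub 1 eps (Phi_at eps t x) <= e /\
    eps / Num.sqrt (eps * t) * (`|tail_mass a b ua ub p eps (gauss_at eps t x)| /
        total_mass a b ua ub 1 eps (Phi_at eps t x)) <= e.
Proof.
move=> ab t0 O e0; apply: (outweighed_near _ _ _ _ _ _ _
  (fun eps => tail_mass a b ua ub p eps (Phi_at eps t x))
  (fun eps => tail_mass a b ua ub p eps (gauss_at eps t x)) ab t0 O) => //.
by move=> eps I eps0 H; apply: tail_le => // y w L; exact: H.
Qed.

Lemma head_near {R : realType} (a b ua ub t x p e : R) :
  a < b -> 0 < t -> outweighed a b ua ub t x (fun y => y <= p) -> 0 < e ->
  \forall eps \near 0^'+,
    head_mass a b ua ub p 1 eps (Phi_at eps t x) /
      total_mass a b ua ub 1 eps (Phi_at eps t x) <= e /\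
    eps / Num.sqrt (eps * t) * (`|head_mass a b ua ub p 0 eps (gauss_at eps t x)| /
        total_mass a b ua ub 1 eps (Phi_at eps t x)) <= e.
Proof.
move=> ab t0 O e0; apply: (outweighed_near _ _ _ _ _ _ _
  (fun eps => head_mass a b ua ub p 1 eps (Phi_at eps t x))
  (fun eps => head_mass a b ua ub p 0 eps (gauss_at eps t x)) ab t0 O) => //.
by move=> eps I eps0 H; apply: head_le => // y w L; exact: H.
Qed.

Lemma total_mass_gt0 {R : realType} (a b ua ub eps t x : R) :
  a < b -> 0 < eps -> 0 < t -> 0 < total_mass a b ua ub 1 eps (Phi_at eps t x).
Proof.
move=> ab e0 t0.
have L : level a b ua ub a 0 by apply: Or31.
have d0 : 0 < (b - a) / 2 by lra.
apply: lt_le_trans (total_ge_gauss _ _ _ _ _ _ _ ab e0 t0 _ _ _ (ltW d0) (lexx _) L).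
by rewrite mulr_gt0 ?expR_gt0// mulr_gt0 ?gauss_gt0// divr_gt0// sqrtr_gt0 mulr_gt0.
Qed.

(** The Gibbs measure of [p, +oo[. *)
Definition tail_prob {R : realType} (a b ua ub p eps x t : R) : R :=
  tail_mass a b ua ub p eps (Phi_at eps t x) /
  total_mass a b ua ub 1 eps (Phi_at eps t x).

Lemma tail_prob_ge0 {R : realType} (a b ua ub p eps x t : R) :
  a < b -> 0 < eps -> 0 < t -> 0 <= tail_prob a b ua ub p eps x t.
Proof.
move=> ab e0 t0; rewrite divr_ge0//; first exact: tail_ge0.
exact/ltW/total_mass_gt0.
Qed.

Lemma onem_tail_prob {R : realType} (a b ua ub p eps x t : R) :
  a < b -> 0 < eps -> 0 < t -> 1 - tail_prob a b ua ub p eps x t =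
  head_mass a b ua ub p 1 eps (Phi_at eps t x) /
  total_mass a b ua ub 1 eps (Phi_at eps t x).
Proof.
move=> ab e0 t0; rewrite /tail_prob; have V0 := total_mass_gt0 a b ua ub _ _ x ab e0 t0.
have E : head_mass a b ua ub p 1 eps (Phi_at eps t x) +
  tail_mass a b ua ub p eps (Phi_at eps t x) =
  total_mass a b ua ub 1 eps (Phi_at eps t x) := head_tail_sum _ _ _ _ _ _ _.
rewrite -{1}(divff (lt0r_neq0 V0)) -mulrBl; congr (_ / _); rewrite -E; ring.
Qed.

Lemma tail_prob_le1 {R : realType} (a b ua ub p eps x t : R) :
  a < b -> 0 < eps -> 0 < t -> tail_prob a b ua ub p eps x t <= 1.
Proof.
move=> ab e0 t0; rewrite -subr_ge0 onem_tail_prob// divr_ge0//; first exact: head_ge0.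
exact/ltW/total_mass_gt0.
Qed.

Lemma tail_prob_cvg0 {R : realType} (a b ua ub p x t : R) :
  a < b -> 0 < t -> outweighed a b ua ub t x (fun y => p <= y) ->
  tail_prob a b ua ub p eps x t @[eps --> 0^'+] --> (0 : R).
Proof.
move=> ab t0 O; apply/cvgrPdist_le => e e0; near=> eps.
have eps0 : 0 < eps by near: eps; exact: nbhs_right_gt.
rewrite sub0r normrN ger0_norm ?tail_prob_ge0//.
suff : tail_mass a b ua ub p eps (Phi_at eps t x) /
      total_mass a b ua ub 1 eps (Phi_at eps t x) <= e /\
    eps / Num.sqrt (eps * t) * (`|tail_mass a b ua ub p eps (gauss_at eps t x)| /
        total_mass a b ua ub 1 eps (Phi_at eps t x)) <= e by case.
by near: eps; exact: tail_near.
Unshelve. all: by end_near. Qed.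

Lemma tail_prob_cvg1 {R : realType} (a b ua ub p x t : R) :
  a < b -> 0 < t -> outweighed a b ua ub t x (fun y => y <= p) ->
  tail_prob a b ua ub p eps x t @[eps --> 0^'+] --> (1 : R).
Proof.
move=> ab t0 O; apply/cvgrPdist_le => e e0; near=> eps.
have eps0 : 0 < eps by near: eps; exact: nbhs_right_gt.
rewrite ger0_norm; last by rewrite subr_ge0 tail_prob_le1.
rewrite onem_tail_prob//.
suff : head_mass a b ua ub p 1 eps (Phi_at eps t x) /
      total_mass a b ua ub 1 eps (Phi_at eps t x) <= e /\
    eps / Num.sqrt (eps * t) * (`|head_mass a b ua ub p 0 eps (gauss_at eps t x)| /
        total_mass a b ua ub 1 eps (Phi_at eps t x)) <= e by case.
by near: eps; exact: head_near.
Unshelve. all: by end_near. Qed.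

Lemma is_derive_tail_mass {R : realType} (a b ua ub p eps t x : R) :
  is_derive x 1 (fun y => tail_mass a b ua ub p eps (Phi_at eps t y))
    (tail_mass a b ua ub p eps (gauss_at eps t x) / Num.sqrt (eps * t)).
Proof.
have h q := is_derive_Phi_affine (Num.sqrt (eps * t)) q x.
rewrite /tail_mass /tail_sum /Phi_at /gauss_at.
have h1 := h p; have h2 := h (Num.max a p); have h3 := h (Num.max b p).
apply: is_derive_eq; rewrite /GRing.scale /=; ring.
Qed.

Lemma is_derive_total_mass {R : realType} (a b ua ub k eps t x : R) :
  is_derive x 1 (fun y => total_mass a b ua ub k eps (Phi_at eps t y))
    (total_mass a b ua ub 0 eps (gauss_at eps t x) / Num.sqrt (eps * t)).
Proof.
have h q := is_derive_Phi_affine (Num.sqrt (eps * t)) q x.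
rewrite /total_mass /total_sum /Phi_at /gauss_at.
have h2 := h a; have h3 := h b.
apply: is_derive_eq; rewrite /GRing.scale /=; ring.
Qed.

Lemma u_viscE {R : realType} (a b ua ub eps x t : R) :
  a < b -> 0 < eps -> 0 < t ->
  u_visc a b ua ub eps x t = - (eps / Num.sqrt (eps * t) *
    (total_mass a b ua ub 0 eps (gauss_at eps t x) /
     total_mass a b ua ub 1 eps (Phi_at eps t x))).
Proof.
move=> ab e0 t0; rewrite /u_visc.
have -> : (fun y => V_visc a b ua ub eps y t) =
    (fun y => total_mass a b ua ub 1 eps (Phi_at eps t y)).
  by apply/funext => y; rewrite V_viscE.
rewrite V_viscE// derive1E; have h := is_derive_total_mass a b ua ub 1 eps t x.
rewrite derive_val -/(total_mass a b ua ub 1 eps (Phi_at eps t x)); ring.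
Qed.

(** Split the mass at p.  The tail makes a contribution of at most (x - p) / t
times its probability by [tail_slope_ge], and that probability tends to 1; the
contribution of the head vanishes by [head_near]. *)
Lemma u_visc_upper {R : realType} (a b ua ub x t p e : R) :
  a < b -> 0 < t -> outweighed a b ua ub t x (fun y => y <= p) -> 0 < e ->
  \forall eps \near 0^'+, u_visc a b ua ub eps x t <= (x - p) / t + e.
Proof.
move=> ab t0 O e0; set M := `|(x - p) / t| + 1.
have M0 : 0 < M by rewrite /M; have := normr_ge0 ((x - p) / t); lra.
have d0 : 0 < e / (2 * M) by rewrite divr_gt0// mulr_gt0.
near=> eps.
have eps0 : 0 < eps by near: eps; exact: nbhs_right_gt.
have [] : head_mass a b ua ub p 1 eps (Phi_at eps t x) /
      total_mass a b ua ub 1 eps (Phi_at eps t x) <= e / (2 * M) /\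
    eps / Num.sqrt (eps * t) * (`|head_mass a b ua ub p 0 eps (gauss_at eps t x)| /
        total_mass a b ua ub 1 eps (Phi_at eps t x)) <= e / (2 * M).
  by near: eps; exact: head_near.
rewrite u_viscE//; rewrite -onem_tail_prob//.
have V0 := total_mass_gt0 a b ua ub _ _ x ab eps0 t0.
have E : total_mass a b ua ub 0 eps (gauss_at eps t x) =
  head_mass a b ua ub p 0 eps (gauss_at eps t x) +
  tail_mass a b ua ub p eps (gauss_at eps t x) by rewrite /total_mass -(head_tail_sum _ _ _ _ p).
have S := tail_slope_ge _ _ ua ub _ _ x ab eps0 t0 p.
rewrite -/(tail_mass a b ua ub p eps (gauss_at eps t x)) in S.
rewrite -/(tail_mass a b ua ub p eps (Phi_at eps t x)) in S.
rewrite E; set V := total_mass _ _ _ _ _ _ _ in V0 *.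
set h := head_mass _ _ _ _ _ _ _ _.
set T' := tail_mass a b ua ub p eps (gauss_at eps t x) in S *.
rewrite /tail_prob -/V.
set T := tail_mass a b ua ub p eps (Phi_at eps t x) in S *.
set s := Num.sqrt (eps * t) in S *.
have s0 : 0 < s by rewrite sqrtr_gt0 mulr_gt0.
have ss : s ^+ 2 = eps * t by rewrite sqr_sqrtr// ltW// mulr_gt0.
move=> h1 h2.
have eM : e / (2 * M) * M = e / 2 by field; rewrite gt_eqF.
have M1 : 1 <= M by rewrite /M; have := normr_ge0 ((x - p) / t); lra.
have eM1 : e / (2 * M) <= e / 2 by rewrite -eM; nra.
have g1 : - (eps / s * (T' / V)) <= (x - p) / t * (T / V).
  have -> : (x - p) / t * (T / V) = - (eps / s * (((p - x) / s * T) / V)).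
    have -> : (x - p) / t = (x - p) * eps / s ^+ 2 by rewrite ss; field; rewrite !gt_eqF.
    by field; rewrite !gt_eqF.
  rewrite lerN2 ler_wpM2l ?divr_ge0 ?(ltW eps0) ?(ltW s0)// ler_pM2r ?invr_gt0//.
have g2 : - (eps / s * (h / V)) <= eps / s * (`|h| / V).
  rewrite -mulrN ler_wpM2l ?divr_ge0 ?(ltW eps0) ?(ltW s0)//.
  by rewrite -mulNr ler_pM2r ?invr_gt0// lerNl lerNnormlW.
have g3 : (x - p) / t * (T / V) <= (x - p) / t + e / 2.
  have p0 : 0 <= 1 - T / V.
    by rewrite subr_ge0; exact: (tail_prob_le1 _ _ ua ub p _ x _ ab eps0 t0).
  have : - ((x - p) / t) <= M by rewrite /M; have := ler_norm (- ((x - p) / t)); rewrite normrN; lra.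
  nra.
have -> : - (eps / s * ((h + T') / V)) = - (eps / s * (h / V)) - eps / s * (T' / V).
  ring.
lra.
Unshelve. all: by end_near. Qed.

(** The mirror image of [u_visc_upper]. *)
Lemma u_visc_lower {R : realType} (a b ua ub x t p e : R) :
  a < b -> 0 < t -> outweighed a b ua ub t x (fun y => p <= y) -> 0 < e ->
  \forall eps \near 0^'+, (x - p) / t - e <= u_visc a b ua ub eps x t.
Proof.
move=> ab t0 O e0; set M := `|(x - p) / t| + 1.
have M0 : 0 < M by rewrite /M; have := normr_ge0 ((x - p) / t); lra.
have d0 : 0 < e / (2 * M) by rewrite divr_gt0// mulr_gt0.
near=> eps.
have eps0 : 0 < eps by near: eps; exact: nbhs_right_gt.
have [] : tail_mass a b ua ub p eps (Phi_at eps t x) /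
      total_mass a b ua ub 1 eps (Phi_at eps t x) <= e / (2 * M) /\
    eps / Num.sqrt (eps * t) * (`|tail_mass a b ua ub p eps (gauss_at eps t x)| /
        total_mass a b ua ub 1 eps (Phi_at eps t x)) <= e / (2 * M).
  by near: eps; exact: tail_near.
rewrite u_viscE//.
have V0 := total_mass_gt0 a b ua ub _ _ x ab eps0 t0.
have T0 := tail_prob_ge0 _ _ ua ub p _ x _ ab eps0 t0.
have E : total_mass a b ua ub 0 eps (gauss_at eps t x) =
  head_mass a b ua ub p 0 eps (gauss_at eps t x) +
  tail_mass a b ua ub p eps (gauss_at eps t x) by rewrite /total_mass -(head_tail_sum _ _ _ _ p).
have S := head_slope_le _ _ ua ub _ _ x ab eps0 t0 p.
rewrite -/(head_mass a b ua ub p 0 eps (gauss_at eps t x)) in S.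
rewrite -/(head_mass a b ua ub p 1 eps (Phi_at eps t x)) in S.
have O1 := onem_tail_prob _ _ ua ub p _ x _ ab eps0 t0.
rewrite -/(tail_prob a b ua ub p eps x t).
rewrite E; set V := total_mass _ _ _ _ _ _ _ in V0 O1 *.
set h := head_mass _ _ _ _ _ 0 _ _ in S *; set T' := tail_mass _ _ _ _ _ _ _.
set P := tail_prob _ _ _ _ _ _ _ _ in T0 O1 *.
set H := head_mass _ _ _ _ _ 1 _ _ in S O1 *.
set s := Num.sqrt (eps * t) in S *.
have s0 : 0 < s by rewrite sqrtr_gt0 mulr_gt0.
have ss : s ^+ 2 = eps * t by rewrite sqr_sqrtr// ltW// mulr_gt0.
move=> h1 h2.
have eM : e / (2 * M) * M = e / 2 by field; rewrite gt_eqF.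
have M1 : 1 <= M by rewrite /M; have := normr_ge0 ((x - p) / t); lra.
have eM1 : e / (2 * M) <= e / 2 by rewrite -eM; nra.
have g1 : (x - p) / t * (1 - P) <= - (eps / s * (h / V)).
  have -> : (x - p) / t * (1 - P) = - (eps / s * (((p - x) / s * H) / V)).
    have -> : (x - p) / t = (x - p) * eps / s ^+ 2 by rewrite ss; field; rewrite !gt_eqF.
    by rewrite O1; field; rewrite !gt_eqF.
  rewrite lerN2 ler_wpM2l ?divr_ge0 ?(ltW eps0) ?(ltW s0)// ler_pM2r ?invr_gt0//.
have g2 : eps / s * (T' / V) <= eps / s * (`|T'| / V).
  rewrite ler_wpM2l ?divr_ge0 ?(ltW eps0) ?(ltW s0)//.
  by rewrite ler_pM2r ?invr_gt0// ler_norm.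
have g3 : (x - p) / t - e / 2 <= (x - p) / t * (1 - P).
  have : (x - p) / t <= M by rewrite /M; have := ler_norm ((x - p) / t); lra.
  nra.
have -> : - (eps / s * ((h + T') / V)) = - (eps / s * (h / V)) - eps / s * (T' / V).
  ring.
lra.
Unshelve. all: by end_near. Qed.

(** The mean of (x - y') / t, squeezed between the values at y + d and y - d. *)
Lemma u_visc_cvg {R : realType} (a b ua ub x t y : R) :
  a < b -> 0 < t ->
  (forall d, 0 < d -> outweighed a b ua ub t x (fun z => z <= y - d) /\
                      outweighed a b ua ub t x (fun z => y + d <= z)) ->
  u_visc a b ua ub eps x t @[eps --> 0^'+] --> (x - y) / t.
Proof.
move=> ab t0 H; apply/cvgrPdist_le => e e0.
have d0 : 0 < t * (e / 2) by rewrite mulr_gt0// divr_gt0.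
have [H1 H2] := H _ d0; near=> eps.
have U : u_visc a b ua ub eps x t <= (x - (y - t * (e / 2))) / t + e / 2.
  by near: eps; apply: u_visc_upper => //; rewrite divr_gt0.
have L : (x - (y + t * (e / 2))) / t - e / 2 <= u_visc a b ua ub eps x t.
  by near: eps; apply: u_visc_lower => //; rewrite divr_gt0.
have E1 : (x - (y - t * (e / 2))) / t = (x - y) / t + e / 2 by field; rewrite gt_eqF.
have E2 : (x - (y + t * (e / 2))) / t = (x - y) / t - e / 2 by field; rewrite gt_eqF.
by rewrite ler_norml; apply/andP; split; lra.
Unshelve. all: by end_near. Qed.

(** * Minimisers of the cost *)

Definition bounded_below {R : realType} (a b ua ub t x m : R) :=
  forall y w, level a b ua ub y w -> m <= cost t x y w.

(** The pair (y, w) is a global minimiser of the cost seen from x. *)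
Definition optimal {R : realType} (a b ua ub t x y w : R) :=
  level a b ua ub y w /\ bounded_below a b ua ub t x (cost t x y w).

(** The minimisers at time t, described on the boundaries of the intervals where
the velocity is prescribed.  On ]-oo, g1], [g2, g3] and [g4, +oo[ the minimiser
is x itself, at the levels 0, ua and ua + ub; it is a between g1 and g2 and b
between g3 and g4.  Conditions about an interval that has shrunk to a point are
void, which allows for shocks. *)
Set Implicit Arguments.
Record fan {R : realType} (a b ua ub t g1 g2 g3 g4 : R) : Prop := Fan {
  fan12 : g1 <= g2;
  fan23 : g2 <= g3;
  fan34 : g3 <= g4;
  fan_left : g1 <= a /\ bounded_below a b ua ub t g1 0;
  fan_a : g1 < g2 -> exists2 w, optimal a b ua ub t g1 a w & optimal a b ua ub t g2 a w;
  fan_mid : g2 < g3 -> [/\ a <= g2, g3 <= b, bounded_below a b ua ub t g2 ua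
                         & bounded_below a b ua ub t g3 ua];
  fan_b : g3 < g4 -> exists2 w, optimal a b ua ub t g3 b w & optimal a b ua ub t g4 b w;
  fan_right : b <= g4 /\ bounded_below a b ua ub t g4 (ua + ub) }.
Unset Implicit Arguments.

Section minimisers.
Context {R : realType} (a b ua ub t : R).
Hypotheses (ab : a < b) (t0 : 0 < t).
Notation level := (level a b ua ub).
Notation cost := (cost t).
Notation bounded_below := (bounded_below a b ua ub t).
Notation optimal := (optimal a b ua ub t).
Notation outweighed := (outweighed a b ua ub t).

Lemma cost_shift x x' y w :
  cost x y w = cost x' y w + (x - x') * (x + x' - 2 * y) / (2 * t).
Proof. by rewrite /cost; field; rewrite gt_eqF. Qed.

Lemma cost_self y w : cost y y w = w.
Proof. by rewrite /cost subrr expr0n mul0r addr0. Qed.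

Let le2t (u v : R) : u <= v -> u / (2 * t) <= v / (2 * t).
Proof. by move=> uv; rewrite ler_pM2r// invr_gt0 mulr_gt0. Qed.

Let ge0_2t (u : R) : 0 <= u -> 0 <= u / (2 * t).
Proof. by move=> u0; rewrite divr_ge0// mulr_ge0// ltW. Qed.

Let gt0_2t (u : R) : 0 < u -> 0 < u / (2 * t).
Proof. by move=> u0; rewrite divr_gt0// mulr_gt0. Qed.

(** Comparing the costs from g and from x, the difference is affine in y; this is
why minimisers move monotonically with x. *)
Lemma cost_gap g x yL wL y w : optimal g yL wL -> level y w ->
  cost x yL wL + 2 * (x - g) * (yL - y) / (2 * t) <= cost x y w.
Proof.
move=> [_ O] L; have := O _ _ L.
rewrite (cost_shift x g yL) (cost_shift x g y).
have -> : (x - g) * (x + g - 2 * y) / (2 * t) =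
  (x - g) * (x + g - 2 * yL) / (2 * t) + 2 * (x - g) * (yL - y) / (2 * t).
  by field; rewrite gt_eqF.
lra.
Qed.

(** To the left of g the minimiser yL of g beats all y >= e > yL. *)
Lemma outweighed_right g yL wL e x : optimal g yL wL -> yL < e -> x < g ->
  outweighed x (fun y => e <= y).
Proof.
move=> O yLe xg; exists yL, wL, (cost x yL wL + 2 * (g - x) * (e - yL) / (2 * t)).
split; first by case: O.
  by rewrite ltrDl gt0_2t// mulr_gt0 ?mulr_gt0 ?subr_gt0.
move=> y w ey L; apply: le_trans (cost_gap _ x _ _ _ _ O L).
rewrite lerD2l; apply: le2t; nra.
Qed.

Lemma outweighed_left g yR wR e x : optimal g yR wR -> e < yR -> g < x ->
  outweighed x (fun y => y <= e).
Proof.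
move=> O yLe xg; exists yR, wR, (cost x yR wR + 2 * (x - g) * (yR - e) / (2 * t)).
split; first by case: O.
  by rewrite ltrDl gt0_2t// mulr_gt0 ?mulr_gt0 ?subr_gt0.
move=> y w ey L; apply: le_trans (cost_gap _ x _ _ _ _ O L).
rewrite lerD2l; apply: le2t; nra.
Qed.

(** The limiting case of [outweighed_right] where e is its own minimiser: then yL
is not to the left of e, but as w is constant to the left of e, moving from e
towards x lowers the cost. *)
Lemma outweighed_right_flat e lo w x : lo < e ->
  (forall y, lo <= y <= e -> level y w) -> bounded_below e w -> x < e ->
  outweighed x (fun y => e <= y).
Proof.
move=> loe L B xe; exists (Num.max x lo), w, (w + (e - x) ^+ 2 / (2 * t)); split.
- by apply: L; rewrite le_max lexx orbT/= ge_max (ltW xe) ltW.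
- rewrite /cost ltrD2l ltr_pM2r ?invr_gt0 ?mulr_gt0//.
  by case: (leP x lo) => h; nra.
- move=> y w' ey L'; rewrite (cost_shift x e).
  apply: lerD; first exact: B.
  apply: le2t; nra.
Qed.

Lemma outweighed_left_flat e hi w x : e < hi ->
  (forall y, e <= y <= hi -> level y w) -> bounded_below e w -> e < x ->
  outweighed x (fun y => y <= e).
Proof.
move=> loe L B xe; exists (Num.min x hi), w, (w + (e - x) ^+ 2 / (2 * t)); split.
- by apply: L; rewrite ge_min lexx orbT andbT le_min (ltW xe) ltW.
- rewrite /cost ltrD2l ltr_pM2r ?invr_gt0 ?mulr_gt0//.
  by case: (leP x hi) => h; nra.
- move=> y w' ey L'; rewrite (cost_shift x e).
  apply: lerD; first exact: B.
  apply: le2t; nra.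
Qed.

Definition concentrated x y := forall d, 0 < d ->
  outweighed x (fun z => z <= y - d) /\ outweighed x (fun z => y + d <= z).

(** A point that is optimal from both g and g' is the only minimiser strictly in
between. *)
Lemma concentrated_fixed g g' y w x : optimal g y w -> optimal g' y w ->
  g < x -> x < g' -> concentrated x y.
Proof.
move=> O O' gx xg d d0; split.
- by apply: outweighed_left O _ gx; lra.
- by apply: outweighed_right O' _ xg; lra.
Qed.

(** The cost of x from x is w; any other point pays at least r or the quadratic
term. *)
Lemma concentrated_at x w r : level x w -> 0 < r ->
  (forall y w', level y w' -> 
     w + Num.min r ((x - y) ^+ 2 / (2 * t)) <= cost x y w') ->
  concentrated x x.
Proof.
move=> Lx r0 H d d0.
have d20 : 0 < d ^+ 2 / (2 * t) by rewrite gt0_2t// exprn_gt0.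
have m0 : 0 < Num.min r (d ^+ 2 / (2 * t)) by rewrite lt_min r0.
split; exists x, w, (w + Num.min r (d ^+ 2 / (2 * t))); split => //.
- by rewrite cost_self ltrDl.
- move=> y w' yx L; apply: le_trans (H _ _ L); rewrite lerD2l le_min !ge_min lexx/=.
  by apply/orP; right; apply: le2t; nra.
- by rewrite cost_self ltrDl.
- move=> y w' yx L; apply: le_trans (H _ _ L); rewrite lerD2l le_min !ge_min lexx/=.
  by apply/orP; right; apply: le2t; nra.
Qed.

(** A lower bound at g improves when x moves away from g and from y. *)
Lemma bounded_below_step g x y w w' : bounded_below g w -> level y w' ->
  (g < x /\ y <= g) \/ (x < g /\ g <= y) ->
  w + (x - g) ^+ 2 / (2 * t) <= cost x y w'.
Proof.
move=> B L H; rewrite (cost_shift x g); apply: lerD; first exact: B.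
apply: le2t; case: H => -[h1 h2]; nra.
Qed.

Variables (g1 g2 g3 g4 : R).
Hypothesis F : fan a b ua ub t g1 g2 g3 g4.

Let sq0 (u : R) : u != 0 -> 0 < u ^+ 2 / (2 * t).
Proof. by move=> u0; rewrite gt0_2t// exprn_even_gt0. Qed.

Lemma fan_concentrated_left x : x < g1 -> concentrated x x.
Proof.
move=> xg; have [g1a B] := fan_left F.
apply: (concentrated_at x 0 ((x - g1) ^+ 2 / (2 * t))).
- by apply: Or31; split => //; lra.
- by apply: sq0; rewrite subr_eq0 lt_eqF.
move=> y w L; have [yg|gy] := ltP y g1.
  have -> : w = 0 by case: L => [[_ //]|[/andP[? ?] _]|[? _]]; exfalso; move: (ab) => ?; lra.
  by rewrite /cost lerD2l ge_min lexx orbT.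
have := bounded_below_step _ x _ _ _ B L (or_intror (conj xg gy)).
by apply: le_trans; rewrite lerD2l ge_min lexx.
Qed.

Lemma fan_concentrated_right x : g4 < x -> concentrated x x.
Proof.
move=> xg; have [g1a B] := fan_right F.
apply: (concentrated_at x (ua + ub) ((x - g4) ^+ 2 / (2 * t))).
- by apply: Or33; split => //; lra.
- by apply: sq0; rewrite subr_eq0 gt_eqF.
move=> y w L; have [yg|gy] := ltP g4 y.
  have -> : w = ua + ub by case: L => [[? _]|[/andP[? ?] _]|[_ //]]; exfalso; move: (ab) => ?; lra.
  by rewrite /cost lerD2l ge_min lexx orbT.
have := bounded_below_step _ x _ _ _ B L (or_introl (conj xg gy)).
by apply: le_trans; rewrite lerD2l ge_min lexx.
Qed.

Lemma fan_concentrated_mid x : g2 < x -> x < g3 -> concentrated x x.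
Proof.
move=> gx xg; have [ag gb B2 B3] := fan_mid F (lt_trans gx xg).
apply: (concentrated_at x ua (Num.min ((x - g2) ^+ 2 / (2 * t)) ((x - g3) ^+ 2 / (2 * t)))).
- by apply: Or32; split => //; apply/andP; split; lra.
- by rewrite lt_min !sq0// subr_eq0 ?(gt_eqF gx) ?(lt_eqF xg).
move=> y w L; have [yg|gy] := leP y g2.
  have := bounded_below_step _ x _ _ _ B2 L (or_introl (conj gx yg)).
  by apply: le_trans; rewrite lerD2l !ge_min lexx.
have [yg|yg] := leP g3 y.
  have := bounded_below_step _ x _ _ _ B3 L (or_intror (conj xg yg)).
  by apply: le_trans; rewrite lerD2l !ge_min lexx orbT.
have -> : w = ua by case: L => [[? _]|[/andP[? ?] //]|[? _]]; exfalso; move: (ab) => ?; lra.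
by rewrite /cost lerD2l ge_min lexx orbT.
Qed.

Lemma fan_concentrated_a x : g1 < x -> x < g2 -> concentrated x a.
Proof.
move=> gx xg; have [w O1 O2] := fan_a F (lt_trans gx xg).
exact: concentrated_fixed O1 O2 gx xg.
Qed.

Lemma fan_concentrated_b x : g3 < x -> x < g4 -> concentrated x b.
Proof.
move=> gx xg; have [w O1 O2] := fan_b F (lt_trans gx xg).
exact: concentrated_fixed O1 O2 gx xg.
Qed.

Let opt1 : optimal g1 g1 0.
Proof.
have [g1a B] := fan_left F; split; last by rewrite cost_self.
exact: Or31.
Qed.

Let opt4 : optimal g4 g4 (ua + ub).
Proof.
have [g4b B] := fan_right F; split; last by rewrite cost_self.
exact: Or33.
Qed.

Let opt23 : g2 < g3 -> optimal g2 g2 ua /\ optimal g3 g3 ua.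
Proof.
move=> h; have [ag gb B2 B3] := fan_mid F h.
by split; (split; last by rewrite cost_self); apply: Or32; split => //;
  apply/andP; split; lra.
Qed.

(* From g2 there is always a minimiser at a or further to the left: if g1 = g2 it
   is g1 itself. *)
Let leftmost2 c : a < c -> exists2 y, y < c & exists w, optimal g2 y w.
Proof.
move=> ac; have := fan12 F; rewrite le_eqVlt => /predU1P[<-|h].
  exists g1; last by exists 0.
  by have [] := fan_left F; lra.
by exists a => //; have [w _ O] := fan_a F h; exists w.
Qed.

Let rightmost3 c : c < b -> exists2 y, c < y & exists w, optimal g3 y w.
Proof.
move=> ac; have := fan34 F; rewrite le_eqVlt => /predU1P[->|h].
  exists g4; last by exists (ua + ub).
  by have [] := fan_right F; lra.
by exists b => //; have [w O _] := fan_b F h; exists w.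
Qed.

(** The tail probability at c jumps at the projection of c onto [g2, g3]: if c
lies outside, a whole range of positions, containing c, is skipped by the
minimiser at the nearest end of [g2, g3]. *)
Lemma fan_split_mid c x : a < c -> c < b ->
  let g := Num.max g2 (Num.min c g3) in
  (x < g -> outweighed x (fun y => c <= y)) /\
  (g < x -> outweighed x (fun y => y <= c)).
Proof.
move=> ac cb g; have [y2 y2c [w2 O2]] := leftmost2 c ac.
have [y3 y3c [w3 O3]] := rightmost3 c cb.
have := fan23 F; rewrite le_eqVlt => /predU1P[E|g23].
  have -> : g = g2 by rewrite /g -E; case: (leP c g2) => h; rewrite ?max_l ?maxxx.
  by split=> h; [exact: outweighed_right O2 _ h|apply: outweighed_left O3 _ _ => //; rewrite -E].
have [Q2 Q3] := opt23 g23.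
have [cg2|g2c] := ltP c g2.
  have -> : g = g2 by rewrite /g min_l ?max_l//; lra.
  by split=> h; [exact: outweighed_right O2 _ h|exact: outweighed_left Q2 _ h].
have [g3c|cg3] := ltP g3 c.
  have -> : g = g3 by rewrite /g min_r ?max_r//; lra.
  by split=> h; [exact: outweighed_right Q3 _ h|exact: outweighed_left O3 _ h].
have -> : g = c by rewrite /g min_l ?max_r//; lra.
have [ag gb B2 B3] := fan_mid F g23.
have B : bounded_below c ua.
  move=> y w L; have [yg|gy] := leP y g2.
    have := B2 _ _ L; rewrite (cost_shift c g2) => h.
    by rewrite -[leLHS]addr0; apply: lerD => //; apply: ge0_2t; nra.
  have [yg|yg] := leP g3 y.
    have := B3 _ _ L; rewrite (cost_shift c g3) => h.
    by rewrite -[leLHS]addr0; apply: lerD => //; apply: ge0_2t; nra.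
  have -> : w = ua by case: L => [[? _]|[/andP[? ?] //]|[? _]]; exfalso; move: (ab) => ?; lra.
  by rewrite /cost lerDl ge0_2t// sqr_ge0.
split=> h.
  apply: (outweighed_right_flat c a ua) => // y /andP[? ?].
  by apply: Or32; split => //; apply/andP; split; lra.
apply: (outweighed_left_flat c b ua) => // y /andP[? ?].
by apply: Or32; split => //; apply/andP; split; lra.
Qed.

(** The tail probability at d jumps at d as long as d is not overtaken by g4. *)
Lemma fan_split_right d x : b < d ->
  let g := Num.max d g4 in
  (x < g -> outweighed x (fun y => d <= y)) /\
  (g < x -> outweighed x (fun y => y <= d)).
Proof.
move=> bd g; have [dg4|g4d] := ltP d g4.
  have -> : g = g4 by rewrite /g max_r// ltW.
  have [y yd [w O]] : exists2 y, y < d & exists w, optimal g4 y w.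
    have := fan34 F; rewrite le_eqVlt => /predU1P[E34|h]; last first.
      by exists b => //; have [w _ O] := fan_b F h; exists w.
    have := fan23 F; rewrite le_eqVlt => /predU1P[E23|h].
      rewrite -E34 -E23; apply: leftmost2; exact: lt_trans ab bd.
    exists g3; last by exists ua; rewrite -E34; case: (opt23 h).
    by have [_ ? _ _] := fan_mid F h; lra.
  split=> h; first exact: outweighed_right O _ h.
  exact: outweighed_left opt4 _ h.
have -> : g = d by rewrite /g max_l.
have [g4b B4] := fan_right F.
have B : bounded_below d (ua + ub).
  move=> y w L; have [yg|gy] := leP y g4.
    have := B4 _ _ L; rewrite (cost_shift d g4) => h.
    by rewrite -[leLHS]addr0; apply: lerD => //; apply: ge0_2t; nra.
  have -> : w = ua + ub by case: L => [[? _]|[/andP[? ?] _]|[_ //]]; exfalso; move: (ab) => ?; lra.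
  by rewrite /cost lerDl ge0_2t// sqr_ge0.
split=> h.
  apply: (outweighed_right_flat d b (ua + ub)) => // y /andP[? ?].
  by apply: Or33.
apply: (outweighed_left_flat d (d + 1) (ua + ub)) => //; first lra.
by move=> y /andP[? ?]; apply: Or33; split => //; lra.
Qed.

End minimisers.

(** * The possible configurations of the four curves *)

(** The assertion [bounded_below] multiplied by 2 t, with p = 2 t ua, q = 2 t ub
and M for 2 t m.  Each component treats one piece: either its level alone is at
least M, or x lies beyond one of its ends and the distance to that end makes up
for the difference. *)
Definition scaled_bound {R : realType} (a b p q x M : R) : Prop :=
  [/\ M <= 0 \/ (a <= x /\ M <= (x - a) ^+ 2),
      [\/ M <= p, x <= a /\ M <= p + (x - a) ^+ 2 | b <= x /\ M <= p + (x - b) ^+ 2]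
    & M <= p + q \/ (x <= b /\ M <= p + q + (x - b) ^+ 2)].

Lemma scaled_boundP {R : realType} (a b ua ub t p q x m : R) :
  0 < t -> p = 2 * t * ua -> q = 2 * t * ub ->
  scaled_bound a b p q x (2 * t * m) -> bounded_below a b ua ub t x m.
Proof.
move=> t0 pE qE [hA hB hC] y w L.
have t20 : 0 < 2 * t by lra.
have -> : cost t x y w = (2 * t * w + (x - y) ^+ 2) / (2 * t).
  by rewrite /cost; field; rewrite gt_eqF.
rewrite ler_pdivlMr// mulrC; move: (2 * t * m) hA hB hC => M hA hB hC.
case: L => [[ya ->]|[/andP[ay yb] ->]|[yb ->]].
- rewrite mulr0 add0r; have := sqr_ge0 (x - y); case: hA => [h|[h1 h2]]; nra.
- rewrite -pE; have := sqr_ge0 (x - y); case: hB => [h|[h1 h2]|[h1 h2]]; nra.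
- by rewrite mulrDr -pE -qE; have := sqr_ge0 (x - y); case: hC => [h|[h1 h2]]; nra.
Qed.

(** The scalars wa and wb are the scaled levels at which a and b are optimal. *)
Lemma fan_scaled {R : realType} (a b ua ub t p q g1 g2 g3 g4 wa wb : R) :
  a < b -> 0 < t -> p = 2 * t * ua -> q = 2 * t * ub ->
  [/\ g1 <= g2, g2 <= g3, g3 <= g4, g1 <= a & b <= g4] ->
  [/\ wa = 0 \/ wa = p, wb = p \/ wb = p + q,
      scaled_bound a b p q g1 0 & scaled_bound a b p q g4 (p + q)] ->
  (g1 < g2 -> scaled_bound a b p q g1 (wa + (g1 - a) ^+ 2) /\
              scaled_bound a b p q g2 (wa + (g2 - a) ^+ 2)) ->
  (g2 < g3 -> [/\ a <= g2, g3 <= b, scaled_bound a b p q g2 p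
                & scaled_bound a b p q g3 p]) ->
  (g3 < g4 -> scaled_bound a b p q g3 (wb + (g3 - b) ^+ 2) /\
              scaled_bound a b p q g4 (wb + (g4 - b) ^+ 2)) ->
  fan a b ua ub t g1 g2 g3 g4.
Proof.
move=> ab t0 pE qE [h12 h23 h34 h1a hb4] [hwa hwb S1 S4] Sa Sm Sb.
have t20 : 0 < 2 * t by lra.
have toS x m M : 2 * t * m = M -> scaled_bound a b p q x M ->
    bounded_below a b ua ub t x m.
  by move=> <-; exact: scaled_boundP.
have costE x y w W : 2 * t * w = W -> 2 * t * cost t x y w = W + (x - y) ^+ 2.
  by move=> <-; rewrite /cost; field; rewrite gt_eqF.
have [w Lw wE] : exists2 w, level a b ua ub a w & 2 * t * w = wa.
  case: hwa => ->.
    by exists 0; rewrite ?mulr0//; exact: Or31.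
  by exists ua => //; apply: Or32; rewrite lexx ltW.
have [w' Lw' wE'] : exists2 w, level a b ua ub b w & 2 * t * w = wb.
  case: hwb => ->.
    by exists ua => //; apply: Or32; rewrite lexx ltW.
  by exists (ua + ub); rewrite ?mulrDr -?pE -?qE//; exact: Or33.
split => //.
- by split => //; apply: toS S1; rewrite mulr0.
- move=> h; have [A1 A2] := Sa h; exists w; split => //.
    exact: toS (costE _ _ _ _ wE) A1.
  exact: toS (costE _ _ _ _ wE) A2.
- move=> h; have [ag gb A1 A2] := Sm h.
  by split => //; [exact: toS A1|exact: toS A2].
- move=> h; have [A1 A2] := Sb h; exists w'; split => //.
    exact: toS (costE _ _ _ _ wE') A1.
  exact: toS (costE _ _ _ _ wE') A2.
- by split => //; apply: toS S4; rewrite mulrDr pE qE.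
Qed.

(** Tries the alternatives of [scaled_bound] in order. *)
Ltac bound_tac :=
  split;
  [ first [left; nra | right; split; nra]
  | first [apply: Or31; nra | apply: Or32; split; nra | apply: Or33; split; nra]
  | first [left; nra | right; split; nra] ].

(** In the names, n and p are the signs of ua and ub; A, B and C are the square
roots of the absolute values of p, q and p + q.  In the first four lemmas the
disturbances issued from a and b have not met. *)
Section fans.
Context {R : realType} (a b ua ub t p q : R).
Hypotheses (ab : a < b) (t0 : 0 < t) (pE : p = 2 * t * ua) (qE : q = 2 * t * ub).

Lemma fan_apart_np A B : 0 <= A -> 0 <= B -> p = - A ^+ 2 -> q = B ^+ 2 ->
  fan a b ua ub t (a - A) a b (b + B).
Proof.
move=> A0 B0 pA qB; have ab' := ab.
apply: (@fan_scaled _ _ _ _ _ _ p q _ _ _ _ p p ab t0 pE qE); rewrite ?pA ?qB.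
- by split; lra.
- by split; [right|left|bound_tac|bound_tac].
- by move=> _; split; bound_tac.
- by move=> _; split; [lra|lra|bound_tac|bound_tac].
- by move=> _; split; bound_tac.
Qed.

Lemma fan_apart_pp A B : 0 <= A -> 0 <= B -> p = A ^+ 2 -> q = B ^+ 2 ->
  A <= b - a -> fan a b ua ub t a (a + A) b (b + B).
Proof.
move=> A0 B0 pA qB Al; have ab' := ab.
apply: (@fan_scaled _ _ _ _ _ _ p q _ _ _ _ 0 p ab t0 pE qE); rewrite ?pA ?qB.
- by split; lra.
- by split; [left|left|bound_tac|bound_tac].
- by move=> _; split; bound_tac.
- by move=> _; split; [lra|lra|bound_tac|bound_tac].
- by move=> _; split; bound_tac.
Qed.

Lemma fan_apart_pn A B : 0 <= A -> 0 <= B -> p = A ^+ 2 -> q = - B ^+ 2 ->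
  A + B <= b - a -> fan a b ua ub t a (a + A) (b - B) b.
Proof.
move=> A0 B0 pA qB Al; have ab' := ab.
apply: (@fan_scaled _ _ _ _ _ _ p q _ _ _ _ 0 (p + q) ab t0 pE qE); rewrite ?pA ?qB.
- by split; lra.
- by split; [left|right|bound_tac|bound_tac].
- by move=> _; split; bound_tac.
- by move=> _; split; [lra|lra|bound_tac|bound_tac].
- by move=> _; split; bound_tac.
Qed.

Lemma fan_apart_nn A B : 0 <= A -> 0 <= B -> p = - A ^+ 2 -> q = - B ^+ 2 ->
  B <= b - a -> fan a b ua ub t (a - A) a (b - B) b.
Proof.
move=> A0 B0 pA qB Al; have ab' := ab.
apply: (@fan_scaled _ _ _ _ _ _ p q _ _ _ _ p (p + q) ab t0 pE qE); rewrite ?pA ?qB.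
- by split; lra.
- by split; [right|right|bound_tac|bound_tac].
- by move=> _; split; bound_tac.
- by move=> _; split; [lra|lra|bound_tac|bound_tac].
- by move=> _; split; bound_tac.
Qed.

(** The wave from a has overtaken everything issued from b.  The last hypothesis
says that the middle piece is never optimal at the front. *)
Lemma fan_forward C : 0 <= p -> p + q = C ^+ 2 -> b - a <= C ->
  q <= (C - (b - a)) ^+ 2 ->
  fan a b ua ub t a (a + C) (a + C) (a + C).
Proof.
move=> p0 pq lC h; have ab' := ab.
apply: (@fan_scaled _ _ _ _ _ _ p q _ _ _ _ 0 p ab t0 pE qE).
- by split; lra.
- by split; [left|left|bound_tac|bound_tac].
- by move=> _; split; bound_tac.
- by rewrite ltxx.
- by rewrite ltxx.
Qed.

Lemma fan_backward C : q <= 0 -> p + q = - C ^+ 2 -> b - a <= C ->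
  - p <= (C - (b - a)) ^+ 2 ->
  fan a b ua ub t (b - C) (b - C) (b - C) b.
Proof.
move=> q0 pq lC h; have ab' := ab.
apply: (@fan_scaled _ _ _ _ _ _ p q _ _ _ _ 0 (p + q) ab t0 pE qE).
- by split; lra.
- by split; [left|right|bound_tac|bound_tac].
- by rewrite ltxx.
- by rewrite ltxx.
- by move=> _; split; bound_tac.
Qed.

(** In the next three lemmas m is the point at which a and b, taken at their
optimal levels, have equal costs; it is a shock.  Here a is at level 0 and b at
level ua. *)
Lemma fan_meet_pp m A B C : 0 <= A -> 0 <= B -> 0 <= C ->
  p = A ^+ 2 -> q = B ^+ 2 -> p + q = C ^+ 2 ->
  2 * (b - a) * (m - (a + b) / 2) = p -> b - a <= A -> C - B <= b - a ->
  fan a b ua ub t a m m (b + B).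
Proof.
move=> A0 B0 C0 pA qB pq mE lA CB; have ab' := ab.
have mab : (m - a) ^+ 2 = p + (m - b) ^+ 2 by rewrite -mE; field.
have bm : b <= m by nra.
have mB : m <= b + B by nra.
apply: (@fan_scaled _ _ _ _ _ _ p q _ _ _ _ 0 p ab t0 pE qE).
- by split; lra.
- by split; [left|left|bound_tac|bound_tac].
- by move=> _; split; bound_tac.
- by rewrite ltxx.
- by move=> _; split; bound_tac.
Qed.

(** Here a is at level 0 and b at level ua + ub. *)
Lemma fan_meet_pn m A B : 0 <= A -> 0 <= B ->
  p = A ^+ 2 -> q = - B ^+ 2 -> p + q <= (b - a) ^+ 2 -> - (p + q) <= (b - a) ^+ 2 ->
  2 * (b - a) * (m - (a + b) / 2) = p + q -> b - a <= A + B ->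
  fan a b ua ub t a m m b.
Proof.
move=> A0 B0 pA qB pq1 pq2 mE lA; have ab' := ab.
have mab : (m - a) ^+ 2 = p + q + (m - b) ^+ 2 by rewrite -mE; field.
have bm : m <= b by nra.
have am : a <= m by nra.
have h1 : A <= B + (b - a) by nra.
have h2 : B <= A + (b - a) by nra.
have mA : m - a <= A by nra.
apply: (@fan_scaled _ _ _ _ _ _ p q _ _ _ _ 0 (p + q) ab t0 pE qE).
- by split; lra.
- by split; [left|right|bound_tac|bound_tac].
- by move=> _; split; bound_tac.
- by rewrite ltxx.
- by move=> _; split; bound_tac.
Qed.

(** Here a is at level ua and b at level ua + ub. *)
Lemma fan_meet_nn m A B C : 0 <= A -> 0 <= B -> 0 <= C ->
  p = - A ^+ 2 -> q = - B ^+ 2 -> p + q = - C ^+ 2 ->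
  2 * (b - a) * (m - (a + b) / 2) = q -> b - a <= B -> C - A <= b - a ->
  fan a b ua ub t (a - A) m m b.
Proof.
move=> A0 B0 C0 pA qB pq mE lA CB; have ab' := ab.
have mab : (m - a) ^+ 2 = q + (m - b) ^+ 2 by rewrite -mE; field.
have bm : m <= a by nra.
have mB : a - A <= m by nra.
apply: (@fan_scaled _ _ _ _ _ _ p q _ _ _ _ p (p + q) ab t0 pE qE).
- by split; lra.
- by split; [right|right|bound_tac|bound_tac].
- by move=> _; split; bound_tac.
- by rewrite ltxx.
- by move=> _; split; bound_tac.
Qed.
End fans.

(** * The curves of the six cases *)

Section curves.
Context {R : realType}.
Implicit Types a b c d w t k r : R.

Lemma forwardE a w t : 0 <= t -> forward a w t = a + Num.sqrt (2 * t) * Num.sqrt w.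
Proof. by move=> t0; rewrite /forward mulrAC sqrtrM// mulr_ge0. Qed.

Lemma backwardE a w t : 0 <= t ->
  backward a w t = a - Num.sqrt (2 * t) * Num.sqrt (- w).
Proof.
move=> t0; rewrite /backward.
have -> : - 2 * w * t = 2 * t * (- w) by ring.
by rewrite sqrtrM// mulr_ge0.
Qed.

(** All the times at which the curves change are of this form; the comparison of
t with them becomes linear in sqrt (2 t). *)
Lemma time_leE r k t : 0 < r -> 0 <= k -> 0 <= t ->
  (t <= k ^+ 2 / (2 * r ^+ 2)) = (Num.sqrt (2 * t) * r <= k).
Proof.
move=> r0 k0 t0; have h0 : 0 <= Num.sqrt (2 * t) * r by rewrite mulr_ge0 ?sqrtr_ge0 ?ltW.
have -> : (Num.sqrt (2 * t) * r <= k) = ((Num.sqrt (2 * t) * r) ^+ 2 <= k ^+ 2).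
  by rewrite ler_sqr.
rewrite exprMn sqr_sqrtr ?mulr_ge0// ler_pdivlMr ?mulr_gt0 ?exprn_gt0//.
by congr (_ <= _); ring.
Qed.

Lemma time_le_sqrtE w k t : 0 < w -> 0 <= k -> 0 <= t ->
  (t <= k ^+ 2 / (2 * w)) = (Num.sqrt (2 * t) * Num.sqrt w <= k).
Proof.
move=> w0 k0 t0; rewrite -time_leE ?sqrtr_gt0//.
by rewrite sqr_sqrtr// ltW.
Qed.

Lemma time_le_sqrtNE w k t : w < 0 -> 0 <= k -> 0 <= t ->
  (t <= k ^+ 2 / (- 2 * w)) = (Num.sqrt (2 * t) * Num.sqrt (- w) <= k).
Proof.
move=> w0 k0 t0; rewrite -time_le_sqrtE ?oppr_gt0//.
by rewrite mulNr mulrN.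
Qed.

Lemma clamp_mid g2 g3 c : g2 <= c -> c <= g3 -> Num.max g2 (Num.min c g3) = c.
Proof. by move=> h1 h2; rewrite min_l// max_r. Qed.

Lemma clamp_lo g2 g3 c : c <= g2 -> Num.max g2 (Num.min c g3) = g2.
Proof. by move=> h1; rewrite max_l// ge_min h1. Qed.

Lemma clamp_hi g2 g3 c : g3 <= c -> g2 <= g3 -> Num.max g2 (Num.min c g3) = g3.
Proof. by move=> h1 h2; rewrite min_r// max_r. Qed.

Lemma clamp_eq g c : Num.max g (Num.min c g) = g.
Proof. by rewrite max_l// ge_min lexx orbT. Qed.
End curves.

(** In each case A, B and C are sqrt (2 t) times the square roots of the absolute
values of ua, ub and ua + ub: the distances run by the waves.  The comparisons
of t with the break times are restated with them (T1, T2, T3), as are those of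
c and d with the meeting point (X, X3).  The combinations of comparisons that
cannot occur are excluded by C^2 = A^2 + B^2 or its analogue. *)
Section cases.
Context {R : realType} (a b c d ua ub t : R).
Hypotheses (ac : a < c) (cb : c < b) (bd : b < d) (t0 : 0 < t).
Let ab : a < b. Proof. exact: lt_trans ac cb. Qed.
Let tau := Num.sqrt (2 * t).
Let tau0 : 0 < tau. Proof. by rewrite sqrtr_gt0 mulr_gt0. Qed.
Let tau2 : 2 * t = tau ^+ 2. Proof. by rewrite sqr_sqrtr// mulr_ge0// ltW. Qed.
Let t0' := ltW t0.
Let ba0 : 0 <= b - a. Proof. by rewrite subr_ge0 ltW. Qed.
Let ca0 : 0 <= c - a. Proof. by rewrite subr_ge0 ltW. Qed.
Let bc0 : 0 <= b - c. Proof. by rewrite subr_ge0 ltW. Qed.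
Let db0 : 0 <= d - b. Proof. by rewrite subr_ge0 ltW. Qed.
Let da0 : 0 <= d - a. Proof. by rewrite subr_ge0 ltW// (lt_trans ab). Qed.

Let sqE w : 0 <= w -> 2 * t * w = (tau * Num.sqrt w) ^+ 2.
Proof. by move=> w0; rewrite tau2 exprMn [Num.sqrt w ^+ 2]sqr_sqrtr. Qed.

Let sqNE w : w <= 0 -> 2 * t * w = - (tau * Num.sqrt (- w)) ^+ 2.
Proof. by move=> w0; rewrite -sqE ?oppr_ge0//; ring. Qed.

Let sq_ge0 w : 0 <= tau * Num.sqrt w.
Proof. by rewrite mulr_ge0 ?sqrtr_ge0// ltW. Qed.

Let chordE w : 2 * (b - a) * (chord a b w t - (a + b) / 2) = 2 * t * w.
Proof. by rewrite /chord; field; rewrite subr_eq0 gt_eqF. Qed.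

Section case1.
Hypotheses (ua0 : ua < 0) (ub0 : 0 < ub).

Lemma case1_fan : fan a b ua ub t (Case1.gamma_a a ua t) (still a t) (still b t)
  (Case1.gamma_b b ub t).
Proof.
rewrite /Case1.gamma_a /Case1.gamma_b /still forwardE// backwardE//.
apply: (fan_apart_np _ _ _ _ _ _ _ ab t0 erefl erefl); rewrite ?sq_ge0//.
  by rewrite sqNE// ltW.
by rewrite sqE// ltW.
Qed.

Lemma case1_gamma_c :
  Case1.gamma_c c t = Num.max (still a t) (Num.min c (still b t)).
Proof. by rewrite clamp_mid// ltW. Qed.

Lemma case1_gamma_d : Case1.gamma_d b d ub t = Num.max d (Case1.gamma_b b ub t).
Proof.
rewrite /Case1.gamma_d /Case1.gamma_b /until /still time_le_sqrtE// forwardE//.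
rewrite -/tau; case: (leP _ (d - b)) => h; first by rewrite max_l//; lra.
by rewrite max_r//; lra.
Qed.
End case1.

Section case2.
Hypotheses (ua0 : 0 < ua) (ub0 : 0 < ub).
Let ra := Num.sqrt ua.
Let rb := Num.sqrt ub.
Let rs := Num.sqrt (ua + ub).
Let ra0 : 0 < ra. Proof. by rewrite sqrtr_gt0. Qed.
Let rb0 : 0 < rb. Proof. by rewrite sqrtr_gt0. Qed.
Let us0 : 0 < ua + ub. Proof. exact: addr_gt0. Qed.
Let rs2 : rs ^+ 2 = ra ^+ 2 + rb ^+ 2.
Proof. by rewrite !sqr_sqrtr ?ltW. Qed.
Let rsb : rb < rs. Proof. by rewrite ltr_sqrt// ltrDr. Qed.
Let rsb0 : 0 < rs - rb. Proof. by rewrite subr_gt0. Qed.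
Let A := tau * ra.
Let B := tau * rb.
Let C := tau * rs.
Let A0 : 0 < A. Proof. exact: mulr_gt0. Qed.
Let B0 : 0 < B. Proof. exact: mulr_gt0. Qed.
Let BC : B < C. Proof. by rewrite ltr_pM2l. Qed.
Let C2 : C ^+ 2 = A ^+ 2 + B ^+ 2.
Proof. by rewrite !exprMn rs2 mulrDr. Qed.
Let T1 : (t <= Case2.t1 a b ua) = (A <= b - a).
Proof. by rewrite /Case2.t1 time_le_sqrtE. Qed.
Let T2 : (t <= Case2.tstar a b ua ub) = (C - B <= b - a).
Proof. by rewrite /Case2.tstar time_leE// mulrBr. Qed.

Lemma case2_fan : fan a b ua ub t (still a t) (Case2.gamma_a a b ua ub t)
  (Case2.gamma_b1 a b ua ub t) (Case2.gamma_b2 a b ua ub t).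
Proof.
rewrite /Case2.gamma_a /Case2.gamma_b1 /Case2.gamma_b2 /until /still.
rewrite -/(Case2.tstar a b ua ub) T1 T2 !forwardE// -/tau -/ra -/rb -/rs -/A -/B -/C.
have pA : 2 * t * ua = A ^+ 2 by rewrite sqE// ltW.
have qB : 2 * t * ub = B ^+ 2 by rewrite sqE// ltW.
have [h1|h1] := leP A (b - a); have [h2|h2] := leP (C - B) (b - a).
- exact: (fan_apart_pp _ _ _ _ _ _ _ ab t0 erefl erefl _ _ (ltW A0) (ltW B0)).
- exfalso; move: A0 B0 BC C2 => ????; nra.
- apply: (fan_meet_pp _ _ _ _ _ _ _ ab t0 erefl erefl _ A B C) => //; rewrite ?ltW//.
  + exact: lt_trans BC.
  + by rewrite pA qB C2.
- apply: (fan_forward _ _ _ _ _ _ _ ab t0 erefl erefl).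
  + by rewrite pA sqr_ge0.
  + by rewrite pA qB C2.
  + move: A0 B0 BC C2 => ????; nra.
  + rewrite qB; move: A0 B0 BC C2 => ????; nra.
Qed.

Lemma case2_gamma_c : Case2.gamma_c a b c ua ub t =
  Num.max (Case2.gamma_a a b ua ub t) (Num.min c (Case2.gamma_b1 a b ua ub t)).
Proof.
rewrite /Case2.gamma_a /Case2.gamma_b1 /Case2.gamma_c /Case2.tc3 /until /still.
rewrite -/(Case2.tstar a b ua ub) T1 T2 time_le_sqrtE// !forwardE//.
rewrite -/tau -/ra -/rs -/A -/C.
have [h|h] := leP A (c - a).
  have -> : A <= b - a by move: cb => ?; lra.
  by rewrite clamp_mid//; [lra|exact: ltW].
have [h1|h1] := leP A (b - a); first by rewrite clamp_lo//; lra.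
by rewrite clamp_eq.
Qed.

Lemma case2_gamma_d :
  Case2.gamma_d a b d ua ub t = Num.max d (Case2.gamma_b2 a b ua ub t).
Proof.
rewrite /Case2.gamma_d /Case2.gamma_b2 /Case2.td /until /still.
have X : (d < Case2.xstar a b ua ub) = ((d - b) * (C - B) < (b - a) * B).
  rewrite /Case2.xstar -ltrBlDl ltr_pdivlMr// -/rb -/rs -(ltr_pM2l tau0).
  by congr (_ < _); rewrite /C /B; ring.
have X' : (Case2.xstar a b ua ub < d) = ((b - a) * B < (d - b) * (C - B)).
  rewrite /Case2.xstar -ltrBrDl ltr_pdivrMr// -/rb -/rs -(ltr_pM2l tau0).
  by congr (_ < _); rewrite /C /B; ring.
case: ltgtP => [h|h|dx]; rewrite !T2.
- rewrite X in h; rewrite time_le_sqrtE// !forwardE// -/tau -/rb -/rs -/B -/C.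
  have [hB|hB] := leP B (d - b).
    have -> : C - B <= b - a by move: B0 BC ab bd => ????; nra.
    by rewrite max_l//; lra.
  have [hD|hD] := leP (C - B) (b - a); first by rewrite max_r//; lra.
  by rewrite max_r//; lra.
- rewrite X' in h; rewrite time_le_sqrtE// !forwardE// -/tau -/rb -/rs -/B -/C.
  have [hB|hB] := leP C (d - a).
    have [hD|hD] := leP (C - B) (b - a); last by rewrite max_l//; lra.
    by rewrite max_l//; move: B0 BC ab bd => ????; nra.
  have [hD|hD] := leP (C - B) (b - a); last by rewrite max_r//; lra.
  by exfalso; move: B0 BC ab bd => ????; nra.
- have h : (d - b) * (C - B) = (b - a) * B.
    rewrite dx /Case2.xstar /C /B -/rb -/rs; field.
    by rewrite subr_eq0 gt_eqF.
  rewrite !forwardE// -/tau -/rb -/rs -/B -/C.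
  have [hD|hD] := leP (C - B) (b - a).
    rewrite max_l//; move: B0 BC ab bd => ????; nra.
  rewrite max_r//; move: B0 BC ab bd => ????; nra.
Qed.
End case2.

(** In the cases ub < 0 < ua the two parabolas meet when A + B = b - a, at a point
that does not depend on the sign of ua + ub.  The curve gamma_c has the same
form in the three cases; late stands for its common continuation after the
meeting. *)
Section towards.
Hypotheses (ua0 : 0 < ua) (ub0 : ub < 0).
Let ra := Num.sqrt ua.
Let rb := Num.sqrt (- ub).
Let ra0 : 0 < ra. Proof. by rewrite sqrtr_gt0. Qed.
Let rb0 : 0 < rb. Proof. by rewrite sqrtr_gt0 oppr_gt0. Qed.
Let rab0 : 0 < ra + rb. Proof. exact: addr_gt0. Qed.
Let A := tau * ra.
Let B := tau * rb.
Let A0 : 0 < A. Proof. exact: mulr_gt0. Qed.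
Let B0 : 0 < B. Proof. exact: mulr_gt0. Qed.
Let pA : 2 * t * ua = A ^+ 2. Proof. by rewrite sqE// ltW. Qed.
Let qB : 2 * t * ub = - B ^+ 2. Proof. by rewrite sqNE// ltW. Qed.
Let T3 : (t <= Case3.tstar a b ua ub) = (A + B <= b - a).
Proof. by rewrite /Case3.tstar time_leE// mulrDr. Qed.
Let X3 : (c < Case3.xstar a b ua ub) = ((c - a) * (A + B) < (b - a) * A).
Proof.
rewrite /Case3.xstar -ltrBlDl ltr_pdivlMr// -/ra -/rb -(ltr_pM2l tau0).
by congr (_ < _); rewrite /A /B; ring.
Qed.
Let X3' : (Case3.xstar a b ua ub < c) = ((b - a) * A < (c - a) * (A + B)).
Proof.
rewrite /Case3.xstar -ltrBrDl ltr_pdivrMr// -/ra -/rb -(ltr_pM2l tau0).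
by congr (_ < _); rewrite /A /B; ring.
Qed.
Let X3e : c = Case3.xstar a b ua ub -> (b - a) * A = (c - a) * (A + B).
Proof. by rewrite /Case3.xstar -/ra -/rb /A /B => ->; field; rewrite gt_eqF. Qed.

Let clamp_before late : (c - a) * (A + B) < (b - a) * A ->
  (if A <= c - a then c else if A + B <= b - a then a + A else late) =
  Num.max (if A + B <= b - a then a + A else late)
    (Num.min c (if A + B <= b - a then b - B else late)).
Proof.
move=> h; have [hA|hA] := leP A (c - a).
  have -> : A + B <= b - a by move: A0 B0 ac cb => ????; nra.
  by rewrite clamp_mid//; move: A0 B0 ac cb => ????; nra.
have [hD|hD] := leP (A + B) (b - a); last by rewrite clamp_eq.
by rewrite clamp_lo//; lra.
Qed.

Let clamp_after late : (b - a) * A < (c - a) * (A + B) ->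
  (if B <= b - c then c else if A + B <= b - a then b - B else late) =
  Num.max (if A + B <= b - a then a + A else late)
    (Num.min c (if A + B <= b - a then b - B else late)).
Proof.
move=> h; have [hA|hA] := leP B (b - c).
  have -> : A + B <= b - a by move: A0 B0 ac cb => ????; nra.
  by rewrite clamp_mid//; move: A0 B0 ac cb => ????; nra.
have [hD|hD] := leP (A + B) (b - a); last by rewrite clamp_eq.
by rewrite clamp_hi//; lra.
Qed.

Let clamp_at late : (b - a) * A = (c - a) * (A + B) ->
  (if A + B <= b - a then c else late) =
  Num.max (if A + B <= b - a then a + A else late)
    (Num.min c (if A + B <= b - a then b - B else late)).
Proof.
move=> h; have [hD|hD] := leP (A + B) (b - a); last by rewrite clamp_eq.
by rewrite clamp_mid//; move: A0 B0 ac cb => ????; nra.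
Qed.

Section case3.
Hypothesis us0 : 0 < ua + ub.
Let rs := Num.sqrt (ua + ub).
Let C := tau * rs.
Let C0 : 0 < C. Proof. by rewrite mulr_gt0// sqrtr_gt0. Qed.
Let C2 : C ^+ 2 = A ^+ 2 - B ^+ 2.
Proof. by rewrite -pA -[- B ^+ 2]qB -sqE ?ltW// mulrDr. Qed.
Let T2 : (t <= Case3.t2 a b ua ub) = (C <= b - a).
Proof. by rewrite /Case3.t2 time_le_sqrtE. Qed.

Lemma case3_fan : fan a b ua ub t (still a t) (Case3.gamma_a a b ua ub t)
  (Case3.gamma_b1 a b ua ub t) (Case3.gamma_b2 a b ua ub t).
Proof.
rewrite /Case3.gamma_a /Case3.gamma_b1 /Case3.gamma_b2 /until /still.
rewrite T3 T2 !forwardE// backwardE// -/tau -/ra -/rb -/rs -/A -/B -/C.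
have [h1|h1] := leP (A + B) (b - a); have [h2|h2] := leP C (b - a).
- exact: (fan_apart_pn _ _ _ _ _ _ _ ab t0 erefl erefl _ _ (ltW A0) (ltW B0)).
- exfalso; move: A0 B0 C0 C2 => ????; nra.
- apply: (fan_meet_pn _ _ _ _ _ _ _ ab t0 erefl erefl _ A B) => //; rewrite ?(ltW A0) ?(ltW B0) ?(ltW h1)//.
  + rewrite pA qB -C2; have := sqr_ge0 C; have := sqr_ge0 (b - a); move: C0 => ?. nra.
  + rewrite pA qB -C2; have := sqr_ge0 C; have := sqr_ge0 (b - a); move: C0 => ?. nra.
  + by rewrite chordE mulrDr.
- apply: (fan_forward _ _ _ _ _ _ _ ab t0 erefl erefl).
  + by rewrite pA sqr_ge0.
  + by rewrite pA qB C2.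
  + exact: ltW.
  + by rewrite qB; have := sqr_ge0 B; have := sqr_ge0 (C - (b - a)); lra.
Qed.

Lemma case3_gamma_c : Case3.gamma_c a b c ua ub t =
  Num.max (Case3.gamma_a a b ua ub t) (Num.min c (Case3.gamma_b1 a b ua ub t)).
Proof.
rewrite /Case3.gamma_a /Case3.gamma_b1 /Case3.gamma_c.
case: ltgtP => [h|h|h]; rewrite /until /still !T3 ?time_le_sqrtE// ?time_le_sqrtNE//
  ?forwardE// ?backwardE// -/tau -/ra -/rb -/A -/B.
- by rewrite -clamp_before -?X3.
- by rewrite -clamp_after -?X3'.
- by rewrite -clamp_at//; exact: X3e.
Qed.

Lemma case3_gamma_d :
  Case3.gamma_d a d ua ub t = Num.max d (Case3.gamma_b2 a b ua ub t).
Proof.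
rewrite /Case3.gamma_d /Case3.gamma_b2 /until /still T2 time_le_sqrtE// !forwardE//.
rewrite -/tau -/rs -/C; move: bd ab => ??.
case: (leP C (d - a)) => h; case: (leP C (b - a)) => h'.
- by rewrite max_l// ltW.
- by rewrite max_l//; lra.
- by exfalso; lra.
- by rewrite max_r//; lra.
Qed.
End case3.

Section case4.
Hypothesis us0 : ua + ub < 0.
Let rs := Num.sqrt (- (ua + ub)).
Let C := tau * rs.
Let C0 : 0 < C. Proof. by rewrite mulr_gt0// sqrtr_gt0 oppr_gt0. Qed.
Let C2 : - C ^+ 2 = A ^+ 2 - B ^+ 2.
Proof. by rewrite -pA -[- B ^+ 2]qB -sqNE ?ltW// mulrDr. Qed.
Let T2 : (t <= Case4.t2 a b ua ub) = (C <= b - a).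
Proof. by rewrite /Case4.t2 time_le_sqrtNE. Qed.

Lemma case4_fan : fan a b ua ub t (Case4.gamma_a1 a b ua ub t)
  (Case4.gamma_a2 a b ua ub t) (Case4.gamma_b a b ua ub t) (still b t).
Proof.
rewrite /Case4.gamma_a1 /Case4.gamma_a2 /Case4.gamma_b /until /still.
rewrite -/(Case3.tstar a b ua ub) T3 T2 forwardE// !backwardE//.
rewrite -/tau -/ra -/rb -/rs -/A -/B -/C.
have [h1|h1] := leP (A + B) (b - a); have [h2|h2] := leP C (b - a).
- exact: (fan_apart_pn _ _ _ _ _ _ _ ab t0 erefl erefl _ _ (ltW A0) (ltW B0)).
- exfalso; move: A0 B0 C0 C2 => ????; nra.
- apply: (fan_meet_pn _ _ _ _ _ _ _ ab t0 erefl erefl _ A B) => //; rewrite ?(ltW A0) ?(ltW B0) ?(ltW h1)//.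
  + rewrite pA qB -C2; have := sqr_ge0 C; have := sqr_ge0 (b - a); move: C0 => ?. nra.
  + rewrite pA qB -C2; have := sqr_ge0 C; have := sqr_ge0 (b - a); move: C0 => ?. nra.
  + by rewrite chordE mulrDr.
- apply: (fan_backward _ _ _ _ _ _ _ ab t0 erefl erefl).
  + by rewrite qB oppr_le0 sqr_ge0.
  + by rewrite pA qB C2.
  + exact: ltW.
  + by rewrite pA; have := sqr_ge0 A; have := sqr_ge0 (C - (b - a)); lra.
Qed.

Lemma case4_gamma_c : Case4.gamma_c a b c ua ub t =
  Num.max (Case4.gamma_a2 a b ua ub t) (Num.min c (Case4.gamma_b a b ua ub t)).
Proof.
rewrite /Case4.gamma_a2 /Case4.gamma_b /Case4.gamma_c.
rewrite -/(Case3.tstar a b ua ub) -/(Case3.xstar a b ua ub).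
case: ltgtP => [h|h|h]; rewrite /until /still !T3 ?time_le_sqrtE// ?time_le_sqrtNE//
  ?forwardE// ?backwardE// -/tau -/ra -/rb -/A -/B.
- by rewrite -clamp_before -?X3.
- by rewrite -clamp_after -?X3'.
- by rewrite -clamp_at//; exact: X3e.
Qed.

End case4.

Section case5.
Hypothesis us0 : ua + ub = 0.
Let AB : A = B.
Proof. by rewrite /A /B /ra /rb; congr (_ * Num.sqrt _); move: us0 => ?; lra. Qed.

Lemma case5_fan : fan a b ua ub t (still a t)
  (Case5.gamma_a a b ua ub t) (Case5.gamma_b a b ua ub t) (still b t).
Proof.
rewrite /Case5.gamma_a /Case5.gamma_b /until /still.
rewrite -/(Case3.tstar a b ua ub) T3 forwardE// backwardE//.
rewrite -/tau -/ra -/rb -/A -/B.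
have [h1|h1] := leP (A + B) (b - a).
  exact: (fan_apart_pn _ _ _ _ _ _ _ ab t0 erefl erefl _ _ (ltW A0) (ltW B0)).
have E : 2 * t * ua + 2 * t * ub = 0 by rewrite -mulrDr us0 mulr0.
apply: (fan_meet_pn _ _ _ _ _ _ _ ab t0 erefl erefl _ A B) => //;
  rewrite ?E ?oppr0 ?sqr_ge0 ?ltW//; ring.
Qed.

Lemma case5_gamma_c : Case5.gamma_c a b c ua ub t =
  Num.max (Case5.gamma_a a b ua ub t) (Num.min c (Case5.gamma_b a b ua ub t)).
Proof.
rewrite /Case5.gamma_a /Case5.gamma_b /Case5.gamma_c -/(Case3.tstar a b ua ub).
case: ltgtP => [h|h|h]; rewrite /until /still !T3 ?time_le_sqrtE// ?time_le_sqrtNE//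
  ?forwardE// ?backwardE// -/tau -/ra -/rb -/A -/B.
- by rewrite -clamp_before// -AB; move: A0 => ?; nra.
- by rewrite -clamp_after// -AB; move: A0 => ?; nra.
- have [hD|hD] := leP (A + B) (b - a); last by rewrite clamp_eq.
  by rewrite clamp_mid//; move: AB => ?; lra.
Qed.
End case5.
End towards.

Section case6.
Hypotheses (ua0 : ua < 0) (ub0 : ub < 0).
Let ra := Num.sqrt (- ua).
Let rb := Num.sqrt (- ub).
Let rs := Num.sqrt (- (ua + ub)).
Let ra0 : 0 < ra. Proof. by rewrite sqrtr_gt0 oppr_gt0. Qed.
Let rb0 : 0 < rb. Proof. by rewrite sqrtr_gt0 oppr_gt0. Qed.
Let us0 : ua + ub < 0. Proof. by move: ua0 ub0 => ??; lra. Qed.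
Let rsa : ra < rs. Proof. by rewrite ltr_sqrt ?oppr_gt0// ltrN2; move: ub0 => ?; lra. Qed.
Let rsa0 : 0 < rs - ra. Proof. by rewrite subr_gt0. Qed.
Let A := tau * ra.
Let B := tau * rb.
Let C := tau * rs.
Let A0 : 0 < A. Proof. exact: mulr_gt0. Qed.
Let B0 : 0 < B. Proof. exact: mulr_gt0. Qed.
Let AC : A < C. Proof. by rewrite ltr_pM2l. Qed.
Let pA : 2 * t * ua = - A ^+ 2. Proof. by rewrite sqNE// ltW. Qed.
Let qB : 2 * t * ub = - B ^+ 2. Proof. by rewrite sqNE// ltW. Qed.
Let C2 : C ^+ 2 = A ^+ 2 + B ^+ 2.
Proof.
have : - C ^+ 2 = - A ^+ 2 - B ^+ 2 by rewrite -pA -[- B ^+ 2]qB -sqNE ?ltW// mulrDr.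
lra.
Qed.
Let T1 : (t <= Case6.t1 a b ub) = (B <= b - a).
Proof. by rewrite /Case6.t1 time_le_sqrtNE. Qed.
Let T2 : (t <= Case6.t2 a b ua ub) = (C - A <= b - a).
Proof. by rewrite /Case6.t2 time_leE// mulrBr. Qed.

Lemma case6_fan : fan a b ua ub t (Case6.gamma_a1 a b ua ub t)
  (Case6.gamma_a2 a b ua ub t) (Case6.gamma_b a b ua ub t) (still b t).
Proof.
rewrite /Case6.gamma_a1 /Case6.gamma_a2 /Case6.gamma_b /until /still.
rewrite T1 T2 !backwardE// -/tau -/ra -/rb -/rs -/A -/B -/C.
have [h1|h1] := leP B (b - a); have [h2|h2] := leP (C - A) (b - a).
- exact: (fan_apart_nn _ _ _ _ _ _ _ ab t0 erefl erefl _ _ (ltW A0) (ltW B0)).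
- exfalso; move: A0 B0 AC C2 => ????; nra.
- apply: (fan_meet_nn _ _ _ _ _ _ _ ab t0 erefl erefl _ A B C) => //; rewrite ?ltW//.
  + exact: lt_trans AC.
  + by rewrite pA qB C2; ring.
- apply: (fan_backward _ _ _ _ _ _ _ ab t0 erefl erefl).
  + by rewrite qB oppr_le0 sqr_ge0.
  + by rewrite pA qB C2; ring.
  + move: A0 B0 AC C2 => ????; nra.
  + rewrite pA opprK; move: A0 B0 AC C2 => ????; nra.
Qed.

Lemma case6_gamma_c : Case6.gamma_c a b c ua ub t =
  Num.max (Case6.gamma_a2 a b ua ub t) (Num.min c (Case6.gamma_b a b ua ub t)).
Proof.
rewrite /Case6.gamma_a2 /Case6.gamma_b /Case6.gamma_c /until /still.
rewrite T1 T2 time_le_sqrtNE// !backwardE// -/tau -/ra -/rb -/rs -/B -/C.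
move: ac cb => ??.
have [h|h] := leP B (b - c).
  have -> : B <= b - a by lra.
  by rewrite clamp_mid//; lra.
have [h1|h1] := leP B (b - a); first by rewrite clamp_hi//; lra.
by rewrite clamp_eq.
Qed.
End case6.

Lemma still_gamma_d : still d t = Num.max d (still b t).
Proof. by rewrite /still max_l// ltW. Qed.

End cases.

(** * The density at positive viscosity *)

Lemma Rintegral_cvg_at_right {R : realType} (D : set R) (F : R -> R -> R)
    (f g : R -> R) :
  measurable D ->
  (forall eps, 0 < eps -> measurable_fun D (F eps)) ->
  measurable_fun D f ->
  {ae lebesgue_measure, forall x, D x -> F eps x @[eps --> 0^'+] --> f x} ->
  lebesgue_measure.-integrable D (EFin \o g) ->
  (forall eps x, 0 < eps -> D x -> `|F eps x| <= g x) ->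
  \int[lebesgue_measure]_(x in D) F eps x @[eps --> 0^'+] -->
  \int[lebesgue_measure]_(x in D) f x.
Proof.
move=> mD mF mf Ff ig Fg; apply/cvg_at_rightP => u [u0 u_cvg].
have [] := @dominated_convergence _ _ R lebesgue_measure D mD
  (fun n x => (F (u n) x)%:E) (EFin \o f) (EFin \o g).
- by move=> n; apply/measurable_EFinP; exact: mF.
- exact/measurable_EFinP.
- move: Ff; apply: filterS; first exact: (ae_filter_ringOfSetsType lebesgue_measure).
  move=> x Ffx Dx.
  apply: cvg_EFin; first exact: nearW.
  by move/cvg_at_rightP : (Ffx Dx); apply.
- exact: ig.
- by apply: aeW => x n Dx; rewrite lee_fin; exact: Fg.
move=> intf _ cv; rewrite /Rintegral.
apply: fine_cvg; rewrite fineK; first exact: cv.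
exact: integrable_fin_num.
Qed.

Lemma ae_neq {R : realType} (p : R) (P : R -> Prop) :
  (forall x, x != p -> P x) -> {ae lebesgue_measure, forall x, P x}.
Proof.
move=> H; exists [set p]; split => //; first exact: lebesgue_measure_set1.
by move=> x /= nP; apply: contrapT => xp; apply: nP; apply: H; apply/eqP.
Qed.

Lemma continuous_compact_integrableT {R : realType} (f : R -> R) (K : R) :
  continuous f -> lebesgue_measure.-integrable `[- K, K] (EFin \o f).
Proof.
move=> cf; apply: continuous_compact_integrable; first exact: segment_compact.
exact: continuous_subspaceT.
Qed.

Lemma derivable_oo_LR {R : realType} (f : R -> R) (u v : R) :
  (forall x, derivable f x 1) -> derivable_oo_LRcontinuous f u v.
Proof.
move=> df; have cf : continuous f.
  by move=> x; apply: differentiable_continuous; apply/derivable1_diffP.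
split; first by move=> x _; exact: df.
  by apply: cvg_at_right_filter; exact: cf.
by apply: cvg_at_left_filter; exact: cf.
Qed.

Lemma tail_sum_cvg {R : realType} {T : topologicalType} (a b E1 E2 p : R)
    (G : T -> R -> R) (x : T) :
  (forall q, G y q @[y --> x] --> G x q) ->
  tail_sum a b E1 E2 p (G y) @[y --> x] --> tail_sum a b E1 E2 p (G x).
Proof.
move=> H; apply: cvgD; last by apply: cvgM; [exact: cvg_cst|exact: H].
apply: cvgD; first by apply: cvgB; exact: H.
by apply: cvgM; [exact: cvg_cst|apply: cvgB; exact: H].
Qed.

Lemma total_sum_cvg {R : realType} {T : topologicalType} (a b E1 E2 k : R)
    (G : T -> R -> R) (x : T) :
  (forall q, G y q @[y --> x] --> G x q) ->
  total_sum a b E1 E2 k (G y) @[y --> x] --> total_sum a b E1 E2 k (G x).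
Proof.
move=> H; apply: cvgD; last by apply: cvgM; [exact: cvg_cst|exact: H].
apply: cvgD; first exact: cvg_cst.
by apply: cvgM; [exact: cvg_cst|exact: H].
Qed.

Lemma Phi_at_cvg_x {R : realType} (eps t x q : R) :
  Phi_at eps t y q @[y --> x] --> Phi_at eps t x q.
Proof.
apply: (cvg_comp (fun y => (y - q) / Num.sqrt (eps * t)) Phi); last exact: continuous_Phi.
by apply: cvgM; [apply: cvgB; [exact: cvg_id|exact: cvg_cst]|exact: cvg_cst].
Qed.

Lemma gauss_at_cvg_x {R : realType} (eps t x q : R) :
  gauss_at eps t y q @[y --> x] --> gauss_at eps t x q.
Proof.
apply: (cvg_comp (fun y => (y - q) / Num.sqrt (eps * t)) gauss); last exact: continuous_gauss.
by apply: cvgM; [apply: cvgB; [exact: cvg_id|exact: cvg_cst]|exact: cvg_cst].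
Qed.

Lemma Phi_at_cvg_t {R : realType} (eps t x q : R) : 0 < eps -> 0 < t ->
  Phi_at eps r x q @[r --> t] --> Phi_at eps t x q.
Proof.
move=> e0 t0.
apply: (cvg_comp (fun r => (x - q) / Num.sqrt (eps * r)) Phi); last exact: continuous_Phi.
apply: cvgM; first exact: cvg_cst.
apply: cvgV; first by rewrite gt_eqF// sqrtr_gt0 mulr_gt0.
apply: (cvg_comp (fun r => eps * r) Num.sqrt); last exact: sqrt_continuous.
by apply: cvgM; [exact: cvg_cst|exact: cvg_id].
Qed.

(** The x-derivative of [tail_prob]. *)
Definition dtail_prob {R : realType} (a b ua ub p eps x t : R) : R :=
  (tail_mass a b ua ub p eps (gauss_at eps t x) *
     total_mass a b ua ub 1 eps (Phi_at eps t x) -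
   tail_mass a b ua ub p eps (Phi_at eps t x) *
     total_mass a b ua ub 0 eps (gauss_at eps t x)) /
  (Num.sqrt (eps * t) * total_mass a b ua ub 1 eps (Phi_at eps t x) ^+ 2).

Section smoothness.
Context {R : realType} (a b ua ub p eps : R).
Hypotheses (ab : a < b) (e0 : 0 < eps).

Lemma is_derive_tail_prob (x t : R) : 0 < t ->
  is_derive x 1 (fun y => tail_prob a b ua ub p eps y t)
    (dtail_prob a b ua ub p eps x t).
Proof.
move=> t0; have h1 := is_derive_tail_mass a b ua ub p eps t x.
have h2 := is_derive_total_mass a b ua ub 1 eps t x.
have V0 := total_mass_gt0 a b ua ub eps t x ab e0 t0.
have V1 : total_mass a b ua ub 1 eps (Phi_at eps t x) != 0 by rewrite gt_eqF.
have s0 : Num.sqrt (eps * t) != 0 by rewrite gt_eqF// sqrtr_gt0 mulr_gt0.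
have h3 := is_deriveV (f := fun y => total_mass a b ua ub 1 eps (Phi_at eps t y)) V1 h2.
rewrite /tail_prob; apply: is_derive_eq.
rewrite /dtail_prob /GRing.scale /=; field; exact/andP.
Qed.

Lemma continuous_tail_prob_x (t : R) : 0 < t ->
  continuous (fun x => tail_prob a b ua ub p eps x t).
Proof.
move=> t0 x; apply: differentiable_continuous; apply/derivable1_diffP.
by have [] := is_derive_tail_prob x t t0.
Qed.

Lemma continuous_dtail_prob (t : R) : 0 < t ->
  continuous (fun x => dtail_prob a b ua ub p eps x t).
Proof.
move=> t0 x; apply: cvgM; first apply: cvgB; try apply: cvgM.
- by apply: tail_sum_cvg => q; exact: gauss_at_cvg_x.
- by apply: total_sum_cvg => q; exact: Phi_at_cvg_x.
- by apply: tail_sum_cvg => q; exact: Phi_at_cvg_x.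
- by apply: total_sum_cvg => q; exact: gauss_at_cvg_x.
apply: cvgV.
  by rewrite gt_eqF// mulr_gt0 ?sqrtr_gt0 ?exprn_gt0 ?total_mass_gt0// mulr_gt0.
apply: cvgM; first exact: cvg_cst.
by apply: cvgM; apply: total_sum_cvg => q; exact: Phi_at_cvg_x.
Qed.

Lemma tail_prob_cvg_t (x t : R) : 0 < t ->
  tail_prob a b ua ub p eps x r @[r --> t] --> tail_prob a b ua ub p eps x t.
Proof.
move=> t0; apply: cvgM.
  by apply: tail_sum_cvg => q; exact: Phi_at_cvg_t.
apply: cvgV; first by rewrite gt_eqF// total_mass_gt0.
by apply: total_sum_cvg => q; exact: Phi_at_cvg_t.
Qed.

Lemma dtail_prob_by_parts (f : R -> R) (K t : R) : 0 < t -> 0 < K ->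
  (forall x, derivable f x 1) -> continuous (f^`()%classic) ->
  f K = 0 -> f (- K) = 0 ->
  \int[lebesgue_measure]_(x in `[- K, K]) (dtail_prob a b ua ub p eps x t * f x) =
  - \int[lebesgue_measure]_(x in `[- K, K]) (tail_prob a b ua ub p eps x t * f^`()%classic x).
Proof.
move=> t0 K0 df cf' fK fNK.
have KK : - K < K by lra.
have D x := is_derive_tail_prob x t t0.
have cd : {within `[- K, K], continuous (fun x => dtail_prob a b ua ub p eps x t)}.
  exact/continuous_subspaceT/continuous_dtail_prob.
have Dtail : derivable_oo_LRcontinuous (fun x => tail_prob a b ua ub p eps x t) (- K) K.
  by apply: derivable_oo_LR => x; have [] := D x.
have dE : {in `]- K, K[, (fun x => tail_prob a b ua ub p eps x t)^`()%classic =1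
    (fun x => dtail_prob a b ua ub p eps x t)}.
  by move=> x _; rewrite derive1E; have h := D x; rewrite derive_val.
have cf'K : {within `[- K, K], continuous (f^`()%classic)}.
  exact: continuous_subspaceT.
have Df := derivable_oo_LR f (- K) K df.
have := Rintegration_by_parts KK cd Dtail dE cf'K Df (fun _ _ => erefl).
by move=> ->; rewrite fK fNK !mulr0 subrr sub0r opprK.
Qed.

End smoothness.

(** The initial datum of S is that of V multiplied by
rhoc * step c + rhod * step d, so R is a combination of tail probabilities. *)
Lemma rho_viscE {R : realType} (a b c d ua ub rhoc rhod eps x t : R) :
  a < c -> c < b -> b < d -> 0 < eps -> 0 < t ->
  rho_visc a b c d ua ub rhoc rhod eps x t =
  rhoc * dtail_prob a b ua ub c eps x t + rhod * dtail_prob a b ua ub d eps x t.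
Proof.
move=> ac cb bd e0 t0; have ab := lt_trans ac cb; rewrite /rho_visc.
have -> : (fun y => R_visc a b c d ua ub rhoc rhod eps y t) =
    (fun y => rhoc * tail_prob a b ua ub c eps y t +
              rhod * tail_prob a b ua ub d eps y t).
  apply/funext => y; rewrite /R_visc (S_viscE a b c d)// V_viscE//.
  rewrite /tail_prob /tail_mass /total_mass; ring.
rewrite derive1E; have h1 := is_derive_tail_prob a b ua ub c eps ab e0 x t t0.
have h2 := is_derive_tail_prob a b ua ub d eps ab e0 x t t0.
by rewrite derive_val /GRing.scale/=; ring.
Qed.

(** * Convergence against test functions *)

Lemma Rintegral_derive1 {R : realType} (f : R -> R) (u v : R) : u < v ->
  (forall x, derivable f x 1) -> continuous (f^`()%classic) ->
  \int[lebesgue_measure]_(x in `[u, v]) (f^`()%classic x) = f v - f u.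
Proof.
move=> uv df cf; have cf' : {within `[u, v], continuous (f^`()%classic)}.
  exact: continuous_subspaceT.
have E := continuous_FTC2 uv cf' (derivable_oo_LR f u v df) (fun _ _ => erefl).
by rewrite /Rintegral E.
Qed.

(** The distributional form of: the derivative of a unit jump at g is the Dirac
measure at g.  The three cases are g beyond K, below - K, and in between. *)
Lemma Rintegral_derive1_beyond {R : realType} (f : R -> R) (K g : R) : 0 < K ->
  (forall x, derivable f x 1) -> continuous (f^`()%classic) ->
  (forall x, K <= `|x| -> f x = 0) ->
  \int[lebesgue_measure]_(x in `[- K, K]) ((g < x)%R%:R * f^`()%classic x) = - f g.
Proof.
move=> K0 df cf f0.
have fK : f K = 0 by apply: f0; rewrite ler_norm.
have fNK : f (- K) = 0 by apply: f0; rewrite normrN ler_norm.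
have [gK|Kg] := ltP g K; last first.
  rewrite f0 ?ler_normr ?Kg// oppr0.
  under eq_Rintegral => x.
    rewrite inE/= in_itv/= => /andP[_ xK].
    rewrite ltNge (le_trans xK Kg) mul0r; over.
  by rewrite Rintegral_cst// mul0r.
have [gNK|Kg] := ltP g (- K).
  rewrite f0 ?ler_normr; last by apply/orP; right; lra.
  under eq_Rintegral => x.
    rewrite inE/= in_itv/= => /andP[xK _].
    rewrite (lt_le_trans gNK xK) mul1r; over.
  by rewrite Rintegral_derive1//; lra.
have -> : - f g = f K - f g by rewrite fK sub0r.
rewrite -Rintegral_derive1// -Rintegral_itv_obnd_cbnd; last first.
  apply: (integrableS _ _ _ (continuous_compact_integrableT _ K cf)) => //.
  by move=> x /=; rewrite !in_itv/= => /andP[h ->]; rewrite (le_trans Kg (ltW h)).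
rewrite Rintegral_mkcond [RHS]Rintegral_mkcond; apply: eq_Rintegral => x _.
rewrite !patchE !mem_setE !in_itv/=; case: (ltP g x) => gx /=.
  by rewrite mul1r (le_trans Kg (ltW gx)).
by rewrite mul0r; case: ifP.
Qed.

Section test.
Context {R : realType} (phi : R -> R -> R) (M : R).
Hypotheses (sphi : smooth phi) (M0 : 0 <= M).
Hypothesis phi0 : forall x t : R, 0 <= t -> M < `|x| \/ M < t -> phi x t = 0.
Let px : R -> R -> R := partial [:: true] phi.

Lemma test_derivable t x : derivable (fun y => phi y t) x 1.
Proof. by have [_ H] := sphi [::]; have [H1 _] := H x t; exact: H1. Qed.

Let cpx : continuous (fun p : R * R => px p.1 p.2).
Proof. by have [] := sphi [:: true]. Qed.

Let cpx_x t : continuous (fun x => px x t).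
Proof.
move=> x; apply: (cvg_comp (fun y => (y, t)) (fun p : R * R => px p.1 p.2) _ (cpx (x, t))).
by apply: (@cvg_pair _ _ _ (nbhs x) (nbhs x) (nbhs t)); [exact: cvg_id|exact: cvg_cst].
Qed.

Let cpx_t x : continuous (px x).
Proof.
move=> t; apply: (cvg_comp (fun y => (x, y)) (fun p : R * R => px p.1 p.2) _ (cpx (x, t))).
by apply: (@cvg_pair _ _ _ (nbhs t) (nbhs x) (nbhs t)); [exact: cvg_cst|exact: cvg_id].
Qed.

Let px_late x t : 0 <= t -> M < t -> px x t = 0.
Proof.
move=> t0 Mt; rewrite /px /= (_ : (fun y => phi y t) = cst 0).
  by rewrite derive1E derive_cst.
by apply/funext => y; apply: phi0 => //; right.
Qed.

(* Any bound exceeding M serves: phi vanishes at - K and K and for t >= K. *)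
Let K := M + 1.
Let K0 : 0 < K. Proof. by rewrite ltr_wpDl. Qed.

Let px_bound : exists2 B, 0 <= B &
  forall x t, `[- K, K]%classic x -> 0 <= t -> `|px x t| <= B.
Proof.
have cpt : compact (`[- K, K] `*` `[0, K] : set (R * R)).
  by apply: compact_setX; exact: segment_compact.
have : compact [set px p.1 p.2 | p in (`[- K, K] `*` `[0, K] : set (R * R))].
  apply: continuous_compact cpt; exact: continuous_subspaceT.
move/compact_bounded => [B [Br HB]].
exists (`|B| + 1); first by rewrite addr_ge0.
move=> x t xK t0; have [tM|Mt] := leP t M; last first.
  by rewrite px_late// normr0 addr_ge0.
apply: (HB (`|B| + 1)); first by rewrite ltr_pwDr// ler_norm.
exists (x, t) => //; split => //=; rewrite in_itv/= t0 /K.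
by rewrite (le_trans tM)// lerDl.
Qed.

Section one_particle.
Variables (a b ua ub e : R).
Hypothesis ab : a < b.

(* Minus the pairing of the derivative of the tail probability with phi at time
   t, after integration by parts. *)
Let I eps t : R :=
  \int[lebesgue_measure]_(x in `[- K, K]) (tail_prob a b ua ub e eps x t * px x t).

Let int_x eps t : 0 < eps -> 0 < t ->
  lebesgue_measure.-integrable `[- K, K]
    (EFin \o (fun x => tail_prob a b ua ub e eps x t * px x t)).
Proof.
move=> e0 t0; apply: continuous_compact_integrableT => x; apply: cvgM.
  exact: continuous_tail_prob_x.
exact: cpx_x.
Qed.

(* Continuity in t is established for the sake of measurability. *)
Let cI eps : 0 < eps -> {in `]0, +oo[%classic, continuous (I eps)}.
Proof.
move=> e0 t; rewrite inE/= in_itv/= andbT => t0.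
have [B B0 HB] := px_bound.
have h (r : R) : `]0, (t + 1)[%classic r -> 0 < r.
  by rewrite /= in_itv/= => /andP[].
apply: (@continuity_under_integral R _ _ lebesgue_measure
  (fun r x => tail_prob a b ua ub e eps x r * px x r) `[- K, K] _ 0 (t + 1)
  _ _ (cst B)) => //.
- by move=> r /h r0; exact: int_x.
- apply: aeW => x _ r; rewrite inE => /h r0.
  by apply: cvgM; [exact: tail_prob_cvg_t|exact: cpx_t].
- by apply: continuous_compact_integrableT => x; exact: cvg_cst.
- move=> r /h r0; apply: aeW => x xK; rewrite normrM.
  rewrite -[leRHS]mul1r ler_pM//; last by apply: HB => //; exact: ltW.
  by rewrite ger0_norm ?tail_prob_ge0 ?tail_prob_le1.
- by rewrite inE/= in_itv/= t0/= ltrDl.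
Qed.

Let mI eps : 0 < eps -> measurable_fun (`]0, +oo[%classic : set R) (I eps).
Proof.
by move=> e0; apply: open_continuous_measurable_fun; [exact: interval_open|exact: cI].
Qed.

Let I_bound : exists C, forall eps t, 0 < eps -> `]0, +oo[%classic t ->
  `|I eps t| <= C * \1_(`[0, M]) t.
Proof.
have [B B0 HB] := px_bound.
exists (B * fine (lebesgue_measure `[- K, K])) => eps t e0 /=.
rewrite in_itv/= andbT => t0; have t0' := ltW t0.
have [tM|Mt] := leP t M; last first.
  rewrite indicE memNset ?mulr0; last first.
    by rewrite /= in_itv/= => /andP[_]; rewrite leNgt Mt.
  rewrite /I; under eq_Rintegral do rewrite px_late// mulr0.
  by rewrite Rintegral_cst// mul0r normr0.
rewrite indicE mem_set ?mulr1; last by rewrite /= in_itv/= t0'.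
apply: le_trans (le_normr_Rintegral _ (int_x _ _ e0 t0)) _ => //.
rewrite -Rintegral_cst//; apply: le_Rintegral => //.
- by have := integrable_abse (int_x _ _ e0 t0); apply: eq_integrable.
- by apply: continuous_compact_integrableT => x; exact: cvg_cst.
- move=> x xK; rewrite normrM -[leRHS]mul1r ler_pM//; last exact: HB.
  by rewrite ger0_norm ?tail_prob_ge0 ?tail_prob_le1.
Qed.

Let int_bound C : lebesgue_measure.-integrable `]0, +oo[
  (EFin \o (fun t : R => C * \1_(`[0, M]) t)).
Proof.
have h := integrableZl measurableT C (@integrable_indic_itv R 0 M true false).
have h' : lebesgue_measure.-integrable [set: R]
    (EFin \o (fun t : R => C * \1_(`[0, M]) t)).
  by apply: eq_integrable h => // t _ /=; rewrite EFinM.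
exact: (integrableS _ _ _ h').
Qed.

Let intI eps : 0 < eps -> lebesgue_measure.-integrable `]0, +oo[ (EFin \o I eps).
Proof.
move=> e0; have [C HC] := I_bound.
apply: (le_integrable _ _ _ (int_bound C)) => //.
  by apply/measurable_EFinP; exact: mI.
move=> t Dt /=; rewrite lee_fin; apply: le_trans (HC _ _ e0 Dt) _.
exact: ler_norm.
Qed.

Lemma Rintegral_dtail eps t : 0 < eps -> 0 < t ->
  lebesgue_measure.-integrable [set: R]
    (EFin \o (fun x => dtail_prob a b ua ub e eps x t * phi x t)) /\
  \int[lebesgue_measure]_(x in [set: R]) (dtail_prob a b ua ub e eps x t * phi x t)
  = - I eps t.
Proof.
move=> e0 t0; have t0' := ltW t0.
have h : (fun x => dtail_prob a b ua ub e eps x t * phi x t) =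
  (fun x => dtail_prob a b ua ub e eps x t * phi x t) \_ `[- K, K].
  apply/funext => x; rewrite patchE; case: ifPn => //.
  rewrite notin_setE/= in_itv/= => /negP xK; rewrite phi0 ?mulr0//; left.
  rewrite ltNge; apply: contraNN xK => xM; rewrite -ler_norml.
  by rewrite (le_trans xM)// lerDl.
have ig : lebesgue_measure.-integrable `[- K, K]
    (EFin \o (fun x => dtail_prob a b ua ub e eps x t * phi x t)).
  apply: continuous_compact_integrableT => x; apply: cvgM.
    exact: continuous_dtail_prob.
  apply: differentiable_continuous; apply/derivable1_diffP.
  exact: test_derivable.
split; first by rewrite h -restrict_EFin; apply/integrable_restrict => //=; rewrite setTI.
rewrite h -Rintegral_mkcond dtail_prob_by_parts//.
- exact: test_derivable.
- exact: cpx_x.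
- by apply: phi0 => //; left; rewrite ger0_norm ?(ltW K0)// ltrDl.
- by apply: phi0 => //; left; rewrite normrN ger0_norm ?(ltW K0)// ltrDl.
Qed.

Variable gamma : R -> R.
Hypothesis gamma_splits : forall x t, 0 < t ->
  (x < gamma t -> outweighed a b ua ub t x (fun y => e <= y)) /\
  (gamma t < x -> outweighed a b ua ub t x (fun y => y <= e)).

Let I_cvg t : 0 < t -> I eps t @[eps --> 0^'+] --> - phi (gamma t) t.
Proof.
move=> t0; have t0' := ltW t0.
rewrite -(@Rintegral_derive1_beyond R (fun y => phi y t) K (gamma t) K0).
- apply: (Rintegral_cvg_at_right _ _ _ (fun x => `|px x t|)).
  + exact: measurable_itv.
  + move=> eps e0; apply: measurable_funTS; apply: continuous_measurable_fun => x.
    by apply: cvgM; [exact: continuous_tail_prob_x|exact: cpx_x].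
  + apply: measurable_funTS; apply: measurable_funM; last first.
      by apply: continuous_measurable_fun; exact: cpx_x.
    have -> : (fun x : R => (gamma t < x)%R%:R : R) = \1_(`]gamma t, +oo[).
      by apply/funext => x; rewrite indicE mem_setE in_itv/= andbT.
    exact: measurable_indic.
  + apply: (ae_neq (gamma t)) => x xg _; apply: cvgM; last exact: cvg_cst.
    have [h1 h2] := gamma_splits x t t0; case: (ltgtP x (gamma t)) xg => // h _.
      by apply: tail_prob_cvg0 => //; exact: h1.
    by apply: tail_prob_cvg1 => //; exact: h2.
  + apply: continuous_compact_integrableT => x.
    by apply: cvg_norm; exact: cpx_x.
  + move=> eps x e0 _; rewrite normrM ler_piMl//.
    by rewrite ger0_norm ?tail_prob_ge0 ?tail_prob_le1.
- exact: test_derivable.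
- exact: cpx_x.
- by move=> x xK; apply: phi0 => //; left; apply: lt_le_trans xK; rewrite ltrDl.
Qed.

Let J eps t : R :=
  \int[lebesgue_measure]_(x in [set: R]) (dtail_prob a b ua ub e eps x t * phi x t).

Let JE eps t : 0 < eps -> 0 < t -> J eps t = - I eps t.
Proof. by move=> e0 t0; have [] := Rintegral_dtail eps t e0 t0. Qed.

Let mJ eps : 0 < eps -> measurable_fun (`]0, +oo[%classic : set R) (J eps).
Proof.
move=> e0; have mN : measurable_fun (`]0, +oo[%classic : set R) (fun t => - I eps t).
  by apply: measurableT_comp => //; exact: mI.
apply: eq_measurable_fun mN => t; rewrite inE/= in_itv/= andbT => t0.
by rewrite JE.
Qed.

Let J_cvg t : 0 < t -> J eps t @[eps --> 0^'+] --> phi (gamma t) t.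
Proof.
move=> t0; rewrite -(opprK (phi _ _)).
have : - I eps t @[eps --> 0^'+] --> - - phi (gamma t) t.
  by apply: cvgN; exact: I_cvg.
apply: cvg_trans; apply: near_eq_cvg; near=> eps.
by rewrite JE//; near: eps; exact: nbhs_right_gt.
Unshelve. all: by end_near. Qed.

Lemma integrable_dtail eps : 0 < eps ->
  lebesgue_measure.-integrable `]0, +oo[ (EFin \o J eps).
Proof.
move=> e0; apply: (le_integrable _ _ _ (intI eps e0)) => //.
  by apply/measurable_EFinP; exact: mJ.
by move=> t /=; rewrite in_itv/= andbT => t0; rewrite lee_fin JE// normrN.
Qed.

(* A pointwise limit of measurable functions. *)
Let measurable_along :
  measurable_fun (`]0, +oo[%classic : set R) (fun t => phi (gamma t) t).
Proof.
apply: (measurable_fun_cvg (h := fun n => J n.+1%:R^-1)) => [n|t].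
  by apply: mJ; rewrite invr_gt0.
rewrite /= in_itv/= andbT => t0.
have /cvg_at_rightP := J_cvg _ t0; apply; split.
  by move=> n; rewrite invr_gt0.
exact: cvg_harmonic.
Qed.

(** Dominated convergence in t.  The values at t = 0, where the Hopf--Cole
formulas degenerate, form a null set. *)
Lemma Rintegral_dtail_cvg :
  \int[lebesgue_measure]_(t in `]0, +oo[) J eps t @[eps --> 0^'+] -->
  delta_curve gamma phi.
Proof.
have [C HC] := I_bound.
rewrite /delta_curve /Rintegral -integral_itv_obnd_cbnd; last first.
  by apply/measurable_EFinP; exact: measurable_along.
apply: (Rintegral_cvg_at_right _ _ _ (fun t => C * \1_(`[0, M]) t)).
- exact: measurable_itv.
- exact: mJ.
- exact: measurable_along.
- by apply: aeW => t; rewrite /= in_itv/= andbT; exact: J_cvg.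
- exact: int_bound.
- move=> eps t e0 Dt; have t0 : 0 < t by move: Dt; rewrite /= in_itv/= andbT.
  by rewrite JE// normrN; exact: HC.
Qed.

End one_particle.
End test.

(** The whole theorem at once: the six cases only have to exhibit fans and to
identify gamma_c and gamma_d. *)
Lemma limit_of_fan {R : realType} (a b c d ua ub rhoc rhod : R)
    (g1 g2 g3 g4 gamma_c gamma_d : R -> R) :
  a < c -> c < b -> b < d ->
  (forall t, 0 < t -> fan a b ua ub t (g1 t) (g2 t) (g3 t) (g4 t)) ->
  (forall t, 0 < t -> gamma_c t = Num.max (g2 t) (Num.min c (g3 t))) ->
  (forall t, 0 < t -> gamma_d t = Num.max d (g4 t)) ->
  vanishing_viscosity_limit a b c d ua ub rhoc rhod g1 g2 g3 g4 gamma_c gamma_d.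
Proof.
move=> ac cb bd F gc gd; have ab := lt_trans ac cb; split.
  move=> x t t0; have Ft := F t t0.
  have cvg_to y : concentrated a b ua ub t x y ->
      u_visc a b ua ub eps x t @[eps --> 0^'+] --> (x - y) / t.
    by move=> H; apply: u_visc_cvg.
  split; rewrite !in_itv/= ?andbT.
  - move=> H; suff : u_visc a b ua ub eps x t @[eps --> 0^'+] --> (x - x) / t.
      by rewrite subrr mul0r.
    apply: cvg_to.
    case/or3P: H => [h|/andP[h1 h2]|h].
    + exact: fan_concentrated_left Ft _ h.
    + exact: fan_concentrated_mid Ft _ h1 h2.
    + exact: fan_concentrated_right Ft _ h.
  - by move=> /andP[h1 h2]; apply: cvg_to; exact: fan_concentrated_a Ft _ h1 h2.
  - by move=> /andP[h1 h2]; apply: cvg_to; exact: fan_concentrated_b Ft _ h1 h2.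
move=> phi [sphi [M0 HM]].
pose M := `|M0|; have M_ge0 : 0 <= M := normr_ge0 _.
have phi0 x t : 0 <= t -> M < `|x| \/ M < t -> phi x t = 0.
  move=> t0 h; apply: HM => //; have := ler_norm M0.
  by rewrite -/M; case: h => h; [left|right]; lra.
have split_c x t : 0 < t ->
    (x < gamma_c t -> outweighed a b ua ub t x (fun y => c <= y)) /\
    (gamma_c t < x -> outweighed a b ua ub t x (fun y => y <= c)).
  by move=> t0; rewrite gc//; exact: fan_split_mid (F t t0) _ _ ac cb.
have split_d x t : 0 < t ->
    (x < gamma_d t -> outweighed a b ua ub t x (fun y => d <= y)) /\
    (gamma_d t < x -> outweighed a b ua ub t x (fun y => y <= d)).
  by move=> t0; rewrite gd//; exact: fan_split_right (F t t0) _ _ bd.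
have Lc := Rintegral_dtail_cvg phi M sphi M_ge0 phi0 a b ua ub c ab _ split_c.
have Ld := Rintegral_dtail_cvg phi M sphi M_ge0 phi0 a b ua ub d ab _ split_d.
have ic := integrable_dtail phi M sphi M_ge0 phi0 a b ua ub c ab.
have id := integrable_dtail phi M sphi M_ge0 phi0 a b ua ub d ab.
pose J e eps t : R := \int[lebesgue_measure]_(x in [set: R])
  (dtail_prob a b ua ub e eps x t * phi x t).
have L : rhoc * \int[lebesgue_measure]_(t in `]0, +oo[) J c eps t +
    rhod * \int[lebesgue_measure]_(t in `]0, +oo[) J d eps t @[eps --> 0^'+] -->
    rhoc * delta_curve gamma_c phi + rhod * delta_curve gamma_d phi.
  by apply: cvgD; (apply: cvgM; first exact: cvg_cst); [exact: Lc|exact: Ld].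
apply: cvg_trans L; apply: near_eq_cvg; near=> eps.
have e0 : 0 < eps by near: eps; exact: nbhs_right_gt.
have {}ic : lebesgue_measure.-integrable `]0, +oo[ (EFin \o J c eps) := ic eps e0.
have {}id : lebesgue_measure.-integrable `]0, +oo[ (EFin \o J d eps) := id eps e0.
have E t : 0 < t -> \int[lebesgue_measure]_(x in [set: R])
    (rho_visc a b c d ua ub rhoc rhod eps x t * phi x t) =
    rhoc * J c eps t + rhod * J d eps t.
  move=> t0; have [i1 _] := Rintegral_dtail phi M sphi M_ge0 phi0 a b ua ub c ab eps t e0 t0.
  have [i2 _] := Rintegral_dtail phi M sphi M_ge0 phi0 a b ua ub d ab eps t e0 t0.
  rewrite /J -Rintegral_lincomb//.
  by apply: eq_Rintegral => x _; rewrite rho_viscE//; ring.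
have E2 : \int[lebesgue_measure]_(t in `]0, +oo[) (rhoc * J c eps t + rhod * J d eps t) =
    rhoc * \int[lebesgue_measure]_(t in `]0, +oo[) J c eps t +
    rhod * \int[lebesgue_measure]_(t in `]0, +oo[) J d eps t.
  apply: Rintegral_lincomb; [exact: measurable_itv|exact: ic|exact: id].
have mE : measurable_fun (`]0, +oo[%classic : set R)
    (fun t => rhoc * J c eps t + rhod * J d eps t).
  apply: measurable_funD; apply: measurable_funM => //; apply/measurable_EFinP.
    exact: measurable_int ic.
  exact: measurable_int id.
rewrite -{}E2 [RHS]/Rintegral -integral_itv_obnd_cbnd.
  by congr fine; apply: eq_integral => t; rewrite inE/= in_itv/= andbT => t0; rewrite E.
apply/measurable_EFinP; apply: eq_measurable_fun mE => t.
by rewrite inE/= in_itv/= andbT => t0; rewrite E.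
Unshelve. all: by end_near. Qed.

(** * The theorem *)

Theorem theorem2p1 (R : realType) (a b c d ua ub rhoc rhod : R)
    (hac : a < c) (hcb : c < b) (hbd : b < d) :
  [/\ (ua < 0 -> 0 < ub ->
        vanishing_viscosity_limit a b c d ua ub rhoc rhod
          (Case1.gamma_a a ua) (still a) (still b) (Case1.gamma_b b ub)
          (Case1.gamma_c c) (Case1.gamma_d b d ub)),
      (0 < ua -> 0 < ub ->
        vanishing_viscosity_limit a b c d ua ub rhoc rhod
          (still a) (Case2.gamma_a a b ua ub)
          (Case2.gamma_b1 a b ua ub) (Case2.gamma_b2 a b ua ub)
          (Case2.gamma_c a b c ua ub) (Case2.gamma_d a b d ua ub)),
      (0 < ua -> ub < 0 -> 0 < ua + ub ->
        vanishing_viscosity_limit a b c d ua ub rhoc rhod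
          (still a) (Case3.gamma_a a b ua ub)
          (Case3.gamma_b1 a b ua ub) (Case3.gamma_b2 a b ua ub)
          (Case3.gamma_c a b c ua ub) (Case3.gamma_d a d ua ub))
    & [/\ (0 < ua -> ub < 0 -> ua + ub < 0 ->
            vanishing_viscosity_limit a b c d ua ub rhoc rhod
              (Case4.gamma_a1 a b ua ub) (Case4.gamma_a2 a b ua ub)
              (Case4.gamma_b a b ua ub) (still b)
              (Case4.gamma_c a b c ua ub) (Case4.gamma_d d)),
          (0 < ua -> ub < 0 -> ua + ub = 0 ->
            vanishing_viscosity_limit a b c d ua ub rhoc rhod
              (still a) (Case5.gamma_a a b ua ub)
              (Case5.gamma_b a b ua ub) (still b)
              (Case5.gamma_c a b c ua ub) (Case5.gamma_d d))
        & (ua < 0 -> ub < 0 ->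
            vanishing_viscosity_limit a b c d ua ub rhoc rhod
              (Case6.gamma_a1 a b ua ub) (Case6.gamma_a2 a b ua ub)
              (Case6.gamma_b a b ua ub) (still b)
              (Case6.gamma_c a b c ua ub) (Case6.gamma_d d))]].
Proof.
split; [| | |split].
- move=> ua0 ub0; apply: limit_of_fan => // t t0.
  + exact: (case1_fan a b c ua ub t).
  + exact: (case1_gamma_c a b c t).
  + exact: (case1_gamma_d b d ub t).
- move=> ua0 ub0; apply: limit_of_fan => // t t0.
  + exact: (case2_fan a b c ua ub t).
  + exact: (case2_gamma_c a b c ua ub t).
  + exact: (case2_gamma_d a b c d ua ub t).
- move=> ua0 ub0 us0; apply: limit_of_fan => // t t0.
  + exact: (case3_fan a b c ua ub t).
  + exact: (case3_gamma_c a b c ua ub t).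
  + exact: (case3_gamma_d a b c d ua ub t).
- move=> ua0 ub0 us0; apply: limit_of_fan => // t t0.
  + exact: (case4_fan a b c ua ub t).
  + exact: (case4_gamma_c a b c ua ub t).
  + exact: (still_gamma_d b d t).
- move=> ua0 ub0 us0; apply: limit_of_fan => // t t0.
  + exact: (case5_fan a b c ua ub t).
  + exact: (case5_gamma_c a b c ua ub t).
  + exact: (still_gamma_d b d t).
- move=> ua0 ub0; apply: limit_of_fan => // t t0.
  + exact: (case6_fan a b c ua ub t).
  + exact: (case6_gamma_c a b c ua ub t).
  + exact: (still_gamma_d b d t).
Qed.
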